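(* Let $d\ge1$, $0<s<\frac{1}{2}$ and let $\omega \subset \mathbb{R}^d$ be an open subset. If the fractional free Schrödinger equation $$\left\lbrace \begin{array}{ll} (\partial_t +i(-\Delta_x)^s)f(t,x)=u(t,x)\mathbf{1}_{\omega}(x), & x \in \mathbb{R}^d,\ t>0,\\ f|_{t=0}=f_0 \in L^2(\mathbb{R}^d),& \end{array}\right.$$ is exactly controllable from $\omega$ in time $T$ for some $T>0$, then the complement $\mathbb{R}^d \setminus \omega$ has empty interior.
   Context: $\mathbf{1}_\omega$ denotes the indicator function of $\omega$. The fractional Laplacian $(-\Delta_x)^s$ is the selfadjoint operator on $L^2(\mathbb{R}^d)$ given by the Fourier multiplier $|\xi|^{2s}$, with domain $\{f\in L^2(\mathbb{R}^d): |\xi|^{2s}\widehat f\in L^2(\mathbb{R}^d)\}$. Exact controllability: let $A$ be a selfadjoint operator on $L^2(\mathbb{R}^d)$ and $T>0$. The equation $\partial_t f+iAf=u\mathbf{1}_\omega$, $f|_{t=0}=f_0$, is exactly controllable from $\omega$ in time $T$ if for all $f_0,f_T \in L^2(\mathbb{R}^d)$ there exists $u \in L^2((0,T)\times\mathbb{R}^d)$, supported in $(0,T)\times\omega$, such that the mild solution $f(t)=e^{-itA}f_0+\int_0^t e^{-i(t-\tau)A}(\mathbf{1}_\omega u(\tau,\cdot))\,d\tau$ satisfies $f(T,\cdot)=f_T$. Here $A=(-\Delta_x)^s$. *)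

(* Defs.v *)
From HB Require Import structures.
From mathcomp Require Import all_boot all_order all_algebra.
From mathcomp Require Import complex.
From mathcomp Require Import all_classical all_reals all_analysis.
From mathcomp Require Import measurable_realfun.

Set Implicit Arguments.
Unset Strict Implicit.
Unset Printing Implicit Defensive.

Import Order.TTheory GRing.Theory Num.Theory.
Import numFieldNormedType.Exports.

Local Open Scope classical_set_scope.
Local Open Scope ring_scope.

(* R^d is ['rV[R]_d]. Its sigma-algebra is generated by the coordinates, so it
   is the Borel sigma-algebra. *)

Definition rV_display : measure_display.
Proof. exact: default_measure_display. Qed.

Section rV_measurable.
Context {R : realType} (n : nat).

Definition rV_coord (i : 'I_n) (v : 'rV[R]_n) : measurableTypeR R := v ord0 i.

Let rV_set0 : g_sigma_preimage rV_coord set0.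
Proof. exact: sigma_algebra0. Qed.

Let rV_setC A : g_sigma_preimage rV_coord A -> g_sigma_preimage rV_coord (~` A).
Proof. exact: sigma_algebraC. Qed.

Let rV_bigcup (F : (set 'rV[R]_n)^nat) :
  (forall i, g_sigma_preimage rV_coord (F i)) ->
  g_sigma_preimage rV_coord (\bigcup_i (F i)).
Proof. exact: sigma_algebra_bigcup. Qed.

HB.instance Definition _ := @isMeasurable.Build rV_display
  'rV[R]_n (g_sigma_preimage rV_coord) rV_set0 rV_setC rV_bigcup.

Lemma measurable_rV_coord (i : 'I_n) : measurable_fun setT (rV_coord i).
Proof.
move=> _ Y mY; rewrite setTI; apply: sub_sigma_algebra => /=.
rewrite -bigcup_seq/=; exists i => /=; first by rewrite mem_index_enum.
by exists Y => //; rewrite setTI.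
Qed.

Lemma measurable_fun_rV d (T : measurableType d) (f : T -> 'rV[R]_n) :
  (forall i, measurable_fun setT (rV_coord i \o f)) -> measurable_fun setT f.
Proof.
move=> mf _ A mA; rewrite setTI; move: A mA.
apply: smallest_sub; first split => /=.
- by rewrite preimage_set0.
- by move=> A mA; rewrite setTD preimage_setC; exact: measurableC.
- by move=> F mF; rewrite preimage_bigcup; exact: bigcup_measurable.
- rewrite -bigcup_seq => A [i _ [B mB <-]].
  by rewrite setTI -comp_preimage -[X in measurable X]setTI; exact: mf.
Qed.

End rV_measurable.

Section cons_rV.
Context {R : realType} (n : nat).

Definition cons_rV (p : measurableTypeR R * 'rV[R]_n) : 'rV[R]_n.+1 :=
  \row_i (if unlift ord0 i is Some j then p.2 ord0 j else p.1).

Definition uncons_rV (v : 'rV[R]_n.+1) : measurableTypeR R * 'rV[R]_n :=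
  (v ord0 ord0, \row_j v ord0 (lift ord0 j)).

Lemma cons_rVK : cancel cons_rV uncons_rV.
Proof.
case=> x v; rewrite /uncons_rV /cons_rV mxE unlift_none /=; congr (_, _).
by apply/rowP => j; rewrite !mxE liftK.
Qed.

Lemma measurable_cons_rV : measurable_fun setT cons_rV.
Proof.
apply: measurable_fun_rV => i.
rewrite (_ : _ \o _ = fun p => if unlift ord0 i is Some j then rV_coord j p.2
  else p.1); last by apply/funext => p /=; rewrite /rV_coord mxE.
case: unliftP => [j _|_]; last exact: measurable_fst.
exact: (measurableT_comp (measurable_rV_coord j) measurable_snd).
Qed.

Lemma measurable_uncons_rV : measurable_fun setT uncons_rV.
Proof.
apply/measurable_fun_pairP; split; first exact: (measurable_rV_coord ord0).
apply: measurable_fun_rV => i.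
rewrite (_ : _ \o _ = rV_coord (lift ord0 i)); first exact: measurable_rV_coord.
by apply/funext => v /=; rewrite /rV_coord mxE.
Qed.

End cons_rV.

Section lebesgue_cons.
Local Open Scope ereal_scope.
Context {R : realType} (n : nat).
Variable mu : {sigma_finite_measure set 'rV[R]_n -> \bar R}.

Definition lebesgue_cons : set 'rV[R]_n.+1 -> \bar R :=
  pushforward (@lebesgue_measure R \x mu) (@cons_rV R n).

Let lebesgue_cons0 : lebesgue_cons set0 = 0.
Proof. by rewrite /lebesgue_cons /pushforward preimage_set0 measure0. Qed.

Let lebesgue_cons_ge0 A : 0 <= lebesgue_cons A.
Proof. by rewrite /lebesgue_cons /pushforward; exact: measure_ge0. Qed.

Let lebesgue_cons_sigma_additive : semi_sigma_additive lebesgue_cons.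
Proof.
move=> F mF tF mUF; rewrite /lebesgue_cons /pushforward preimage_bigcup.
apply: measure_semi_sigma_additive.
- move=> k; rewrite -[X in measurable X]setTI.
  exact: (measurable_cons_rV measurableT (mF k)).
- apply/trivIsetP => /= i j _ _ ij; rewrite -preimage_setI.
  by move/trivIsetP : tF => /(_ _ _ _ _ ij) ->//; rewrite preimage_set0.
- rewrite -preimage_bigcup -[X in measurable X]setTI.
  exact: (measurable_cons_rV measurableT mUF).
Qed.

HB.instance Definition _ := isMeasure.Build _ _ _ lebesgue_cons
  lebesgue_cons0 lebesgue_cons_ge0 lebesgue_cons_sigma_additive.

Let lebesgue_cons_sigma_finite : sigma_finite setT lebesgue_cons.
Proof.
have /sigma_finiteP[F [TF ndF Foo]] := sigma_finiteT (@lebesgue_measure R).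
have /sigma_finiteP[G [TG ndG Goo]] := sigma_finiteT mu.
exists (fun k => @uncons_rV R n @^-1` (F k `*` G k)).
  rewrite -preimage_bigcup (_ : \bigcup_k (F k `*` G k) = setT) ?preimage_setT//.
  rewrite -setXTT TF TG predeqE => -[x y]; split.
    by move=> [k _ []/= ? ?]; split; exists k.
  move=> [/= [k _ Fkx] [l _ Gly]]; exists (maxn k l) => //; split.
  - by move: x Fkx; exact/subsetPset/ndF/leq_maxl.
  - by move: y Gly; exact/subsetPset/ndG/leq_maxr.
move=> k; have [mF Fk] := Foo k; have [mG Gk] := Goo k; split.
  rewrite -[X in measurable X]setTI.
  exact: (measurable_uncons_rV measurableT (measurableX mF mG)).
rewrite /lebesgue_cons /pushforward -comp_preimage.
rewrite (_ : _ \o _ = id); last by apply/funext => p /=; rewrite cons_rVK.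
by rewrite preimage_id product_measure1E// lte_mul_pinfty// ge0_fin_numE.
Qed.

HB.instance Definition _ := Measure_isSigmaFinite.Build _ _ _ lebesgue_cons
  lebesgue_cons_sigma_finite.

End lebesgue_cons.

Fixpoint lebesgue_rV {R : realType} (n : nat) :
    {sigma_finite_measure set 'rV[R]_n -> \bar R} :=
  match n with
  | 0 => dirac (0 : 'rV[R]_0)
  | m.+1 => lebesgue_cons (@lebesgue_rV R m)
  end.

Lemma measurable_box (R : realType) n (A : 'I_n -> set (measurableTypeR R)) :
  (forall i, measurable (A i)) ->
  measurable [set v : 'rV[R]_n | forall i, A i (v ord0 i)].
Proof.
move=> mA; rewrite (_ : [set v | _] =
  \bigcap_(i in [set: 'I_n]) (@rV_coord R n i @^-1` A i)); last first.
  by apply/seteqP; split => v /= Av i; [move=> _; exact: Av|exact: (Av i)].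
apply: fin_bigcap_measurable => // i _.
by rewrite -[X in measurable X]setTI; exact: measurable_rV_coord.
Qed.

Lemma lebesgue_rV_box (R : realType) n (A : 'I_n -> set (measurableTypeR R)) :
  (forall i, measurable (A i)) ->
  (lebesgue_rV n [set v : 'rV[R]_n | forall i, A i (v ord0 i)] =
   \prod_(i < n) lebesgue_measure (A i))%E.
Proof.
elim: n A => [|n IHn] A mA.
  by rewrite big_ord0 /= diracE mem_set// => -[].
rewrite big_ord_recl /= /lebesgue_cons /pushforward.
rewrite -(IHn (fun i => A (lift ord0 i)))// -product_measure1E//; last first.
  exact: (@measurable_box R n (fun i => A (lift ord0 i)) (fun i => mA _)).
congr (product_measure1 (@lebesgue_measure R) (@lebesgue_rV R n) _).
apply/seteqP; split => -[x v] /=.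
  move=> Av; split; first by have := Av ord0; rewrite mxE unlift_none.
  by move=> i; have := Av (lift ord0 i); rewrite mxE liftK.
move=> [A0 Av] i; rewrite mxE; case: unliftP => [j ->|->//]; exact: Av.
Qed.

(* Elements of L^2(mu; C) are represented by functions [T -> R[i]]; equality in
   L^2 is [ae_equal]. *)

Section L2.
Context d (T : measurableType d) (R : realType).
Variable mu : {measure set T -> \bar R}.
Implicit Types f g : T -> R[i].

Definition cmeasurable f : Prop :=
  measurable_fun setT (fun x => complex.Re (f x)) /\
  measurable_fun setT (fun x => complex.Im (f x)).

Definition L2norm f : \bar R := Lnorm mu 2%:E (fun x => (Normc.normc (f x))%:E).

Definition inL2 f : Prop := cmeasurable f /\ (L2norm f < +oo)%E.

Definition ae_equal f g : Prop := {ae mu, forall x, f x = g x}.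

Definition L2cvg (f_ : nat -> T -> R[i]) f : Prop :=
  L2norm (fun x => f_ n x - f x) @[n --> \oo] --> 0%E.

Definition cintegrable f : Prop :=
  mu.-integrable setT (fun x => (complex.Re (f x))%:E) /\
  mu.-integrable setT (fun x => (complex.Im (f x))%:E).

Definition cintegral f : R[i] :=
  (Rintegral mu setT (fun x => complex.Re (f x)) +i*
   Rintegral mu setT (fun x => complex.Im (f x)))%C.

End L2.

Section evolution.
Context d (T : measurableType d) (R : realType).
Variable mu : {measure set T -> \bar R}.

(* An unbounded operator A on L^2(mu; C) is given by its graph: [A f g] means
   that f is in the domain of A and A f = g. *)
Definition operator := (T -> R[i]) -> (T -> R[i]) -> Prop.

(* U t = e^{-itA}: U is a strongly continuous one-parameter unitary group with
   infinitesimal generator -iA. By Stone's theorem, for A selfadjoint such a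
   group exists and is unique up to a.e. equality. Nothing is required of
   [U t f] when f is not in L^2. Surjectivity of U t follows from [group_add]
   and [group_zero]. *)
Record unitary_group (A : operator) (U : R -> (T -> R[i]) -> (T -> R[i])) :
    Prop := {
  group_L2 : forall t f, inL2 mu f -> inL2 mu (U t f) ;
  group_linear : forall t (a : R[i]) f g, inL2 mu f -> inL2 mu g ->
    ae_equal mu (U t (fun x => a * f x + g x))
                (fun x => a * U t f x + U t g x) ;
  group_isometry : forall t f, inL2 mu f -> L2norm mu (U t f) = L2norm mu f ;
  group_zero : forall f, inL2 mu f -> ae_equal mu (U 0 f) f ;
  group_add : forall t r f, inL2 mu f ->
    ae_equal mu (U (t + r) f) (U t (U r f)) ;
  group_continuous : forall f, inL2 mu f ->
    L2norm mu (fun x => U t f x - f x) @[t --> (0 : R)] --> 0%E ;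
  group_generator : forall f g, inL2 mu f -> inL2 mu g ->
    (A f g <->
     L2norm mu (fun x => (h^-1)%:C%C * (U h f x - f x) - (- 'i%C * g x))
       @[h --> (0 : R)^'] --> 0%E) }.

(* I is the Bochner integral over D of g : D -> L^2(mu; C): there are simple
   functions s_n = \sum_(i < k n) \1_(E n i) v n i such that the integral over D
   of ||g - s_n|| tends to 0 and the integrals of the s_n tend to I. Since g is
   only specified up to null sets, ||g - s_n|| is not assumed measurable but is
   bounded a.e. by measurable functions h n whose integrals tend to 0. *)
Definition bochner_integral (D : set (measurableTypeR R))
    (g : R -> T -> R[i]) (I : T -> R[i]) : Prop :=
  inL2 mu I /\
  {ae @lebesgue_measure R, forall t, D t -> inL2 mu (g t)} /\
  exists (k : nat -> nat) (E : nat -> nat -> set (measurableTypeR R))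
    (v : nat -> nat -> T -> R[i]) (h : nat -> measurableTypeR R -> \bar R),
  [/\ forall n i, [/\ measurable (E n i), E n i `<=` D,
        (lebesgue_measure (E n i) < +oo)%E & inL2 mu (v n i)],
      forall n, measurable_fun D (h n) /\ (forall t, D t -> (0 <= h n t)%E),
      forall n, {ae @lebesgue_measure R, forall t, D t ->
        (L2norm mu (fun x => g t x -
           \sum_(i < k n) (\1_(E n i) t)%:C%C * v n i x)%R
         <= h n t)%E},
      (\int[@lebesgue_measure R]_(t in D) h n t)%E @[n --> \oo] --> 0%E &
      L2cvg mu (fun n x =>
        \sum_(i < k n) (fine (lebesgue_measure (E n i)))%:C%C * v n i x) I].

End evolution.

Section fourier.
Context {R : realType} {d : nat}.
Implicit Types (x xi : 'rV[R]_d) (f g : 'rV[R]_d -> R[i]).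

Definition dotp x xi : R := \sum_(i < d) x ord0 i * xi ord0 i.

(* The Euclidean norm; the library's norm on matrices is the sup norm. *)
Definition enorm xi : R := Num.sqrt (dotp xi xi).

Definition cis (theta : R) : R[i] := (cos theta +i* sin theta)%C.

Definition fourier_L1 f xi : R[i] :=
  cintegral (lebesgue_rV d) (fun x => cis (- dotp x xi) * f x).

(* g is the Fourier transform of f in L^2: the Fourier integral on the dense
   subspace of L^1 /\ L^2, extended to L^2 by continuity (Plancherel). *)
Definition is_fourier f g : Prop :=
  [/\ inL2 (lebesgue_rV d) f, inL2 (lebesgue_rV d) g &
  exists f_ : nat -> 'rV[R]_d -> R[i],
    [/\ forall n, cintegrable (lebesgue_rV d) (f_ n) /\
                  inL2 (lebesgue_rV d) (f_ n),
        L2cvg (lebesgue_rV d) f_ f &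
        L2cvg (lebesgue_rV d) (fun n => fourier_L1 (f_ n)) g]].

(* The Fourier multiplier |xi|^(2s); since both sides of [is_fourier] are in
   L^2, the domain is the set of f in L^2 such that |xi|^(2s) f^ is in L^2. *)
Definition frac_laplacian (s : R) : operator 'rV[R]_d R := fun f g =>
  exists fh, is_fourier f fh /\
             is_fourier g (fun xi => (enorm xi `^ (2 * s))%:C%C * fh xi).

End fourier.

Section control.
Context {R : realType} {d : nat}.
Local Notation E := ('rV[R]_d).
Local Notation leb := (lebesgue_rV d).

(* L^2((0, T) * R^d) is seen as a space of functions on R * R^d that vanish a.e.
   outside (0, T) * R^d. *)
Definition control (omega : set E) (T : R)
    (u : measurableTypeR R * E -> R[i]) : Prop :=
  inL2 (@lebesgue_measure R \x leb)%E u /\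
  {ae (@lebesgue_measure R \x leb)%E, forall z,
     ~ (0 < z.1 < T /\ omega z.2) -> u z = 0}.

(* f(t) = e^{-itA} f0 + \int_0^t e^{-i(t-tau)A} (1_omega u(tau, .)) dtau for t in
   [0, T], where U t = e^{-itA}. *)
Definition mild_solution (U : R -> (E -> R[i]) -> (E -> R[i]))
    (omega : set E) (T : R) (f0 : E -> R[i])
    (u : measurableTypeR R * E -> R[i]) (f : R -> E -> R[i]) : Prop :=
  forall t, 0 <= t <= T -> exists2 I,
    bochner_integral leb `]0, t[
      (fun tau => U (t - tau) (fun x => (\1_omega x)%:C%C * u (tau, x))) I &
    ae_equal leb (f t) (fun x => U t f0 x + I x).

Definition exactly_controllable (A : operator E R) (omega : set E) (T : R) :
    Prop :=
  exists2 U, unitary_group leb A U &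
  forall f0 fT, inL2 leb f0 -> inL2 leb fT ->
  exists u f, [/\ control omega T u, mild_solution U omega T f0 u f &
                  ae_equal leb (f T) fT].

End control.

(* Main.v *)
Require Import Defs.
From mathcomp Require Import all_boot all_order all_algebra.
From mathcomp Require Import complex.
From mathcomp Require Import all_classical all_reals all_analysis.
From mathcomp Require Import measurable_realfun.
From mathcomp Require Import ring lra.
Set Implicit Arguments.
Unset Strict Implicit.
Unset Printing Implicit Defensive.
Import Order.TTheory GRing.Theory Num.Theory.
Import numFieldNormedType.Exports.
Local Open Scope classical_set_scope.
Local Open Scope ring_scope.

(* Suppose that the complement of omega contains a ball around x0, and let
   U t = e^{-itA} with A = (-Delta)^s. For 2s < 1 the group velocity of
   |xi|^(2s) tends to 0 at infinity, so a packet g whose Fourier transform is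
   cis(- x0.xi) e^{-k |xi - q|_1}, with k small and then |q| large, is almost
   supported in the ball and ||A g - |q|^(2s) g|| is small: on [0, T], U t g is
   close to e^{-it |q|^(2s)} g and hardly meets omega. This gives unit vectors
   g_k with |Re <I, g_k>| <= C 9^-k for every state I reachable from 0, C
   depending on I only, whereas a gliding-hump construction yields f in L^2 with
   |Re <f, g_k>| >= 3^-k / 2 for all k; so f is not reachable. *)

(** * Complex-valued square-integrable functions *)

(** Controllability provides a control for each target but no bound on its cost, so the constant C
    attached to a reachable state is not uniform. The usual remedy, a closed-graph argument leading
    to an observability inequality, is replaced by a single target built against all packets at
    once; the rates 9^-k and 3^-k must differ in order to beat an arbitrary C.

    The group [U] is known only through its group law and its generator, so U t g is never computed
    by a multiplier: its distance to e^{-it lam} g is estimated from the difference quotient at time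
    0 and the residual h - lam g.

    The 1-norm in the exponential makes the packet a product over the coordinates, whose transform
    is an explicit product of Cauchy kernels; inversion and a Plancherel inequality are derived from
    these same kernels. In position, |g| is a multiple of a Cauchy kernel of width k around x0 and
    does not depend on q: localization and normalization are settled before q is chosen. The
    residual is controlled by concavity of t^(2s), which bounds the variation of the symbol by
    |q|^(2s-1) |xi - q|_1. *)

Notation Re := complex.Re.
Notation Im := complex.Im.

Section complex_norm.
Variable R : realType.
Implicit Types z w : R[i].

Definition sqn z : R := Re z ^+ 2 + Im z ^+ 2.

Lemma ReD z w : Re (z + w) = Re z + Re w.
Proof. by case: z; case: w. Qed.

Lemma ImD z w : Im (z + w) = Im z + Im w.
Proof. by case: z; case: w. Qed.

Lemma ReM z w : Re (z * w) = Re z * Re w - Im z * Im w.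
Proof. by case: z; case: w. Qed.

Lemma ImM z w : Im (z * w) = Re z * Im w + Im z * Re w.
Proof. by case: z; case: w. Qed.

Lemma ReN z : Re (- z) = - Re z. Proof. by case: z. Qed.

Lemma ImN z : Im (- z) = - Im z. Proof. by case: z. Qed.

Lemma complex_eq z w : Re z = Re w -> Im z = Im w -> z = w.
Proof. by case: z => a b; case: w => c e /= -> ->. Qed.

Lemma sqn_ge0 z : 0 <= sqn z.
Proof. by rewrite addr_ge0 ?sqr_ge0. Qed.

Lemma normc_sqr z : Normc.normc z ^+ 2 = sqn z.
Proof. by case: z => a b /=; rewrite sqr_sqrtr// addr_ge0 ?sqr_ge0. Qed.

Lemma normc_ge0 z : 0 <= Normc.normc z.
Proof. by case: z => a b /=; exact: sqrtr_ge0. Qed.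

Lemma sqnM z w : sqn (z * w) = sqn z * sqn w.
Proof. by rewrite /sqn ReM ImM; ring. Qed.

Lemma sqnN z : sqn (- z) = sqn z.
Proof. by rewrite /sqn ReN ImN !sqrrN. Qed.

Lemma sqn_real (a : R) : sqn a%:C%C = a ^+ 2.
Proof. by rewrite /sqn /= expr0n addr0. Qed.

Lemma sqn_cis (a : R) : sqn (cis a) = 1.
Proof. exact: cos2Dsin2. Qed.

Lemma sqnD_le z w : sqn (z + w) <= 2 * (sqn z + sqn w).
Proof.
case: z => a b; case: w => c e; rewrite /sqn/=.
have := sqr_ge0 (a - c); have := sqr_ge0 (b - e); lra.
Qed.

Lemma normc_sqrt z : Normc.normc z = Num.sqrt (sqn z).
Proof. by case: z. Qed.

Lemma normcN z : Normc.normc (- z) = Normc.normc z.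
Proof. by rewrite !normc_sqrt sqnN. Qed.

Lemma normc_cis (a : R) : Normc.normc (cis a) = 1.
Proof. by rewrite /cis /Normc.normc cos2Dsin2 sqrtr1. Qed.

Lemma normc_real (a : R) : Normc.normc (a%:C%C : R[i]) = `|a|.
Proof. by rewrite /Normc.normc /= expr0n addr0 sqrtr_sqr. Qed.

Lemma cisD (a b : R) : cis (a + b) = cis a * cis b.
Proof. by apply: complex_eq; rewrite ?ReM ?ImM /= ?cosD ?sinD; ring. Qed.

Lemma cis0 : cis (0 : R) = 1.
Proof. by rewrite /cis cos0 sin0. Qed.

Lemma abs_Re_le z : `|Re z| <= Normc.normc z.
Proof.
rewrite -(@ler_pXn2r _ 2) ?nnegrE ?normc_ge0// normc_sqr /sqn.
by rewrite -normrX ger0_norm ?sqr_ge0// lerDl sqr_ge0.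
Qed.

Lemma abs_Im_le z : `|Im z| <= Normc.normc z.
Proof.
rewrite -(@ler_pXn2r _ 2) ?nnegrE ?normc_ge0// normc_sqr /sqn.
by rewrite -normrX ger0_norm ?sqr_ge0// lerDr sqr_ge0.
Qed.

Lemma normc_le_ReIm z : Normc.normc z <= `|Re z| + `|Im z|.
Proof.
rewrite -(@ler_pXn2r _ 2) ?nnegrE ?normc_ge0 ?addr_ge0// normc_sqr /sqn.
rewrite sqrrD !real_normK ?num_real// -addrA [X in _ <= _ + X]addrC addrA lerDl.
by rewrite mulrn_wge0// mulr_ge0.
Qed.

End complex_norm.

Section L2_theory.
Context d (T : measurableType d) (R : realType).
Variable mu : {measure set T -> \bar R}.
Implicit Types (f g : T -> R[i]) (a : R[i]).

Lemma cmeasurableD f g : cmeasurable f -> cmeasurable g ->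
  cmeasurable (fun x => f x + g x).
Proof.
move=> [f1 f2] [g1 g2]; split.
  by under eq_fun do rewrite ReD; exact: measurable_funD.
by under eq_fun do rewrite ImD; exact: measurable_funD.
Qed.

Lemma cmeasurableM f g : cmeasurable f -> cmeasurable g ->
  cmeasurable (fun x => f x * g x).
Proof.
move=> [f1 f2] [g1 g2]; split.
  by under eq_fun do rewrite ReM; apply: measurable_funB; exact: measurable_funM.
by under eq_fun do rewrite ImM; apply: measurable_funD; exact: measurable_funM.
Qed.

Lemma cmeasurable_cst a : cmeasurable (fun _ : T => a).
Proof. by split; exact: measurable_cst. Qed.

Lemma cmeasurable_real (f : T -> R) : measurable_fun setT f ->
  cmeasurable (fun x => (f x)%:C%C).
Proof. by move=> mf; split => //=; exact: measurable_cst. Qed.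

Lemma cmeasurableZ a f : cmeasurable f -> cmeasurable (fun x => a * f x).
Proof. by move=> mf; apply: cmeasurableM => //; exact: cmeasurable_cst. Qed.

Lemma cmeasurableN f : cmeasurable f -> cmeasurable (fun x => - f x).
Proof.
by move=> /(cmeasurableZ (-1)); under eq_fun do rewrite mulN1r.
Qed.

Lemma cmeasurableB f g : cmeasurable f -> cmeasurable g ->
  cmeasurable (fun x => f x - g x).
Proof. by move=> mf /cmeasurableN; exact: cmeasurableD. Qed.

Lemma measurable_sqn f : cmeasurable f -> measurable_fun setT (fun x => sqn (f x)).
Proof. by move=> [f1 f2]; apply: measurable_funD; exact: measurable_funX. Qed.

Lemma measurable_normc f : cmeasurable f ->
  measurable_fun setT (fun x => Normc.normc (f x)).
Proof.
move=> /measurable_sqn mf.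
rewrite (_ : (fun _ => _) = (fun x => sqn (f x) `^ 2^-1)).
  exact: (measurableT_comp (measurable_powR _)) mf.
by apply/funext => x; rewrite powR12_sqrt ?sqn_ge0// -normc_sqr sqrtr_sqr ger0_norm ?normc_ge0.
Qed.

Definition N2 f : \bar R := (\int[mu]_x (sqn (f x))%:E)%E.

Lemma N2_ge0 f : (0 <= N2 f)%E.
Proof. by apply: integral_ge0 => x _; rewrite lee_fin sqn_ge0. Qed.

Lemma L2normE f : L2norm mu f = sqrte (N2 f).
Proof.
rewrite -poweR12_sqrt ?N2_ge0//.
rewrite /L2norm unlock; congr (_ `^ _)%E; apply: eq_integral => x _.
by rewrite abse_EFin ger0_norm ?normc_ge0// poweR_EFin powR_mulrn ?normc_ge0// normc_sqr.
Qed.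

Lemma L2norm_lty f : (L2norm mu f < +oo)%E = (N2 f < +oo)%E.
Proof.
by rewrite L2normE; case: (N2 f) (N2_ge0 f) => //= r _; rewrite !ltry.
Qed.

Lemma inL2P f : inL2 mu f <-> cmeasurable f /\ (N2 f < +oo)%E.
Proof. by rewrite /inL2 L2norm_lty. Qed.

(** [fine] sends +oo to 0, so this is the L^2 norm only for functions in L^2; hence the [inL2]
    hypotheses throughout. *)
Definition nrm f : R := Num.sqrt (fine (N2 f)).

Lemma nrm_ge0 f : 0 <= nrm f. Proof. exact: sqrtr_ge0. Qed.

Lemma inL2_N2 f : inL2 mu f -> N2 f = (nrm f ^+ 2)%:E.
Proof.
move=> /inL2P[_]; have := N2_ge0 f; rewrite /nrm.
by case: (N2 f) => //= r r0 _; rewrite sqr_sqrtr.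
Qed.

Lemma inL2_L2norm f : inL2 mu f -> L2norm mu f = (nrm f)%:E.
Proof.
move=> /inL2_N2 E; rewrite L2normE E /= sqrtr_sqr ger0_norm ?nrm_ge0//.
Qed.

Lemma eq_N2 f g : (forall x, sqn (f x) = sqn (g x)) -> N2 f = N2 g.
Proof. by move=> fg; apply: eq_integral => x _; rewrite fg. Qed.

Lemma ae_eq_N2 f g : cmeasurable f -> cmeasurable g -> ae_equal mu f g -> N2 f = N2 g.
Proof.
move=> mf mg fg; apply: ge0_ae_eq_integral => //.
- by apply/measurable_EFinP; exact: measurable_sqn.
- by apply/measurable_EFinP; exact: measurable_sqn.
- by move=> x _; rewrite lee_fin sqn_ge0.
- by move=> x _; rewrite lee_fin sqn_ge0.
- by apply: filterS fg => x /= ->.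
Qed.

Lemma le_N2 f g : cmeasurable f -> cmeasurable g ->
  (forall x, sqn (f x) <= sqn (g x)) -> (N2 f <= N2 g)%E.
Proof.
move=> mf mg fg; apply: ge0_le_integral => //.
- by move=> x _; rewrite lee_fin sqn_ge0.
- by apply/measurable_EFinP; exact: measurable_sqn.
- by apply/measurable_EFinP; exact: measurable_sqn.
- by move=> x _; rewrite lee_fin.
Qed.

Lemma inL2Z a f : inL2 mu f -> inL2 mu (fun x => a * f x).
Proof.
move=> /inL2P[mf Nf]; apply/inL2P; split; first exact: cmeasurableZ.
rewrite /N2; under eq_integral do rewrite sqnM EFinM.
rewrite ge0_integralZl//; first last.
- by rewrite lee_fin sqn_ge0.
- by move=> x _; rewrite lee_fin sqn_ge0.
- by apply/measurable_EFinP; exact: measurable_sqn.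
by rewrite lte_mul_pinfty// lee_fin sqn_ge0.
Qed.

Lemma inL2D f g : inL2 mu f -> inL2 mu g -> inL2 mu (fun x => f x + g x).
Proof.
move=> /inL2P[mf Nf] /inL2P[mg Ng]; apply/inL2P; split; first exact: cmeasurableD.
have mf' : measurable_fun setT (fun x => (sqn (f x))%:E).
  by apply/measurable_EFinP; exact: measurable_sqn.
have mg' : measurable_fun setT (fun x => (sqn (g x))%:E).
  by apply/measurable_EFinP; exact: measurable_sqn.
apply: (@le_lt_trans _ _ (\int[mu]_x (2%:E * ((sqn (f x))%:E + (sqn (g x))%:E)))%E).
  apply: ge0_le_integral => //.
  - by move=> x _; rewrite lee_fin sqn_ge0.
  - by apply/measurable_EFinP/measurable_sqn; exact: cmeasurableD.
  - by apply: measurable_funeM; exact: emeasurable_funD.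
  - by move=> x _; rewrite -EFinD -EFinM lee_fin sqnD_le.
rewrite ge0_integralZl//; first last.
- by move=> x _; rewrite -EFinD lee_fin addr_ge0 ?sqn_ge0.
- exact: emeasurable_funD.
rewrite ge0_integralD//; first last.
- by move=> x _; rewrite lee_fin sqn_ge0.
- by move=> x _; rewrite lee_fin sqn_ge0.
by rewrite lte_mul_pinfty// lte_add_pinfty.
Qed.

Lemma inL2N f : inL2 mu f -> inL2 mu (fun x => - f x).
Proof. by move=> /(inL2Z (-1)); under eq_fun do rewrite mulN1r. Qed.

Lemma inL2B f g : inL2 mu f -> inL2 mu g -> inL2 mu (fun x => f x - g x).
Proof. by move=> fL /inL2N; exact: inL2D. Qed.

Lemma inL2_0 : inL2 mu (fun=> 0).
Proof.
apply/inL2P; split; first exact: cmeasurable_cst.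
by rewrite /N2 integral0_eq// => x _; rewrite /sqn/= expr0n addr0.
Qed.

Lemma nrm_ae f g : inL2 mu f -> inL2 mu g -> ae_equal mu f g -> nrm f = nrm g.
Proof. by move=> [mf _] [mg _] fg; rewrite /nrm (ae_eq_N2 mf mg fg). Qed.

Lemma nrmZ a f : inL2 mu f -> nrm (fun x => a * f x) = Normc.normc a * nrm f.
Proof.
move=> fL; apply/eqP; rewrite -(@eqrXn2 _ 2) ?mulr_ge0 ?normc_ge0 ?nrm_ge0//.
rewrite exprMn normc_sqr; apply/eqP/EFin_inj.
rewrite -(inL2_N2 (inL2Z a fL)) EFinM -(inL2_N2 fL).
rewrite -ge0_integralZl//; first last.
- by rewrite lee_fin sqn_ge0.
- by move=> x _; rewrite lee_fin sqn_ge0.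
- by apply/measurable_EFinP; apply: measurable_sqn; case: fL.
by apply/eq_integral => x _; rewrite sqnM EFinM.
Qed.

(** The real part of the hermitian inner product. It induces the same norm, and a real scalar
    product is all that the duality argument uses. *)
Definition rip f g : R :=
  Rintegral mu setT (fun x => Re (f x) * Re (g x) + Im (f x) * Im (g x)).

Lemma rip_integrable f g : inL2 mu f -> inL2 mu g ->
  mu.-integrable setT (fun x => (Re (f x) * Re (g x) + Im (f x) * Im (g x))%:E).
Proof.
move=> /inL2P[[f1 f2] Nf] /inL2P[[g1 g2] Ng].
have mf' : measurable_fun setT (fun x => (sqn (f x))%:E).
  by apply/measurable_EFinP; exact: measurable_sqn.
have mg' : measurable_fun setT (fun x => (sqn (g x))%:E).
  by apply/measurable_EFinP; exact: measurable_sqn.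
have mfg : measurable_fun setT (fun x => Re (f x) * Re (g x) + Im (f x) * Im (g x)).
  by apply: measurable_funD; exact: measurable_funM.
apply: (@le_integrable _ _ _ mu _ measurableT _ (fun x => ((sqn (f x))%:E + (sqn (g x))%:E)%E)).
- exact/measurable_EFinP.
- move=> x _; rewrite -EFinD !abse_EFin lee_fin [leRHS]ger0_norm; last by rewrite addr_ge0 ?sqn_ge0.
  case: (f x) (g x) => a b [c e]; rewrite /sqn /= ler_norml.
  have := sqr_ge0 (a - c); have := sqr_ge0 (b - e).
  have := sqr_ge0 (a + c); have := sqr_ge0 (b + e).
  have := sqr_ge0 a; have := sqr_ge0 b; have := sqr_ge0 c; have := sqr_ge0 e => *.
  by apply/andP; split; lra.
apply: integrableD => //; apply/integrableP; split => //.
  by under eq_integral do rewrite abse_EFin ger0_norm ?sqn_ge0//.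
by under eq_integral do rewrite abse_EFin ger0_norm ?sqn_ge0//.
Qed.

Lemma rip_self f : inL2 mu f -> rip f f = nrm f ^+ 2.
Proof.
move=> fL; by rewrite -[RHS]/(fine (nrm f ^+ 2)%:E) -inL2_N2.
Qed.

Lemma ripDl f g h : inL2 mu f -> inL2 mu g -> inL2 mu h ->
  rip (fun x => f x + g x) h = rip f h + rip g h.
Proof.
move=> fL gL hL; rewrite /rip -RintegralD//; [|exact: rip_integrable..].
by apply: eq_Rintegral => x _; rewrite ReD ImD; ring.
Qed.

Lemma ripZl (c : R) f h : inL2 mu f -> inL2 mu h ->
  rip (fun x => c%:C%C * f x) h = c * rip f h.
Proof.
move=> fL hL; rewrite /rip -RintegralZl//; last exact: rip_integrable.
by apply: eq_Rintegral => x _; rewrite ReM ImM /=; ring.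
Qed.

Lemma ripC f h : rip f h = rip h f.
Proof. by apply: eq_Rintegral => x _; ring. Qed.

Lemma ripDr f g h : inL2 mu f -> inL2 mu g -> inL2 mu h ->
  rip h (fun x => f x + g x) = rip h f + rip h g.
Proof. by move=> fL gL hL; rewrite ripC ripDl// !(ripC _ h). Qed.

Lemma ripNl f h : inL2 mu f -> inL2 mu h -> rip (fun x => - f x) h = - rip f h.
Proof.
move=> fL hL; rewrite -mulN1r -ripZl//; congr rip; apply/funext => x.
by rewrite rmorphN1 mulN1r.
Qed.

Lemma ripBl f g h : inL2 mu f -> inL2 mu g -> inL2 mu h ->
  rip (fun x => f x - g x) h = rip f h - rip g h.
Proof. by move=> fL gL hL; rewrite ripDl ?ripNl//; exact: inL2N. Qed.

Lemma ripBr f g h : inL2 mu f -> inL2 mu g -> inL2 mu h ->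
  rip h (fun x => f x - g x) = rip h f - rip h g.
Proof. by move=> fL gL hL; rewrite ripC ripBl// !(ripC _ h). Qed.

Lemma nrm_sqrD f g : inL2 mu f -> inL2 mu g ->
  nrm (fun x => f x + g x) ^+ 2 = nrm f ^+ 2 + 2 * rip f g + nrm g ^+ 2.
Proof.
move=> fL gL; rewrite -!rip_self//; last exact: inL2D.
rewrite ripDl ?ripDr//; [|exact: inL2D..].
by rewrite (ripC g f); ring.
Qed.

(** Cauchy-Schwarz, from the nonnegativity of the quadratic polynomial t -> |t f + g|^2. *)
Lemma rip_le f g : inL2 mu f -> inL2 mu g -> `|rip f g| <= nrm f * nrm g.
Proof.
move=> fL gL; set a := nrm f; set b := nrm g; set c := rip f g.
have H t : 0 <= a ^+ 2 * t ^+ 2 + 2 * t * c + b ^+ 2.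
  have := sqr_ge0 (nrm (fun x => t%:C%C * f x + g x)).
  rewrite nrm_sqrD ?ripZl ?nrmZ ?normc_real//; last exact: inL2Z.
  by rewrite exprMn real_normK ?num_real// -/a -/b -/c; congr (_ <= _); ring.
have a0 : 0 <= a := nrm_ge0 f; have b0 : 0 <= b := nrm_ge0 g.
rewrite -(@ler_pXn2r _ 2) ?nnegrE ?mulr_ge0// real_normK ?num_real//.
have [a_eq0|a_neq0] := eqVneq a 0.
  have [->|c0] := eqVneq c 0; first by rewrite expr0n sqr_ge0.
  (* When |f| = 0 the polynomial is affine in t; this t gives it the value -1. *)
  have := H (- (b ^+ 2 + 1) / (2 * c)); rewrite a_eq0.
  rewrite [X in 0 <= X -> _](_ : _ = -1) ?ler0N1//.
  by field.
(* The minimizer of the polynomial. *)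
have := H (- c / a ^+ 2).
rewrite [X in 0 <= X -> _](_ : _ = (a ^+ 2 * b ^+ 2 - c ^+ 2) / a ^+ 2); last by field.
rewrite pmulr_lge0 ?invr_gt0 ?exprn_gt0 ?lt_def ?a_neq0//.
by rewrite subr_ge0 exprMn.
Qed.

Lemma nrmD f g : inL2 mu f -> inL2 mu g ->
  nrm (fun x => f x + g x) <= nrm f + nrm g.
Proof.
move=> fL gL; rewrite -(@ler_pXn2r _ 2) ?nnegrE ?addr_ge0 ?nrm_ge0//.
rewrite nrm_sqrD//; have := le_trans (ler_norm _) (rip_le fL gL); lra.
Qed.

Lemma nrm_le f g : inL2 mu f -> inL2 mu g ->
  (forall x, sqn (f x) <= sqn (g x)) -> nrm f <= nrm g.
Proof.
move=> fL gL fg; rewrite -(@ler_pXn2r _ 2) ?nnegrE ?nrm_ge0//.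
by rewrite -lee_fin -!inL2_N2//; apply: le_N2 => //; [case: fL|case: gL].
Qed.

Lemma nrm_ae0 f : inL2 mu f -> ae_equal mu f (fun=> 0) -> nrm f = 0.
Proof.
move=> fL f0; rewrite (nrm_ae fL inL2_0 f0) /nrm /N2 integral0_eq ?sqrtr0// => x _.
by rewrite /sqn/= expr0n addr0.
Qed.

Lemma rip_ae f g h : inL2 mu f -> inL2 mu g -> inL2 mu h -> ae_equal mu f g ->
  rip f h = rip g h.
Proof.
move=> fL gL hL fg; apply/eqP; rewrite -subr_eq0 -ripBl// -normr_le0.
have fgL := inL2B fL gL.
rewrite (le_trans (rip_le _ _))// nrm_ae0 ?mul0r//.
by apply: filterS fg => x /= ->; rewrite subrr.
Qed.

Lemma nrm_triangle f g h : inL2 mu f -> inL2 mu g -> inL2 mu h ->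
  nrm (fun x => f x - h x) <= nrm (fun x => f x - g x) + nrm (fun x => g x - h x).
Proof.
move=> fL gL hL; rewrite (_ : (fun x => f x - h x) = (fun x => (f x - g x) + (g x - h x))).
  by apply: nrmD; exact: inL2B.
by apply/funext => x; ring.
Qed.

End L2_theory.

(** * Quasimodes and controlled states *)

Lemma is_derive_diff_quotient (R : realType) (f : R -> R) (l : R) :
  is_derive (0 : R) 1 f l -> k^-1 * (f k - f 0) @[k --> (0 : R)^'] --> l.
Proof.
case=> df <-; have := df; rewrite /derivable => /cvgP; rewrite -/(derive f 0 1).
apply: cvg_trans; apply: near_eq_cvg; near=> k.
by rewrite /= /shift /= addr0 scaler1.
Unshelve. all: end_near. Qed.

Section unitary.
Context d (T : measurableType d) (R : realType).
Variable mu : {measure set T -> \bar R}.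
Variables (A : operator T R) (U : R -> (T -> R[i]) -> T -> R[i]).
Hypothesis UA : unitary_group mu A U.
Implicit Types (f g h : T -> R[i]).

Lemma unitary_nrm t f : inL2 mu f -> nrm mu (U t f) = nrm mu f.
Proof.
move=> fL; apply: EFin_inj; rewrite -!inL2_L2norm//.
- exact: group_isometry UA t f fL.
- exact: group_L2 UA t f fL.
Qed.

(** Polarization: the isometry applied to f + g, f and g leaves only the cross terms. *)
Lemma unitary_rip t f g : inL2 mu f -> inL2 mu g ->
  rip mu (U t f) (U t g) = rip mu f g.
Proof.
move=> fL gL; have UfL := group_L2 UA t fL; have UgL := group_L2 UA t gL.
have fgL := inL2D fL gL.
have E : nrm mu (fun x => U t f x + U t g x) = nrm mu (fun x => f x + g x).
  rewrite -(unitary_nrm t fgL); apply: nrm_ae.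
  - exact: inL2D.
  - exact: group_L2 UA _ _ fgL.
  - have := group_linear UA t 1 fL gL.
    under eq_fun do rewrite mul1r.
    by apply: filterS => x /= ->; rewrite mul1r.
have := nrm_sqrD UfL UgL; rewrite E nrm_sqrD// !unitary_nrm// => /addIr/addrI.
by move/mulfI => ->.
Qed.

(** Linearity is given for a f + g only; writing a g = (a - 1) g + g avoids evaluating the group at
    the zero function. *)
Lemma unitaryZ t g (a : R[i]) : inL2 mu g ->
  ae_equal mu (U t (fun x => a * g x)) (fun x => a * U t g x).
Proof.
move=> gL; have := group_linear UA t (a - 1) gL gL.
rewrite (_ : (fun x => (a - 1) * g x + g x) = (fun x => a * g x)); last first.
  by apply/funext => x; ring.
by apply: filterS => x /= ->; ring.
Qed.

Lemma unitaryB t f g (a : R[i]) : inL2 mu f -> inL2 mu g ->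
  ae_equal mu (U t (fun x => f x - a * g x)) (fun x => U t f x - a * U t g x).
Proof.
move=> fL gL; have := group_linear UA t (- a) gL fL.
rewrite (_ : (fun x => - a * g x + f x) = (fun x => f x - a * g x)); last first.
  by apply/funext => x; rewrite mulNr addrC.
by apply: filterS => x /= ->; rewrite mulNr addrC.
Qed.

Section quasimode.
Variables (g h : T -> R[i]) (lam : R).
Hypotheses (gL : inL2 mu g) (hL : inL2 mu h) (Agh : A g h).

(** The defect of e^{-i lam t} g as a solution. It is subadditive in t and its slope at 0 is at most
    [r], whence rho t <= t r. No derivative of U t g at t <> 0 is involved. *)
Let rho t := nrm mu (fun x => U t g x - cis (- lam * t) * g x).

Let r := nrm mu (fun x => h x - lam%:C%C * g x).

Let cgL a : inL2 mu (fun x => a * g x). Proof. exact: inL2Z. Qed.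
Let UgL t : inL2 mu (U t g). Proof. exact: (group_L2 UA). Qed.

Let rho0 : rho 0 = 0.
Proof.
rewrite /rho mulr0 cis0 (@nrm_ae _ _ _ _ _ (fun=> 0)).
- rewrite /nrm /N2 integral0_eq ?sqrtr0// => x _.
  by rewrite /sqn/= expr0n addr0.
- by apply: inL2B => //; exact: inL2Z.
- exact: inL2_0.
- by apply: filterS (group_zero UA gL) => x /= ->; rewrite mul1r subrr.
Qed.

Let rhoD s t : rho (s + t) <= rho s + rho t.
Proof.
rewrite /rho -[X in _ <= _ + X](unitary_nrm s); last exact: inL2B.
rewrite -[X in _ <= X + _]mul1r -(normc_cis (- lam * t)) -nrmZ; last exact: inL2B.
rewrite (@nrm_ae _ _ _ _ _ (fun x => cis (- lam * t) * (U s g x - cis (- lam * s) * g x)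
  + U s (fun x => U t g x - cis (- lam * t) * g x) x)).
- apply: nrmD; first by apply/inL2Z/inL2B.
  by apply: (group_L2 UA); exact: inL2B.
- exact: inL2B.
- apply: inL2D; first by apply/inL2Z/inL2B.
  by apply: (group_L2 UA); exact: inL2B.
- have := group_add UA s t gL; have := unitaryB s (cis (- lam * t)) (UgL t) gL.
  apply: filterS2 => x /= -> ->; rewrite mulrDr cisD; ring.
Qed.

Let rho_mul n t : rho (n%:R * t) <= n%:R * rho t.
Proof.
elim: n => [|n IH]; first by rewrite !mul0r rho0.
rewrite -[n.+1]addn1 natrD !mulrDl !mul1r; apply: le_trans (rhoD _ _) _.
by rewrite lerD2r.
Qed.

Let cis_diff : Normc.normc ((k^-1)%:C%C * (cis (- lam * k) - 1) + 'i%C * lam%:C%C)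
   @[k --> (0 : R)^'] --> (0 : R).
Proof.
have dc : k^-1 * (cos (- lam * k) - 1) @[k --> (0 : R)^'] --> (0 : R).
  have : is_derive (0 : R) 1 (fun k : R => cos (- lam * k)) 0.
    by apply: is_derive_eq; rewrite mulr0 sin0 oppr0 mul0r.
  by move=> /is_derive_diff_quotient; rewrite mulr0 cos0.
have ds : k^-1 * (sin (- lam * k)) @[k --> (0 : R)^'] --> (- lam : R).
  have : is_derive (0 : R) 1 (fun k : R => sin (- lam * k)) (- lam).
    by apply: is_derive_eq; rewrite mulr0 cos0 mul1r /GRing.scale/= mulr1.
  by move=> /is_derive_diff_quotient; rewrite mulr0 sin0; under eq_fun do rewrite subr0.
apply: (@squeeze_cvgr _ _ _ _ (fun=> 0) (fun k => `|k^-1 * (cos (- lam * k) - 1)| +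
   `|k^-1 * (sin (- lam * k)) + lam|)).
- near=> k; apply/andP; split; first exact: normc_ge0.
  apply: (le_trans (normc_le_ReIm _)).
  apply: lerD; rewrite le_eqVlt; apply/orP; left; apply/eqP; congr (`|_|);
    rewrite /cis/=; ring.
- exact: cvg_cst.
- have H := cvgD (cvg_norm dc) (cvg_norm (cvgD ds (cvg_cst lam))).
  by rewrite addNr normr0 addr0 in H; exact: H.
Unshelve. all: end_near. Qed.

Let rho_small e : 0 < e -> \forall k \near (0 : R)^', rho k <= `|k| * (r + e).
Proof.
move=> e0; have e20 : 0 < e / 2 by rewrite divr_gt0.
have /(group_generator UA gL hL) := Agh.
move=> /fine_cvgP[_] /cvgrPdist_lt /(_ _ e20) H1.
(* The summand 1 covers the case |g| = 0, which is not excluded. *)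
have g0 : 0 < nrm mu g + 1 by rewrite ltr_wpDl ?nrm_ge0.
have e30 : 0 < e / 2 / (nrm mu g + 1) by rewrite divr_gt0.
have := cis_diff => /cvgrPdist_lt /(_ _ e30) H2.
have H3 : \forall k \near (0 : R)^', k != 0 by exact: nbhs_dnbhs_neq.
apply: filterS3 H1 H2 H3 => k F1 c1 k0; rewrite /comp in F1.
pose F x := (k^-1)%:C%C * (U k g x - g x) - (- 'i%C * h x).
have FL : inL2 mu F.
  apply: inL2B; last exact: inL2Z.
  by apply/inL2Z/inL2B => //; exact: UgL.
rewrite -/F inL2_L2norm// sub0r normrN/= ger0_norm ?nrm_ge0// in F1.
pose c := (k^-1)%:C%C * (cis (- lam * k) - 1) + 'i%C * lam%:C%C.
rewrite -/c sub0r normrN ger0_norm ?normc_ge0// in c1.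
(* Both difference quotients are subtracted from their limits: [F] is the error for U k g, of limit
   -i h, and [c] the error for e^{-i lam k}, of limit -i lam. What remains is -i (h - lam g), of
   norm [r]. *)
rewrite /rho (_ : (fun x => _) = (fun x => k%:C%C *
    (F x + (- 'i%C * (h x - lam%:C%C * g x) + (- c) * g x)))); last first.
  apply/funext => x; rewrite /F /c.
  have kk : k%:C%C * (k^-1)%:C%C = 1 :> R[i] by rewrite -rmorphM/= divff.
  set a := (k^-1)%:C%C; set b := k%:C%C in kk *.
  rewrite [RHS](_ : _ = (b * a) * (U k g x - cis (- lam * k) * g x)); last by ring.
  by rewrite kk mul1r.
have hgL : inL2 mu (fun x => h x - lam%:C%C * g x) by exact: inL2B.
rewrite nrmZ; last by apply: inL2D => //; apply: inL2D; exact: inL2Z.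
rewrite normc_real ler_wpM2l//.
apply: le_trans (nrmD _ _) _ => //; first by apply: inL2D; exact: inL2Z.
rewrite addrC [e]splitr addrA lerD//; last exact: ltW.
apply: le_trans (nrmD _ _) _; [exact: inL2Z..|].
rewrite !nrmZ// !normcN lerD//.
  by rewrite /= expr0n expr1n add0r sqrtr1 mul1r.
rewrite -(mulrC (nrm mu g)) (le_trans (_ : _ <= (nrm mu g + 1) * (e / 2 / (nrm mu g + 1))))//.
  by apply: ler_pM; rewrite ?nrm_ge0 ?normc_ge0 ?lerDl// ltW.
by rewrite mulrC divfK// gt_eqF.
Qed.

Lemma quasimode t : 0 <= t ->
  nrm mu (fun x => U t g x - cis (- lam * t) * g x) <=
  t * nrm mu (fun x => h x - lam%:C%C * g x).
Proof.
rewrite -/(rho t) -/r le_eqVlt => /predU1P[<-|t0]; first by rewrite rho0 mul0r.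
apply/ler_addgt0Pr => e e0.
(* [0, t] is cut into n steps short enough for [rho_small]; an error (t / n) (e / t) in each of them
   adds up to e. *)
have et0 : 0 < e / t by rewrite divr_gt0.
have [/= dlt dlt0 H] := rho_small et0.
have := archi_boundP (ltW (divr_gt0 t0 dlt0)).
set n := Num.bound _ => ndlt.
have n0 : 0 < n%:R :> R by apply: lt_trans ndlt; rewrite divr_gt0.
have tn0 : 0 < t / n%:R by rewrite divr_gt0.
have := H (t / n%:R); rewrite /ball_/= sub0r normrN gtr0_norm// => Hn0.
have Hn : rho (t / n%:R) <= t / n%:R * (r + e / t).
  by apply: Hn0; rewrite ?gt_eqF// ltr_pdivrMr// mulrC -ltr_pdivrMr.
have -> : t = n%:R * (t / n%:R) by rewrite mulrC divfK// gt_eqF.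
apply: le_trans (rho_mul _ _) _; apply: le_trans (ler_wpM2l (ltW n0) Hn) _.
by rewrite le_eqVlt; apply/orP; left; apply/eqP; field; rewrite !gt_eqF.
Qed.

End quasimode.
End unitary.

(** * Pairing a Bochner integral with a fixed function *)

Section bochner.
Context d (T : measurableType d) (R : realType).
Variable mu : {measure set T -> \bar R}.
Local Notation leb := (@lebesgue_measure R).

Lemma inL2_sum k (c : nat -> R[i]) (v : nat -> T -> R[i]) :
  (forall i, inL2 mu (v i)) -> inL2 mu (fun x => \sum_(i < k) c i * v i x).
Proof.
move=> vL; elim: k => [|k IH].
  by under eq_fun do rewrite big_ord0; exact: inL2_0.
under eq_fun do rewrite big_ord_recr/=.
by apply: inL2D => //; exact: inL2Z.
Qed.

Lemma rip_suml k (c : nat -> R) (v : nat -> T -> R[i]) g :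
  (forall i, inL2 mu (v i)) -> inL2 mu g ->
  rip mu (fun x => \sum_(i < k) (c i)%:C%C * v i x) g =
  \sum_(i < k) c i * rip mu (v i) g.
Proof.
move=> vL gL; elim: k => [|k IH].
  under eq_fun do rewrite big_ord0.
  by rewrite big_ord0 /rip /Rintegral integral0_eq// => x _; rewrite !mul0r addr0.
under eq_fun do rewrite big_ord_recr/=.
rewrite ripDl ?ripZl ?IH ?big_ord_recr//; last exact: inL2Z.
exact: (inL2_sum k (fun i => (c i)%:C%C) vL).
Qed.

Lemma bochner_rip_le (D : set (measurableTypeR R)) F I g
    (b : measurableTypeR R -> \bar R) :
  measurable D -> inL2 mu g -> bochner_integral mu D F I ->
  measurable_fun D b -> (forall t, D t -> (0 <= b t)%E) ->
  {ae leb, forall t, D t -> (`|rip mu (F t) g|%:E <= b t)%E} ->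
  (`|rip mu I g|%:E <= \int[leb]_(t in D) b t)%E.
Proof.
move=> mD gL [IL [FL [k [E [v [h [HE Hh gh h0 Ic]]]]]]] mb b0 Fb.
(* An infinite bound is trivial; a finite one makes the final passage to the limit in a sum
   legitimate. *)
have [->|bfin] := eqVneq (\int[leb]_(t in D) b t)%E +oo%E; first exact: leey.
have bint : (\int[leb]_(t in D) b t)%E \is a fin_num.
  by rewrite ge0_fin_numE ?integral_ge0// ltey.
have vL n i : inL2 mu (v n i) by case: (HE n i).
pose S n x := \sum_(i < k n) (fine (leb (E n i)))%:C%C * v n i x.
have SL n : inL2 mu (S n) := inL2_sum (k n) (fun i => (fine (leb (E n i)))%:C%C) (vL n).
pose s n t x := \sum_(i < k n) (\1_(E n i) t)%:C%C * v n i x.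
have sL n t : inL2 mu (s n t) := inL2_sum (k n) (fun i => (\1_(E n i) t)%:C%C) (vL n).
have intE n i : leb.-integrable D (fun t => (\1_(E n i) t)%:E).
  have [mE ED Eoo _] := HE n i; apply/integrableP; split.
    by apply/measurable_EFinP; exact: measurable_indic.
  under eq_integral do rewrite abse_EFin ger0_norm//.
  by rewrite integral_indic// (le_lt_trans _ Eoo)// le_measure ?inE//; exact: measurableI.
have mrs n : measurable_fun D (fun t => rip mu (s n t) g).
  rewrite /s; under eq_fun do rewrite (rip_suml (k n) (fun i => \1_(E n i) _) (vL n) gL).
  apply: measurable_sum => i; apply: measurable_funM => //.
  by apply: measurable_indic; case: (HE n i).
have ripS n : (rip mu (S n) g)%:E = (\int[leb]_(t in D) (rip mu (s n t) g)%:E)%E.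
  rewrite /S (rip_suml (k n) (fun i => fine (leb (E n i))) (vL n) gL).
  rewrite /s; under eq_integral do rewrite (rip_suml (k n) (fun i => \1_(E n i) _) (vL n) gL) -sumEFin.
  rewrite integral_sum//; last first.
    move=> i; under eq_fun do rewrite EFinM muleC.
    by apply: integrableZl => //; exact: intE.
  rewrite -sumEFin; apply: eq_bigr => i _.
  under eq_integral do rewrite EFinM muleC.
  rewrite integralZl//; have [mE ED Eoo _] := HE n i.
  have EF : leb (E n i) \is a fin_num by rewrite ge0_fin_numE.
  by rewrite integral_indic// setIidl// EFinM muleC (fineK EF).
have key n : (`|rip mu (S n) g|%:E <=
    \int[leb]_(t in D) b t + (nrm mu g)%:E * \int[leb]_(t in D) h n t)%E.
  rewrite -abse_EFin ripS; apply: le_trans (le_abse_integral _ mD _) _.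
    exact/measurable_EFinP.
  have [mh hn0] := Hh n.
  rewrite -ge0_integralZl ?lee_fin ?nrm_ge0// -ge0_integralD//; last 2 first.
  - by move=> t Dt; rewrite mule_ge0 ?lee_fin ?nrm_ge0 ?hn0.
  - exact: measurable_funeM.
  apply: ae_ge0_le_integral => //.
  - by apply: measurableT_comp => //; exact/measurable_EFinP.
  - by move=> t Dt; rewrite adde_ge0 ?b0// mule_ge0 ?lee_fin ?nrm_ge0 ?hn0.
  - by apply: emeasurable_funD => //; exact: measurable_funeM.
  apply: filterS3 Fb (gh n) FL => t /= bt ht Ft Dt.
  have FtL := Ft Dt.
  have -> : rip mu (s n t) g = rip mu (F t) g - rip mu (fun x => F t x - s n t x) g.
    by rewrite ripBl//; ring.
  apply: (@le_trans _ _ (`|rip mu (F t) g|%:E + (nrm mu g * nrm mu (fun x => F t x - s n t x))%:E)%E).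
    rewrite -EFinD lee_fin (le_trans (ler_normB _ _))// lerD2l mulrC.
    by apply: rip_le => //; exact: inL2B.
  apply: leeD; first exact: bt.
  rewrite EFinM lee_wpmul2l ?lee_fin ?nrm_ge0// -inL2_L2norm; first exact: ht.
  exact: inL2B.
have key2 n : (`|rip mu I g|%:E <= \int[leb]_(t in D) b t +
   (nrm mu g)%:E * (\int[leb]_(t in D) h n t + L2norm mu (fun x => (S n x - I x)%R)))%E.
  have SIL : inL2 mu (fun x => S n x - I x) by exact: inL2B.
  rewrite inL2_L2norm// ge0_muleDr ?lee_fin ?nrm_ge0//; last first.
    by apply: integral_ge0; case: (Hh n).
  rewrite addeA; apply: (@le_trans _ _ (`|rip mu (S n) g|%:E + (nrm mu g * nrm mu (fun x => (S n x - I x)%R))%:E)%E).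
    rewrite -EFinD lee_fin.
    have -> : rip mu I g = rip mu (S n) g - rip mu (fun x => S n x - I x) g.
      by rewrite ripBl//; ring.
    rewrite (le_trans (ler_normB _ _))// lerD2l mulrC.
    exact: rip_le.
  by rewrite EFinM; apply: leeD => //; exact: key.
apply: (cvge_ge (F := \oo) (f := fun n => (\int[leb]_(t in D) b t +
   (nrm mu g)%:E * (\int[leb]_(t in D) h n t + L2norm mu (fun x => (S n x - I x)%R)))%E)).
  exact: nearW.
rewrite -[X in _ --> X]adde0; apply: cvgeD; first by rewrite fin_num_adde_defl.
  exact: cvg_cst.
rewrite -[X in _ --> X](mule0 (nrm mu g)%:E); apply: cvgeZl => //.
by rewrite -[X in _ --> X]adde0; apply: cvgeD.
Qed.

End bochner.

(** * Pairing a controlled state with a quasimode *)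

Section control_bound.
Context d (T : measurableType d) (R : realType).
Variable mu : {sigma_finite_measure set T -> \bar R}.
Local Notation leb := (@lebesgue_measure R).
Variables (A : operator T R) (U : R -> (T -> R[i]) -> T -> R[i]).
Hypothesis UA : unitary_group mu A U.

Lemma cmeasurable_indicM (om : set T) f : measurable om -> cmeasurable f ->
  cmeasurable (fun x => (\1_om x)%:C%C * f x : R[i]).
Proof.
by move=> mom mf; apply: cmeasurableM => //; exact/cmeasurable_real/measurable_indic.
Qed.

Lemma sqn_indicM (om : set T) (f : T -> R[i]) x :
  sqn ((\1_om x)%:C%C * f x) <= sqn (f x).
Proof.
rewrite sqnM sqn_real ler_piMl ?sqn_ge0// expr_le1// indicE; case: (_ \in _) => //.
Qed.

Lemma inL2_indicM (om : set T) f : measurable om -> inL2 mu f ->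
  inL2 mu (fun x => (\1_om x)%:C%C * f x).
Proof.
move=> mom /inL2P[mf Nf]; apply/inL2P; split; first exact: cmeasurable_indicM.
by apply: le_lt_trans (le_N2 _ _ _ _) Nf => //; [exact: cmeasurable_indicM|exact: sqn_indicM].
Qed.

(** With c = e^{i lam t}, g = c U t g - c (U t g - e^{-i lam t} g). In the first term unitarity
    removes U t, and the indicator moves from a to g; the second is the defect of the quasimode.
    Neither an adjoint nor an inverse of U t is used. *)
Lemma quasimode_rip_le (om : set T) a g h lam t : measurable om ->
  inL2 mu a -> inL2 mu g -> inL2 mu h -> A g h -> 0 <= t ->
  `|rip mu (U t (fun x => (\1_om x)%:C%C * a x)) g| <=
  nrm mu a * (nrm mu (fun x => (\1_om x)%:C%C * g x) +
              t * nrm mu (fun x => h x - lam%:C%C * g x)).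
Proof.
move=> mom aL gL hL Agh t0; set a' := fun x => _ * a x.
have a'L : inL2 mu a' by exact: inL2_indicM.
have na' : nrm mu a' <= nrm mu a.
  by apply: nrm_le => // x; exact: sqn_indicM.
pose c := cis (lam * t).
have cc : c * cis (- lam * t) = 1 by rewrite -cisD mulNr addrN cis0.
have UaL := group_L2 UA t a'L; have UgL := group_L2 UA t gL.
have cgL b : inL2 mu (fun x => b * g x) by exact: inL2Z.
have EcU : rip mu (U t a') (U t (fun x => c * g x)) = rip mu (U t a') (fun x => c * U t g x).
  rewrite ripC [RHS]ripC; apply: rip_ae => //; last exact: (unitaryZ UA).
  - exact: group_L2 UA _ _ _.
  - exact: inL2Z.
have -> : rip mu (U t a') g = rip mu (U t a') (U t (fun x => c * g x)) -
   rip mu (U t a') (fun x => c * (U t g x - cis (- lam * t) * g x)).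
  rewrite EcU -ripBr//; [|exact: inL2Z|by apply/inL2Z/inL2B].
  congr (rip _ _ _); apply/funext => x.
  by rewrite mulrBr opprB mulrA cc mul1r addrC subrK.
rewrite (unitary_rip UA)// mulrDr (le_trans (ler_normB _ _))// lerD//.
  have -> : rip mu a' (fun x => c * g x) = rip mu a (fun x => c * ((\1_om x)%:C%C * g x)).
    apply: eq_Rintegral => x _; rewrite /a'.
    by move: (\1_om x) (a x) (g x) c {cc EcU} => i [a1 a2] [g1 g2] [c1 c2] /=; ring.
  apply: le_trans (rip_le _ _) _ => //; first by apply/inL2Z/inL2_indicM.
  by rewrite nrmZ ?normc_cis ?mul1r//; exact: inL2_indicM.
apply: le_trans (rip_le _ _) _ => //; first by apply/inL2Z/inL2B.
rewrite (unitary_nrm UA)// nrmZ ?normc_cis ?mul1r//; last exact: inL2B.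
apply: ler_pM; rewrite ?nrm_ge0//.
exact: (quasimode UA lam gL hL Agh).
Qed.

(** C is chosen before g, h, lam and eps: it depends on the control only, which allows one reachable
    state to be tested against a whole sequence of packets. *)
Lemma control_rip_le (om : set T) (T0 : R) (u : measurableTypeR R * T -> R[i]) I :
  measurable om -> 0 < T0 -> inL2 (leb \x mu)%E u ->
  bochner_integral mu `]0, T0[
    (fun tau => U (T0 - tau) (fun x => (\1_om x)%:C%C * u (tau, x))) I ->
  exists C : R, forall g h lam eps, inL2 mu g -> inL2 mu h -> A g h -> 0 < eps ->
    nrm mu (fun x => (\1_om x)%:C%C * g x) +
      T0 * nrm mu (fun x => h x - lam%:C%C * g x) <= eps ->
    `|rip mu I g| <= eps * C.
Proof.
move=> mom T00 uL BI; exists (T0 + fine (N2 (leb \x mu)%E u)).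
move=> g h lam eps gL hL Agh eps0 Heps.
have mu' : measurable_fun setT (fun z => (sqn (u z))%:E).
  by apply/measurable_EFinP; apply: measurable_sqn; case: uL.
have mN : measurable_fun setT (fun tau => N2 mu (fun x => u (tau, x))).
  apply: (@measurable_fun_fubini_tonelli_F _ _ _ _ _ mu (fun z => (sqn (u z))%:E)) => // z.
  by rewrite lee_fin sqn_ge0.
have NE : N2 (leb \x mu)%E u = (\int[leb]_tau N2 mu (fun x => u (tau, x)))%E.
  by rewrite /N2 fubini_tonelli1// => z; rewrite lee_fin sqn_ge0.
(* From y <= 1 + y^2 with y the norm of the slice u(tau, .). Integrating 1 + y^2 over (0, T0) gives
   the constant T0 + |u|^2 announced above. *)
pose b tau := (eps%:E * (1 + N2 mu (fun x => u (tau, x))))%E.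
rewrite -lee_fin; apply: (le_trans (bochner_rip_le (b := b) _ gL BI _ _ _)) => //.
- by apply: measurable_funeM; apply: emeasurable_funD => //; exact: measurable_funTS.
- move=> t _; apply: mule_ge0; first by rewrite lee_fin ltW.
  by rewrite adde_ge0// N2_ge0.
- apply: nearW => tau /=; rewrite in_itv/= => /andP[tau0 tauT].
  (* A slice that is not in L^2 is not discarded as part of a null set: there b is +oo and the bound
     is trivial. *)
  have [Nu|Nu] := ltP (N2 mu (fun x => u (tau, x))) +oo%E; last first.
    move: Nu; rewrite leye_eq /b => /eqP ->.
    by rewrite addey// gt0_muley ?leey// lte_fin.
  have aL : inL2 mu (fun x => u (tau, x)).
    apply/inL2P; split=> //; case: uL => -[u1 u2] _.
    by split; [exact: (measurableT_comp u1 (pair1_measurable tau))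
      |exact: (measurableT_comp u2 (pair1_measurable tau))].
  rewrite /b inL2_N2// -EFinD -EFinM lee_fin.
  apply: (le_trans (quasimode_rip_le lam mom aL gL hL Agh _)); first by rewrite subr_ge0 ltW.
  rewrite mulrC; apply: ler_pM; rewrite ?addr_ge0 ?mulr_ge0 ?nrm_ge0 ?subr_ge0 ?(ltW tauT)//.
    apply: le_trans Heps; rewrite lerD2l ler_wpM2r ?nrm_ge0//.
    by rewrite gerBl ltW.
  have := sqr_ge0 (nrm mu (fun x => u (tau, x)) - 1); have := nrm_ge0 mu (fun x => u (tau, x)); lra.
- rewrite /b ge0_integralZl ?lee_fin ?(ltW eps0)//; last 2 first.
  + by apply: emeasurable_funD => //; exact: measurable_funTS.
  + by move=> t _; rewrite adde_ge0// N2_ge0.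
  rewrite EFinM lee_wpmul2l ?lee_fin ?(ltW eps0)// ge0_integralD//; last 2 first.
  + by move=> t _; exact: N2_ge0.
  + exact: measurable_funTS.
  rewrite integral_cst// mul1e EFinD leeD//.
    suff : (leb `]0%R, T0[ <= T0%:E)%E by [].
    by rewrite lebesgue_measure_itv/= lte_fin T00 oppr0 adde0.
  rewrite fineK; last first.
    by rewrite ge0_fin_numE ?N2_ge0//; case/inL2P : uL.
  rewrite NE; apply: ge0_subset_integral => //.
  by move=> t _; exact: N2_ge0.
Qed.

End control_bound.

(** * The gliding hump *)

Section L2_limits.
Context d (T : measurableType d) (R : realType).
Variable mu : {measure set T -> \bar R}.
Implicit Types f : T -> R[i].

Lemma limn_einf_le (u : (\bar R)^nat) (C : \bar R) :
  (\forall n \near \oo, (u n <= C)%E) -> (limn_einf u <= C)%E.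
Proof.
move=> uC; rewrite limn_einf_lim; apply: lime_le; first exact: is_cvg_einfs.
apply: filterS uC => n; apply: le_trans; apply: ereal_inf_lbound.
by exists n => /=.
Qed.

(** Lower semicontinuity of the norm under a.e. convergence. It serves wherever a bound must survive
    a pointwise limit without any dominating function. *)
Lemma N2_fatou (F : nat -> T -> R[i]) f (C : \bar R) :
  (forall m, cmeasurable (F m)) -> cmeasurable f ->
  {ae mu, forall x, sqn (F m x) @[m --> \oo] --> sqn (f x)} ->
  (\forall m \near \oo, (N2 mu (F m) <= C)%E) -> (N2 mu f <= C)%E.
Proof.
move=> mF mf Ff FC; apply: le_trans (limn_einf_le FC).
have mF' m : measurable_fun setT (fun x => (sqn (F m x))%:E).
  by apply/measurable_EFinP; exact: measurable_sqn.
apply: le_trans (fatou _ _ _ _) => //; last first.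
  by move=> n x _; rewrite lee_fin sqn_ge0.
apply: ae_ge0_le_integral => //.
- by move=> x _; rewrite lee_fin sqn_ge0.
- by apply/measurable_EFinP; exact: measurable_sqn.
- move=> x _; rewrite limn_einf_lim; apply: lime_ge; first exact: is_cvg_einfs.
  apply: nearW => n; apply: le_ereal_inf_tmp => _ [m _ <-].
  by rewrite lee_fin sqn_ge0.
- rewrite /limn_einf; apply: measurableT_comp => //.
  by apply: measurable_fun_limn_esup => n; exact: measurableT_comp.
- apply: filterS Ff => x Fx _.
  have /cvg_limn_einf_sup[-> _] // : (sqn (F m x))%:E @[m --> \oo] --> (sqn (f x))%:E.
  by apply: cvg_EFin => //; exact: nearW.
Qed.

Lemma sqn_cvg (u : nat -> R[i]) (z : R[i]) :
  Re (u n) @[n --> \oo] --> Re z -> Im (u n) @[n --> \oo] --> Im z ->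
  sqn (u n) @[n --> \oo] --> sqn z.
Proof.
by move=> u1 u2; rewrite /sqn; apply: cvgD; rewrite expr2; under eq_fun do rewrite expr2;
  exact: cvgM.
Qed.

(** Riesz-Fischer for a sequence with geometric increments. The constant is the tail of the series,
    3/2 * 3^-k being the sum of 3^-j over j >= k; the gliding hump needs it explicitly. *)
Lemma L2_complete (Y : nat -> T -> R[i]) :
  (forall k, inL2 mu (Y k)) ->
  (forall k, nrm mu (fun x => Y k.+1 x - Y k x) <= 3^-1 ^+ k) ->
  exists2 f, inL2 mu f & forall k, nrm mu (fun x => f x - Y k x) <= 3 / 2 * 3^-1 ^+ k.
Proof.
move=> YL Y3.
have Ydist n k : nrm mu (fun x => Y (n + k)%N x - Y k x) <= 3 / 2 * 3^-1 ^+ k.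
  (* The partial geometric sum is what passes through the induction; the bound by the full tail does
     not. *)
  suff : nrm mu (fun x => Y (n + k)%N x - Y k x) <= 3 / 2 * (3^-1 ^+ k - 3^-1 ^+ (n + k)).
    move/le_trans; apply; rewrite ler_wpM2l// gerBl exprn_ge0//.
  elim: n => [|n IH].
    rewrite subrr mulr0 nrm_ae0//; first by apply: inL2B.
    by apply: nearW => x; rewrite subrr.
  apply: le_trans (nrm_triangle (YL _) (YL (n + k)%N) (YL _)) _.
  apply: le_trans (lerD (Y3 _) IH) _; rewrite exprS.
  lra.
pose D k x := Y k.+1 x - Y k x.
have DL k : inL2 mu (D k) by exact: inL2B.
(* The weights 2^k still give a finite integral, as 2^k 9^-k <= 2^-k, and they turn squares into
   first powers: |D| <= 2^-k + 2^k |D|^2, so the increments are absolutely summable wherever S is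
   finite. *)
pose w k x : \bar R := ((2 ^+ k)%:E * (sqn (D k x))%:E)%E.
have w0 k x : (0 <= w k x)%E by rewrite /w -EFinM lee_fin mulr_ge0 ?exprn_ge0 ?sqn_ge0.
have mw k : measurable_fun setT (w k).
  by apply: measurable_funeM; apply/measurable_EFinP; apply: measurable_sqn; case: (DL k).
pose S x := (\sum_(k <oo) w k x)%E.
have mS : measurable_fun setT S by exact: ge0_emeasurable_sum.
have S0 x : (0 <= S x)%E by exact: nneseries_ge0.
have Sfin : {ae mu, forall x, (S x < +oo)%E}.
  have : mu.-integrable setT S.
    apply/integrableP; split => //.
    under eq_integral do rewrite gee0_abs//.
    rewrite /S integral_nneseries//.
    apply: (@le_lt_trans _ _ (\sum_(k <oo) (2 / (2 ^ (k + 1))%:R)%:E)%E).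
      apply: lee_nneseries => [k _ _|k _]; first exact: integral_ge0.
      rewrite /w ge0_integralZl//; last 2 first.
      - by apply/measurable_EFinP; apply: measurable_sqn; case: (DL k).
      - by move=> x _; rewrite lee_fin sqn_ge0.
      rewrite -/(N2 mu (D k)) inL2_N2// -[leLHS]EFinM lee_fin addn1 natrX (exprS 2 k).
      have -> : 2 / (2 * 2 ^+ k) = (2 ^+ k)^-1 :> R by rewrite invfM mulrA divff// mul1r.
      rewrite -[leRHS]mul1r ler_pdivlMr ?exprn_gt0//.
      have H : 2 ^+ k * nrm mu (D k) <= 1.
        apply: le_trans (ler_wpM2l _ (Y3 k)) _; rewrite ?exprn_ge0//.
        by rewrite -exprMn exprn_ile1//; lra.
      rewrite (_ : _ * _ = (2 ^+ k * nrm mu (D k)) ^+ 2); last by ring.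
      by rewrite expr_le1// mulr_ge0 ?exprn_ge0 ?nrm_ge0.
    have /cvg_lim -> // := @cvg_geometric_eseries_half R 2 0.
    by rewrite ltry.
  move=> /(integrable_ae measurableT); apply: filterS => x /(_ I).
  by rewrite ge0_fin_numE.
pose N := [set x | (S x < +oo)%E].
have mN : measurable N.
  rewrite -[N]setTI; exact: emeasurable_fun_infty_o.
(* Cut to 0 outside [N], the sequence converges at every point, and its limit is measurable. *)
pose Z k x := (\1_N x)%:C%C * Y k x : R[i].
have ReIm_cvg (p : R[i] -> R) : (forall z w, p (z - w) = p z - p w) ->
    (forall z, `|p z| <= Normc.normc z) -> forall x, N x -> cvgn (fun k => p (Y k x)).
  move=> pB pn x Nx.
  have wc : cvgn (series (fun k => 2 ^+ k * sqn (D k x))).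
    apply: nnseries_is_cvg => [k|]; first by rewrite mulr_ge0 ?exprn_ge0 ?sqn_ge0.
    by under eq_eseriesr do rewrite EFinM.
  have gc : cvgn (series (geometric 1 2^-1 : R ^nat)).
    by apply: is_cvg_geometric_series; rewrite ger0_norm//; lra.
  have : cvgn (series (telescope (fun k => p (Y k x)))).
    apply: normed_cvg; apply: series_le_cvg (is_cvg_seriesD gc wc) => n //=.
      by rewrite addr_ge0 ?mulr_ge0 ?exprn_ge0 ?sqn_ge0// ?invr_ge0.
    rewrite (_ : telescope _ n = p (D n x)); last by rewrite pB.
    apply: le_trans (pn _) _.
    rewrite [leRHS](_ : _ = 2^-1 ^+ n + 2 ^+ n * Normc.normc (D n x) ^+ 2); last first.
      by rewrite normc_sqr -[2^-1 ^+ n]mul1r.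
    rewrite exprVn.
    set a := 2 ^+ n; set z := Normc.normc _.
    have a0 : 0 < a by rewrite exprn_gt0.
    have z0 : 0 <= z := normc_ge0 _.
    rewrite -(ler_pM2l a0) mulrDr divff ?gt_eqF//.
    have := sqr_ge0 (a * z - 1); have : 0 <= a * z by rewrite mulr_ge0// ltW.
    nra.
  move=> tc; rewrite (_ : (fun k => _) = (fun k => series (telescope (fun k => p (Y k x))) k + p (Y 0%N x))).
    by apply: is_cvgD => //; exact: is_cvg_cst.
  by apply/funext => k; rewrite telescopeK/= subrK.
have ReZ x : cvgn (fun k => Re (Z k x)).
  rewrite /Z indicE; have [Nx|Nx] := boolP (x \in N).
    rewrite (_ : (fun k => _) = (fun k => Re (Y k x))); last first.
      by apply/funext => k; rewrite mul1r.
    have pB (z w' : R[i]) : Re (z - w') = Re z - Re w' by rewrite ReD ReN.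
    by rewrite inE in Nx; exact: (ReIm_cvg _ pB (@abs_Re_le R) x Nx).
  rewrite (_ : (fun k => _) = (fun=> 0)); first exact: is_cvg_cst.
  by apply/funext => k; rewrite mul0r.
have ImZ x : cvgn (fun k => Im (Z k x)).
  rewrite /Z indicE; have [Nx|Nx] := boolP (x \in N).
    rewrite (_ : (fun k => _) = (fun k => Im (Y k x))); last first.
      by apply/funext => k; rewrite mul1r.
    have pB (z w' : R[i]) : Im (z - w') = Im z - Im w' by rewrite ImD ImN.
    by rewrite inE in Nx; exact: (ReIm_cvg _ pB (@abs_Im_le R) x Nx).
  rewrite (_ : (fun k => _) = (fun=> 0)); first exact: is_cvg_cst.
  by apply/funext => k; rewrite mul0r.
pose f x : R[i] := (lim (Re (Z k x) @[k --> \oo]) +i* lim (Im (Z k x) @[k --> \oo]))%C.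
have mZ k : cmeasurable (Z k).
  apply: cmeasurableM; last by case: (YL k).
  by apply: cmeasurable_real; exact: measurable_indic.
have mf : cmeasurable f.
  split; apply: measurable_fun_cvg => //=.
  - by move=> m; case: (mZ m) => + _; apply.
  - by move=> x _; exact: ReZ.
  - by move=> m; case: (mZ m) => _; apply.
  - by move=> x _; exact: ImZ.
have fY k : (N2 mu (fun x => (f x - Y k x)%R) <= ((3 / 2 * 3^-1 ^+ k) ^+ 2)%:E)%E.
  apply: (N2_fatou (F := fun m x => Y m x - Y k x)).
  - by move=> m; have [] := inL2B (YL m) (YL k).
  - by apply: cmeasurableB => //; case: (YL k).
  - apply: filterS Sfin => x Nx.
    have ZY m : Z m x = Y m x by rewrite /Z indicE mem_set// mul1r.
    apply: sqn_cvg.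
      rewrite ReD; under eq_fun do rewrite ReD -ZY.
      by apply: cvgD; [exact: ReZ|exact: cvg_cst].
    rewrite ImD; under eq_fun do rewrite ImD -ZY.
    by apply: cvgD; [exact: ImZ|exact: cvg_cst].
  - exists k => // m /= km.
    rewrite inL2_N2; last exact: inL2B.
    rewrite lee_fin ler_pXn2r ?nnegrE ?nrm_ge0 ?mulr_ge0 ?exprn_ge0//.
    by have := Ydist (m - k)%N k; rewrite subnK.
have fYL k : inL2 mu (fun x => f x - Y k x).
  apply/inL2P; split; first by apply: cmeasurableB => //; case: (YL k).
  by apply: le_lt_trans (fY k) _; rewrite ltry.
exists f.
  have := inL2D (fYL 0%N) (YL 0%N).
  by rewrite (_ : (fun x => _) = f)//; apply/funext => x; rewrite subrK.
move=> k; rewrite -(@ler_pXn2r _ 2) ?nnegrE ?nrm_ge0 ?mulr_ge0 ?exprn_ge0//.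
by rewrite -lee_fin -inL2_N2.
Qed.

(* The sign of each new term is chosen as in Sokal's proof of the uniform
   boundedness principle, so that no orthogonality between the g k is needed. *)
Lemma gliding_hump (g : nat -> T -> R[i]) :
  (forall k, inL2 mu (g k)) -> (forall k, nrm mu (g k) = 1) ->
  exists2 f, inL2 mu f & forall k, 3^-1 ^+ k / 2 <= `|rip mu f (g k)|.
Proof.
move=> gL g1.
pose sgn k (Y : T -> R[i]) : R := if 3^-1 ^+ k <= `|rip mu (fun x => Y x + (3^-1 ^+ k)%:C%C * g k x) (g k)|
  then 3^-1 ^+ k else - 3^-1 ^+ k.
pose Y := fix Y k := if k is k'.+1 then fun x => Y k' x + (sgn k' (Y k'))%:C%C * g k' x
  else fun=> 0 : R[i].
have YL k : inL2 mu (Y k).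
  by elim: k => [|k IH]; [exact: inL2_0|apply: inL2D => //; exact: inL2Z].
have r0 k : 0 < 3^-1 ^+ k :> R by rewrite exprn_gt0.
have abs_sgn k : `|sgn k (Y k)| = 3^-1 ^+ k.
  by rewrite /sgn; case: ifP => _; rewrite ?normrN ger0_norm// ltW.
have [k|f fL fY] := L2_complete YL.
  rewrite (_ : (fun x => _) = fun x => (sgn k (Y k))%:C%C * g k x); last first.
    by apply/funext => x /=; rewrite addrAC subrr add0r.
  by rewrite nrmZ// g1 mulr1 normc_real abs_sgn.
exists f => // k.
have H : 3^-1 ^+ k <= `|rip mu (Y k.+1) (g k)|.
  have E (a : R) : rip mu (fun x => Y k x + a%:C%C * g k x) (g k) = rip mu (Y k) (g k) + a.
    rewrite ripDl//; last exact: inL2Z.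
    by rewrite ripZl// rip_self// g1 expr1n mulr1.
  have -> : Y k.+1 = (fun x => Y k x + (sgn k (Y k))%:C%C * g k x) by [].
  rewrite E /sgn E; case: ifPn => //; rewrite -ltNge.
  have := r0 k; set r := _ ^+ k; set p := rip _ _ _ => rr.
  (* If |p + r| < r then p < 0, so that |p - r| = r - p > r: one of the two signs always works. *)
  rewrite ltr_norml => /andP[H1 H2].
  by rewrite ler_normr; apply/orP; right; lra.
have -> : rip mu f (g k) = rip mu (Y k.+1) (g k) + rip mu (fun x => f x - Y k.+1 x) (g k).
  by rewrite ripBl//; ring.
(* All later humps together change the pairing by at most 3/2 * 3^-(k+1) = 3^-k / 2, half of what
   the k-th one secured. *)
have := rip_le (inL2B fL (YL k.+1)) (gL k); rewrite g1 mulr1.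
move=> /le_trans/(_ (fY k.+1)); rewrite exprS => H2.
have := lerB_normD (rip mu (Y k.+1) (g k)) (rip mu (fun x => f x - Y k.+1 x) (g k)).
lra.
Qed.

End L2_limits.

(** * Complex integrals *)

Section cintegral_theory.
Context d (T : measurableType d) (R : realType).
Variable mu : {measure set T -> \bar R}.
Implicit Types (f g : T -> R[i]) (a : R[i]).

Lemma cintegrableP f : cintegrable mu f <->
  cmeasurable f /\ (\int[mu]_x (Normc.normc (f x))%:E < +oo)%E.
Proof.
split=> [[/integrableP[mf1 f1] /integrableP[mf2 f2]]|[mf foo]].
  have mf : cmeasurable f by split; exact/measurable_EFinP.
  split => //.
  apply: (@le_lt_trans _ _ (\int[mu]_x (`|(Re (f x))%:E| + `|(Im (f x))%:E|))%E).
    apply: ge0_le_integral => //.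
    - by move=> x _; rewrite lee_fin normc_ge0.
    - by apply/measurable_EFinP; exact: measurable_normc.
    - by apply: emeasurable_funD; exact: measurableT_comp.
    - by move=> x _; rewrite !abse_EFin -EFinD lee_fin normc_le_ReIm.
  by rewrite ge0_integralD//; [exact: lte_add_pinfty|exact: measurableT_comp..].
have mn : measurable_fun setT (fun x => (Normc.normc (f x))%:E).
  by apply/measurable_EFinP; exact: measurable_normc.
have [mf1 mf2] := mf.
split; apply/integrableP; split; try exact/measurable_EFinP.
  apply: le_lt_trans foo; apply: ge0_le_integral => //.
    by apply: measurableT_comp => //; exact/measurable_EFinP.
  by move=> x _; rewrite abse_EFin lee_fin abs_Re_le.
apply: le_lt_trans foo; apply: ge0_le_integral => //.
  by apply: measurableT_comp => //; exact/measurable_EFinP.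
by move=> x _; rewrite abse_EFin lee_fin abs_Im_le.
Qed.

Lemma integrable_normc f : cintegrable mu f ->
  mu.-integrable setT (fun x => (Normc.normc (f x))%:E).
Proof.
move=> /cintegrableP[mf foo]; apply/integrableP; split.
  by apply/measurable_EFinP; exact: measurable_normc.
by under eq_integral do rewrite abse_EFin ger0_norm ?normc_ge0//.
Qed.

Lemma le_cintegrable f (b : T -> R) : cmeasurable f ->
  mu.-integrable setT (fun x => (b x)%:E) ->
  (forall x, Normc.normc (f x) <= b x) -> cintegrable mu f.
Proof.
move=> mf /integrableP[mb boo] fb; apply/cintegrableP; split => //.
apply: le_lt_trans boo; apply: ge0_le_integral => //.
- by move=> x _; rewrite lee_fin normc_ge0.
- by apply/measurable_EFinP; exact: measurable_normc.
- exact: measurableT_comp.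
- by move=> x _; rewrite abse_EFin lee_fin (le_trans (fb x))// ler_norm.
Qed.

Lemma cintegrableM_le1 f g : cmeasurable g -> (forall x, Normc.normc (g x) <= 1) ->
  cintegrable mu f -> cintegrable mu (fun x => g x * f x).
Proof.
move=> mg g1 fI; have [mf _] := (cintegrableP f).1 fI.
apply: le_cintegrable (integrable_normc fI) _; first exact: cmeasurableM.
by move=> x; rewrite Normc.normcM ler_piMl ?normc_ge0.
Qed.

Lemma cintegrableD f g : cintegrable mu f -> cintegrable mu g ->
  cintegrable mu (fun x => f x + g x).
Proof.
move=> [f1 f2] [g1 g2]; split.
  by under eq_fun do rewrite ReD EFinD; exact: integrableD.
by under eq_fun do rewrite ImD EFinD; exact: integrableD.
Qed.

Lemma cintegrableZ a f : cintegrable mu f -> cintegrable mu (fun x => a * f x).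
Proof.
move=> [f1 f2]; split.
  under eq_fun do rewrite ReM EFinB !EFinM.
  by apply: integrableB => //; exact: integrableZl.
under eq_fun do rewrite ImM EFinD !EFinM.
by apply: integrableD => //; exact: integrableZl.
Qed.

Lemma cintegrableB f g : cintegrable mu f -> cintegrable mu g ->
  cintegrable mu (fun x => f x - g x).
Proof.
move=> fI /(cintegrableZ (-1)) gI; have := cintegrableD fI gI.
by under eq_fun do rewrite mulN1r.
Qed.

Lemma cintegralD f g : cintegrable mu f -> cintegrable mu g ->
  cintegral mu (fun x => f x + g x) = cintegral mu f + cintegral mu g.
Proof.
move=> [f1 f2] [g1 g2]; apply: complex_eq; rewrite ?ReD ?ImD /= -RintegralD//.
  by apply: eq_Rintegral => x _; rewrite ReD.
by apply: eq_Rintegral => x _; rewrite ImD.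
Qed.

Lemma cintegralZ a f : cintegrable mu f ->
  cintegral mu (fun x => a * f x) = a * cintegral mu f.
Proof.
move=> [f1 f2]; have iZ b (h : T -> R) : mu.-integrable setT (EFin \o h) ->
    mu.-integrable setT (EFin \o (fun x => b * h x)).
  move=> hI; rewrite [X in integrable _ _ X](_ : _ = (fun x => b%:E * (EFin \o h) x)%E)//.
  exact: integrableZl.
apply: complex_eq; rewrite ?ReM ?ImM /= -!RintegralZl//.
  rewrite -RintegralB//; [|exact: iZ..].
  by apply: eq_Rintegral => x _; rewrite ReM.
rewrite -RintegralD//; [|exact: iZ..].
by apply: eq_Rintegral => x _; rewrite ImM.
Qed.

Lemma cintegralB f g : cintegrable mu f -> cintegrable mu g ->
  cintegral mu (fun x => f x - g x) = cintegral mu f - cintegral mu g.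
Proof.
move=> fI gI; have gI' := cintegrableZ (-1) gI.
rewrite -mulN1r -cintegralZ// -cintegralD//.
by congr (cintegral mu _); apply/funext => x; rewrite mulN1r.
Qed.

Lemma cintegralZr a f : cintegrable mu f ->
  cintegral mu (fun x => f x * a) = cintegral mu f * a.
Proof.
by move=> fI; rewrite mulrC -cintegralZ//; under eq_fun do rewrite mulrC.
Qed.

Lemma eq_cintegral f g : (forall x, f x = g x) -> cintegral mu f = cintegral mu g.
Proof. by move=> fg; congr cintegral; exact/funext. Qed.

Lemma abs_Re_cintegral_le f : cintegrable mu f ->
  `|Re (cintegral mu f)| <= Rintegral mu setT (fun x => Normc.normc (f x)).
Proof.
move=> fI; have [f1 _] := fI; rewrite /= (le_trans (le_normr_Rintegral _ _))//.
apply: le_Rintegral => //; first exact: integrable_norm.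
  exact: integrable_normc.
by move=> x _; exact: abs_Re_le.
Qed.

Lemma abs_Im_cintegral_le f : cintegrable mu f ->
  `|Im (cintegral mu f)| <= Rintegral mu setT (fun x => Normc.normc (f x)).
Proof.
move=> fI; have [_ f2] := fI; rewrite /= (le_trans (le_normr_Rintegral _ _))//.
apply: le_Rintegral => //; first exact: integrable_norm.
  exact: integrable_normc.
by move=> x _; exact: abs_Im_le.
Qed.

Lemma cintegrable_conj f : cintegrable mu f -> cintegrable mu (fun x => ((f x)^*)%C).
Proof.
move=> /cintegrableP[[mf1 mf2] foo]; apply/cintegrableP; split.
  split.
    by congr (measurable_fun _ _) : mf1; apply/funext => x; case: (f x).
  rewrite (_ : (fun _ => _) = (fun x => -1 * Im (f x))); last first.
    by apply/funext => x; case: (f x) => u v /=; rewrite mulN1r.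
  exact: measurable_funM.
congr (_ < _)%E : foo; apply: eq_integral => x _.
by case: (f x) => u v /=; rewrite sqrrN.
Qed.

Lemma cintegral_conj f : cintegrable mu f ->
  cintegral mu (fun x => (f x)^*%C) = ((cintegral mu f)^*)%C.
Proof.
move=> [f1 f2]; rewrite /cintegral /=; congr (_ +i* _)%C.
  by apply: eq_Rintegral => x _; case: (f x).
rewrite -mulN1r -RintegralZl//.
by apply: eq_Rintegral => x _; case: (f x) => u v /=; rewrite mulN1r.
Qed.

End cintegral_theory.

(** * Fubini's theorem for complex integrands *)

Section cfubini.
Context d1 d2 (T1 : measurableType d1) (T2 : measurableType d2) (R : realType).
Variables (m1 : {sigma_finite_measure set T1 -> \bar R})
          (m2 : {sigma_finite_measure set T2 -> \bar R}).

(** The real-valued inner integral is the [fine] part of the extended one. They agree only for those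
    x whose section is integrable, that is almost everywhere, which is enough for the outer
    integral. *)
Lemma Rintegral_fubini_F (f : T1 * T2 -> R) :
  (m1 \x m2)%E.-integrable setT (EFin \o f) ->
  m1.-integrable setT (EFin \o (fun x => Rintegral m2 setT (fun y => f (x, y)))) /\
  Rintegral m1 setT (fun x => Rintegral m2 setT (fun y => f (x, y))) =
  Rintegral (m1 \x m2)%E setT f.
Proof.
move=> fI; have FI := integrable_fubini_F fI; have mF := measurable_fubini_F fI.
have mF' : measurable_fun setT (EFin \o (fun x => Rintegral m2 setT (fun y => f (x, y)))).
  by apply/measurable_EFinP; exact: measurableT_comp mF.
have aeF : ae_eq m1 setT (EFin \o (fun x => Rintegral m2 setT (fun y => f (x, y))))
    (fun x => \int[m2]_y (f (x, y))%:E)%E.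
  apply: filterS (ae_integrable1 fI) => x /= xI _.
  by rewrite fineK//; exact: integrable_fin_num.
split.
  apply/integrableP; split => //; case/integrableP : FI => _; apply: le_lt_trans.
  rewrite le_eqVlt; apply/orP; left; apply/eqP; apply: ge0_ae_eq_integral => //.
  - exact: measurableT_comp.
  - exact: measurableT_comp.
  - by apply: filterS aeF => x /= /(_ I) H _; exact: (congr1 abse H).
transitivity (fine (\int[m1]_x fubini_F m2 (EFin \o f) x)%E); congr fine.
  exact: ae_eq_integral.
exact: (integral12_prod_meas1 fI).
Qed.

Lemma Rintegral_fubini_G (f : T1 * T2 -> R) :
  (m1 \x m2)%E.-integrable setT (EFin \o f) ->
  m2.-integrable setT (EFin \o (fun y => Rintegral m1 setT (fun x => f (x, y)))) /\
  Rintegral m2 setT (fun y => Rintegral m1 setT (fun x => f (x, y))) =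
  Rintegral (m1 \x m2)%E setT f.
Proof.
move=> fI; have mG := measurable_fubini_G fI.
have mG' : measurable_fun setT (EFin \o (fun y => Rintegral m1 setT (fun x => f (x, y)))).
  by apply/measurable_EFinP; exact: measurableT_comp mG.
have aeG : ae_eq m2 setT (EFin \o (fun y => Rintegral m1 setT (fun x => f (x, y))))
    (fun y => \int[m1]_x (f (x, y))%:E)%E.
  apply: filterS (ae_integrable2 fI) => y /= yI _.
  by rewrite fineK//; exact: integrable_fin_num.
split.
  have /integrableP[mf foo] := fI.
  apply/integrableP; split => //; apply: le_lt_trans foo.
  rewrite [leRHS]fubini_tonelli2//; last exact: measurableT_comp.
  apply: ae_ge0_le_integral => //.
  - exact: measurableT_comp.
  - by move=> y _; exact: integral_ge0.
  - apply: (@measurable_fun_fubini_tonelli_G _ _ _ _ _ m1 (fun z => `|(f z)%:E|%E)) => //.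
    exact: measurableT_comp.
  - apply: filterS aeG => y /= /(_ I) H _.
    rewrite -abse_EFin H; apply: le_abse_integral => //.
    exact: (measurableT_comp mf (pair2_measurable y)).
transitivity (fine (\int[m2]_y fubini_G m1 (EFin \o f) y)%E); congr fine.
  exact: ae_eq_integral.
exact: (integral21_prod_meas1 fI).
Qed.

Lemma cintegral_fubini_F (f : T1 * T2 -> R[i]) : cintegrable (m1 \x m2)%E f ->
  cintegrable m1 (fun x => cintegral m2 (fun y => f (x, y))) /\
  cintegral m1 (fun x => cintegral m2 (fun y => f (x, y))) = cintegral (m1 \x m2)%E f.
Proof.
move=> [/Rintegral_fubini_F[i1 e1] /Rintegral_fubini_F[i2 e2]]; split => //.
by apply: complex_eq => /=; [rewrite e1|rewrite e2].
Qed.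

Lemma cintegral_fubini_G (f : T1 * T2 -> R[i]) : cintegrable (m1 \x m2)%E f ->
  cintegrable m2 (fun y => cintegral m1 (fun x => f (x, y))) /\
  cintegral m2 (fun y => cintegral m1 (fun x => f (x, y))) = cintegral (m1 \x m2)%E f.
Proof.
move=> [/Rintegral_fubini_G[i1 e1] /Rintegral_fubini_G[i2 e2]]; split => //.
by apply: complex_eq => /=; [rewrite e1|rewrite e2].
Qed.

Lemma cintegrable_tensor (a : T1 -> R[i]) (b : T2 -> R[i]) :
  cintegrable m1 a -> cintegrable m2 b ->
  cintegrable (m1 \x m2)%E (fun z => a z.1 * b z.2).
Proof.
move=> /cintegrableP[ma aoo] /cintegrableP[mb boo].
have ma' : cmeasurable (fun z : T1 * T2 => a z.1).
  by case: ma => ma1 ma2; split;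
    [exact: (measurableT_comp ma1 measurable_fst)|exact: (measurableT_comp ma2 measurable_fst)].
have mb' : cmeasurable (fun z : T1 * T2 => b z.2).
  by case: mb => mb1 mb2; split;
    [exact: (measurableT_comp mb1 measurable_snd)|exact: (measurableT_comp mb2 measurable_snd)].
apply/cintegrableP; split; first exact: cmeasurableM.
rewrite fubini_tonelli1//=; last 2 first.
- by apply/measurable_EFinP; apply: measurable_normc; exact: cmeasurableM.
- by move=> z; rewrite lee_fin normc_ge0.
rewrite /fubini_F.
under eq_integral => x _.
  under eq_integral do rewrite Normc.normcM EFinM /=.
  rewrite ge0_integralZl//; last 3 first.
  - by apply/measurable_EFinP; exact: measurable_normc.
  - by move=> y _; rewrite lee_fin normc_ge0.
  - by rewrite lee_fin normc_ge0.
  over.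
have a0 : (0 <= \int[m1]_x (Normc.normc (a x))%:E)%E.
  by apply: integral_ge0 => x _; rewrite lee_fin normc_ge0.
rewrite ge0_integralZr//.
- by apply: lte_mul_pinfty => //; rewrite ge0_fin_numE.
- by apply/measurable_EFinP; exact: measurable_normc.
- by move=> y _; rewrite lee_fin normc_ge0.
- by apply: integral_ge0 => y _; rewrite lee_fin normc_ge0.
Qed.

Lemma cintegral_tensor (a : T1 -> R[i]) (b : T2 -> R[i]) :
  cintegrable m1 a -> cintegrable m2 b ->
  cintegral (m1 \x m2)%E (fun z => a z.1 * b z.2) = cintegral m1 a * cintegral m2 b.
Proof.
move=> aI bI; have [_ <-] := cintegral_fubini_F (cintegrable_tensor aI bI).
rewrite -cintegralZr//; apply: eq_cintegral => x /=; exact: cintegralZ.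
Qed.

End cfubini.

(** * Laplace and Cauchy kernels on the line *)

Section integrals_on_the_line.
Context {R : realType}.
Local Notation leb := (@lebesgue_measure R).

Lemma integral_affine (G : R -> R) (k a : R) : 0 < k -> continuous G ->
  (forall x, 0 <= G x) ->
  (\int[leb]_x (G x)%:E = \int[leb]_x (G (k * x + a) * k)%:E)%E.
Proof.
move=> k0 cG G0; pose F x := k * x + a.
have dF (x : R) : is_derive x 1 F k by apply: is_derive_eq; rewrite addr0 /GRing.scale/= mulr1.
have F' : derive1 F = cst k.
  by apply/funext => x; rewrite derive1E derive_val.
rewrite (@increasing_ge0_integration_by_substitutionT _ F G)//.
- by apply: eq_integral => x _; rewrite F'.
- by move=> x y xy; rewrite /F ltrD2r ltr_pM2l.
- by rewrite F'; exact: cst_continuous.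
- by rewrite F'; exact: is_cvg_cst.
- by rewrite F'; exact: is_cvg_cst.
- apply/cvgrNyPle => A; exists ((A - a) / k); split; first exact: num_real.
  by move=> x /ltW; rewrite ler_pdivlMr// /F mulrC lerBrDr.
- apply/cvgryPge => A; exists ((A - a) / k); split; first exact: num_real.
  by move=> x /ltW; rewrite ler_pdivrMr// /F mulrC lerBlDr.
Qed.

Lemma ge0_integral_fold (f : R -> R) : (forall x, 0 <= f x) -> continuous f ->
  (\int[leb]_x (f x)%:E = \int[leb]_(x in `[0%R, +oo[) (f x)%:E +
    \int[leb]_(x in `[0%R, +oo[) (f (- x)%R)%:E)%E.
Proof.
move=> f0 cf.
have mf : measurable_fun [set: R] f by exact: continuous_measurable_fun.
rewrite -(setUv `[0, +oo[) ge0_integral_setU//= ; last 4 first.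
- exact: measurableC.
- by apply/measurable_EFinP; rewrite setUv.
- by move=> x _; rewrite lee_fin.
- exact/disj_setPCl.
congr +%E; rewrite setCitvr.
rewrite integral_itv_bndo_bndc; last exact/measurable_EFinP/measurable_funTS.
rewrite -{1}oppr0 ge0_integration_by_substitutionNy//.
exact: continuous_subspaceT.
Qed.

(** The Fourier transform of exp(- e |x|), without normalization: its mass is 2 pi for every e > 0,
    and it concentrates at 0 as e tends to 0. *)
Definition cauchy (e y : R) : R := 2 * e / (e ^+ 2 + y ^+ 2).

Lemma cauchy_ge0 e y : 0 < e -> 0 <= cauchy e y.
Proof. by move=> e0; rewrite divr_ge0 ?mulr_ge0 ?ltW ?ltr_wpDr ?sqr_ge0 ?exprn_gt0. Qed.

Lemma cauchy_den e y : 0 < e -> 0 < e ^+ 2 + y ^+ 2 :> R.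
Proof. by move=> e0; rewrite ltr_wpDr ?sqr_ge0 ?exprn_gt0. Qed.

Lemma cauchyN e y : cauchy e (- y) = cauchy e y.
Proof. by rewrite /cauchy sqrrN. Qed.

Lemma continuous_cauchy e : 0 < e -> continuous (cauchy e).
Proof.
move=> e0 x; apply: cvgM; first exact: cvg_cst.
apply: cvgV; first by rewrite gt_eqF// cauchy_den.
apply: cvgD; first exact: cvg_cst.
exact: exprn_continuous.
Qed.

Lemma measurable_cauchy e : 0 < e -> measurable_fun setT (cauchy e).
Proof. by move=> e0; apply: continuous_measurable_fun; exact: continuous_cauchy. Qed.

Lemma integral_cauchy e a : 0 < e ->
  (\int[leb]_x (cauchy e (x - a))%:E = (2 * pi)%:E)%E.
Proof.
move=> e0; pose G (x : R) := 2 * (oneDsqr x)^-1.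
have cG : continuous G.
  by move=> x; apply: cvgM; [exact: cvg_cst|exact: continuous_oneDsqrV].
have G0 x : 0 <= G x by rewrite mulr_ge0// invr_ge0.
have mV : measurable_fun setT (fun x : R => (oneDsqr x)^-1).
  by apply: continuous_measurable_fun; exact: continuous_oneDsqrV.
transitivity (\int[leb]_x (G x)%:E)%E.
  rewrite (@integral_affine G e^-1 (- (a / e))) ?invr_gt0//.
  apply: eq_integral => x _; congr EFin; rewrite /G /oneDsqr /cauchy.
  have := cauchy_den (x - a) e0; set D := e ^+ 2 + _ => D0.
  have -> : 1 + (e^-1 * x - a / e) ^+ 2 = D / e ^+ 2.
    by rewrite /D; field; rewrite gt_eqF.
  by field; rewrite !gt_eqF.
rewrite ge0_symfun_integralT//; last by move=> x; rewrite /G/= /oneDsqr sqrrN.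
rewrite -set_itvcy; under eq_integral do rewrite EFinM.
rewrite ge0_integralZl//; last first.
  exact/measurable_EFinP/measurable_funTS.
rewrite integral0y_oneDsqr -!EFinM; congr EFin; lra.
Qed.

Section exponential.
Variable e : R.
Hypothesis e0 : 0 < e.

(* The summand 1 keeps the integrands nonnegative, as required by the fundamental
   theorem of calculus on [[0, +oo[]. *)
Let wave (y c1 c2 x : R) := expR (- (e * x)) * (1 + c1 * cos (y * x) + c2 * sin (y * x)).

Lemma integral0y_wave (y c1 c2 : R) : (forall x, 0 <= 1 + c1 * cos (y * x) + c2 * sin (y * x)) ->
  (\int[leb]_(x in `[0%R, +oo[) (wave y c1 c2 x)%:E =
   (e^-1 + (c1 * e + c2 * y) / (e ^+ 2 + y ^+ 2))%:E)%E.
Proof.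
move=> w0; have D0 := cauchy_den y e0; set D := e ^+ 2 + y ^+ 2 in D0 *.
(* exp(- e x) B x is an explicit primitive of the integrand; B is bounded, so the primitive tends to
   0 at +oo and the integral is - B 0. *)
pose B x := - e^-1 + D^-1 * (c1 * (- e * cos (y * x) + y * sin (y * x)) +
  c2 * (- e * sin (y * x) - y * cos (y * x))).
pose F x := expR (- (e * x)) * B x.
have dF (x : R) : is_derive x 1 F (wave y c1 c2 x).
  apply: is_derive_eq.
  rewrite /wave /GRing.scale/= /B.
  move: (expR _) (cos _) (sin _) => E C S; rewrite /D; field.
  by rewrite !gt_eqF.
have cF : continuous F.
  by move=> x; apply/differentiable_continuous/derivable1_diffP; apply: ex_derive.
have cw : continuous (wave y c1 c2).
  move=> x; apply/differentiable_continuous/derivable1_diffP; apply: ex_derive.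
pose M := e^-1 + D^-1 * (`|c1| * (e + `|y|) + `|c2| * (e + `|y|)).
have BM x : `|B x| <= M.
  have cb (z : R) : `|cos z| <= 1 by rewrite ler_norml cos_geN1 cos_le1.
  have sb (z : R) : `|sin z| <= 1 by rewrite ler_norml sin_geN1 sin_le1.
  have pb (a b : R) : `|b| <= 1 -> `|a * b| <= `|a|.
    by move=> b1; rewrite normrM ler_piMr.
  rewrite (le_trans (ler_normD _ _))// lerD//.
    by rewrite normrN gtr0_norm// invr_gt0.
  rewrite normrM gtr0_norm ?invr_gt0// ler_pM2l ?invr_gt0//.
  rewrite (le_trans (ler_normD _ _))// lerD// normrM ler_wpM2l//.
    rewrite (le_trans (ler_normD _ _))// lerD//; last exact: pb.
    by rewrite (le_trans (pb _ _ _))// normrN gtr0_norm.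
  rewrite (le_trans (ler_normB _ _))// lerD//; last exact: pb.
  by rewrite (le_trans (pb _ _ _))// normrN gtr0_norm.
have ey : expR (- (e * x)) @[x --> +oo] --> (0 : R).
  apply: (@cvg_comp _ _ _ (fun x => e * x) (fun x => expR (- x)) _ +oo%R); last exact: cvgr_expR.
  apply/cvgryPge => A; exists (A / e); split; first exact: num_real.
  by move=> x /ltW; rewrite ler_pdivrMr// mulrC.
have Fy : F x @[x --> +oo] --> 0.
  have Me : M * expR (- (e * x)) @[x --> +oo] --> M * 0 by exact: cvgMl_tmp.
  rewrite mulr0 in Me.
  have MeN : - (M * expR (- (e * x))) @[x --> +oo] --> (- 0 : R) by exact: cvgN.
  rewrite oppr0 in MeN.
  apply: (squeeze_cvgr _ MeN Me); apply: nearW => x.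
  by rewrite -ler_norml normrM ger0_norm ?expR_ge0// mulrC ler_wpM2r ?expR_ge0.
rewrite (@ge0_continuous_FTC2y _ _ F _ 0)//.
- by rewrite /F /B !mulr0 oppr0 expR0 cos0 sin0; congr EFin; field; rewrite !gt_eqF.
- by move=> x _; rewrite /wave mulr_ge0 ?expR_ge0.
- exact: continuous_subspaceT.
- by apply: cvg_at_right_filter; exact: cF.
- by move=> x _; rewrite derive1E derive_val.
Qed.

Let lap (x : R) := expR (- (e * `|x|)).
Let cont_lap : continuous lap.
Proof.
move=> x; rewrite /lap; apply: continuous_comp; last exact: continuous_expR.
apply: cvgN; apply: cvgMl_tmp; exact: norm_continuous.
Qed.

Let cont_wave (y c1 c2 : R) :
  continuous (fun x => lap x * (1 + (c1 * cos (y * x) + c2 * sin (y * x)))).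
Proof.
have cp : continuous (fun x => 1 + (c1 * cos (y * x) + c2 * sin (y * x))).
  by move=> x; apply/differentiable_continuous/derivable1_diffP; apply: ex_derive.
by move=> x; apply: cvgM; [exact: cont_lap|exact: cp].
Qed.

(** Folding the line onto [0, +oo[ changes the sign of the sine coefficient on one half, so [c2]
    cancels and only the cosine contributes to the value. *)
Lemma integral_wave (y c1 c2 : R) (p := fun x => c1 * cos (y * x) + c2 * sin (y * x)) :
  (forall x, `|p x| <= 1) ->
  (\int[leb]_x (expR (- (e * `|x|)) * (1 + p x))%:E =
   (2 / e + c1 * cauchy e y)%:E)%E.
Proof.
move=> p1.
have w0 c : (forall x, `|c1 * cos (y * x) + c * sin (y * x)| <= 1) ->
    forall x, 0 <= 1 + c1 * cos (y * x) + c * sin (y * x).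
  by move=> H x; have := H x; rewrite ler_norml => /andP[+ _]; lra.
have p1N x : `|c1 * cos (y * x) + (- c2) * sin (y * x)| <= 1.
  by have := p1 (- x); rewrite /p mulrN cosN sinN mulrN mulNr.
rewrite ge0_integral_fold.
- transitivity (\int[leb]_(x in `[0%R, +oo[) (wave y c1 c2 x)%:E +
    \int[leb]_(x in `[0%R, +oo[) (wave y c1 (- c2) x)%:E)%E.
    congr +%E; apply: eq_integral => x; rewrite inE/= in_itv/= andbT => x0.
      by rewrite ger0_norm// /wave addrA.
    by rewrite normrN ger0_norm// /wave /p mulrN cosN sinN mulrN mulNr addrA.
  rewrite !integral0y_wave; [|exact: w0..].
  rewrite -EFinD /cauchy; congr EFin; field.
  by rewrite !gt_eqF// cauchy_den.
- by move=> x; rewrite mulr_ge0 ?expR_ge0//; have := p1 x; rewrite ler_norml => /andP[+ _]; lra.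
- exact: cont_wave.
Qed.

Let wave_shift (y c1 c2 a : R) (p := fun x => c1 * cos (y * x) + c2 * sin (y * x)) :
  (forall x, `|p x| <= 1) ->
  (\int[leb]_x (lap (x - a) * (1 + p (x - a)))%:E = (2 / e + c1 * cauchy e y)%:E)%E.
Proof.
move=> p1; rewrite -(integral_wave p1) (@integral_affine (fun x => lap x * (1 + p x)) 1 (- a))//.
- by apply: eq_integral => x _; rewrite mul1r mulr1.
- exact: cont_wave.
- by move=> x; rewrite mulr_ge0 ?expR_ge0//; have := p1 x; rewrite ler_norml => /andP[+ _]; lra.
Qed.

Let mlap (a : R) : measurable_fun setT (fun x : R => lap (x - a)).
Proof.
apply: continuous_measurable_fun => x.
apply: (@continuous_comp _ _ _ (fun x => x - a) lap); last exact: cont_lap.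
by apply: cvgB; [exact: cvg_id|exact: cvg_cst].
Qed.

Lemma integral_exp a : (\int[leb]_x (expR (- (e * `|x - a|)))%:E = (2 / e)%:E)%E.
Proof.
have := @wave_shift 0 0 0 a; rewrite mul0r addr0 => <-.
  by apply: eq_integral => x _; rewrite !mul0r !addr0 mulr1.
by move=> x; rewrite !mul0r addr0 normr0.
Qed.

Lemma integrable_exp a : leb.-integrable setT (fun x => (expR (- (e * `|x - a|)))%:E).
Proof.
apply/integrableP; split; first by apply/measurable_EFinP; exact: mlap.
under eq_integral do rewrite abse_EFin ger0_norm ?expR_ge0//.
by rewrite integral_exp ltry.
Qed.

(** Removes the auxiliary summand 1 by subtracting the integral of the bare exponential; the
    integrand may then change sign. *)
Let Rint_wave (y c1 c2 a : R) (p := fun x => c1 * cos (y * x) + c2 * sin (y * x)) :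
  (forall x, `|p x| <= 1) ->
  leb.-integrable setT (EFin \o (fun x => lap (x - a) * p (x - a))) /\
  Rintegral leb setT (fun x => lap (x - a) * p (x - a)) = c1 * cauchy e y.
Proof.
move=> p1.
have mp : measurable_fun setT (fun x : R => lap (x - a) * (1 + p (x - a))).
  apply: continuous_measurable_fun => x.
  apply: (@continuous_comp _ _ _ (fun x => x - a) (fun x => lap x * (1 + p x))).
    by apply: cvgB; [exact: cvg_id|exact: cvg_cst].
  exact: cont_wave.
have i1 : leb.-integrable setT (EFin \o (fun x => lap (x - a) * (1 + p (x - a)))).
  apply/integrableP; split; first exact/measurable_EFinP.
  under eq_integral => x _.
    rewrite /= ger0_norm; last first.
      by rewrite mulr_ge0 ?expR_ge0//; have := p1 (x - a); rewrite ler_norml => /andP[+ _]; lra.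
    over.
  by rewrite wave_shift// ltry.
have E : (fun x : R => lap (x - a) * p (x - a)) =
    (fun x => lap (x - a) * (1 + p (x - a)) - lap (x - a)).
  by apply/funext => x; ring.
have i0 : leb.-integrable setT (EFin \o (fun x => lap (x - a))) := integrable_exp a.
rewrite E; split.
  exact: (integrableB measurableT i1 i0).
rewrite RintegralB// {1}/Rintegral wave_shift// /Rintegral integral_exp/=; ring.
Qed.

Let pcos (y x : R) : `|1 * cos (y * x) + 0 * sin (y * x)| <= 1.
Proof. by rewrite mul1r mul0r addr0 ler_norml cos_geN1 cos_le1. Qed.

Let psin (y x : R) : `|0 * cos (y * x) + 1 * sin (y * x)| <= 1.
Proof. by rewrite mul1r mul0r add0r ler_norml sin_geN1 sin_le1. Qed.

(** Writing y x = y a + y (x - a) extracts the phase; the coefficients (1, 0) and (0, 1) then give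
    the real and the imaginary part. *)
Lemma cintegral_exp (y a : R) :
  cintegral leb (fun x => cis (y * x) * (expR (- (e * `|x - a|)))%:C%C) =
  cis (y * a) * (cauchy e y)%:C%C.
Proof.
have [Ic Ec] := @Rint_wave y 1 0 a (pcos y); have [Is Es] := @Rint_wave y 0 1 a (psin y).
have E x : cis (y * x) * (lap (x - a))%:C%C = cis (y * a) *
   (lap (x - a) * (1 * cos (y * (x - a)) + 0 * sin (y * (x - a))) +i*
    (lap (x - a) * (0 * cos (y * (x - a)) + 1 * sin (y * (x - a)))))%C.
  have -> : y * x = y * a + y * (x - a) by ring.
  rewrite cisD -mulrA; congr (_ * _); apply: complex_eq; rewrite ?ReM ?ImM /=; ring.
rewrite (eq_cintegral leb E) cintegralZ; last by split.
by congr (_ * _); apply: complex_eq; rewrite /= ?Ec ?Es; ring.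
Qed.

End exponential.
End integrals_on_the_line.

(** * The Fourier transform on R^d *)

Section rV_product.
Context {R : realType}.
Local Notation leb := (@lebesgue_measure R).

Lemma integral_cons n (f : 'rV[R]_n.+1 -> \bar R) : measurable_fun setT f ->
  (\int[lebesgue_rV n.+1]_v f v =
   \int[leb \x lebesgue_rV n]_z f (cons_rV z))%E.
Proof.
have ge0 (g : 'rV[R]_n.+1 -> \bar R) : measurable_fun setT g -> (forall v, 0 <= g v)%E ->
    (\int[lebesgue_rV n.+1]_v g v = \int[leb \x lebesgue_rV n]_z g (cons_rV z))%E.
  move=> mg g0.
  rewrite (eq_measure_integral (pushforward (leb \x lebesgue_rV n)%E (@cons_rV R n)))//.
    exact: measurable_cons_rV.
  by move=> mc; rewrite ge0_integral_pushforward ?preimage_setT.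
move=> mf; rewrite integralE [RHS]integralE; congr (_ - _)%E.
  rewrite (ge0 f^\+%E); [|by apply: measurable_funepos|by []].
  by apply: eq_integral => z _; rewrite !funeposE.
rewrite (ge0 f^\-%E); [|by apply: measurable_funeneg|by []].
by apply: eq_integral => z _; rewrite !funenegE.
Qed.

Lemma cintegral_cons n (f : 'rV[R]_n.+1 -> R[i]) : cmeasurable f ->
  cintegral (lebesgue_rV n.+1) f =
  cintegral (leb \x lebesgue_rV n)%E (fun z => f (cons_rV z)).
Proof.
move=> [f1 f2]; rewrite /cintegral /Rintegral !integral_cons//; exact/measurable_EFinP.
Qed.

Lemma cmeasurable_coord n (i : 'I_n) (f : R -> R[i]) :
  cmeasurable (f : measurableTypeR R -> R[i]) ->
  cmeasurable (fun v : 'rV[R]_n => f (v ord0 i)).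
Proof.
move=> [f1 f2]; split.
  exact: (measurableT_comp f1 (measurable_rV_coord i)).
exact: (measurableT_comp f2 (measurable_rV_coord i)).
Qed.

Lemma cmeasurable_bigprod d (T : measurableType d) (I : Type) (s : seq I) (f : I -> T -> R[i]) :
  (forall i, cmeasurable (f i)) -> cmeasurable (fun x => \prod_(i <- s) f i x).
Proof.
move=> mf; elim: s => [|i s IH].
  by under eq_fun do rewrite big_nil; exact: cmeasurable_cst.
by under eq_fun do rewrite big_cons; exact: cmeasurableM.
Qed.

(** Induction on the dimension with Fubini, Lebesgue measure on R^(n+1) being the image of a
    product. The explicit integrals over R^d needed later all factor in this way, because the
    packets are built on the 1-norm. *)
Lemma cintegral_rV_prod n (f : 'I_n -> R -> R[i]) :
  (forall i, cintegrable leb (f i)) ->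
  cintegrable (lebesgue_rV n) (fun v => \prod_(i < n) f i (v ord0 i)) /\
  cintegral (lebesgue_rV n) (fun v => \prod_(i < n) f i (v ord0 i)) =
  \prod_(i < n) cintegral leb (f i).
Proof.
elim: n f => [|n IHn] f fI.
  under eq_fun do rewrite big_ord0.
  rewrite big_ord0; split.
    apply/cintegrableP; split; first exact: cmeasurable_cst.
    by rewrite integral_cst//= diracT mule1 ltry.
  have d1 : lebesgue_rV 0 [set: 'rV[R]_0] = 1%E by exact: diracT.
  have i1 (r : R) : (\int[lebesgue_rV 0]_(v in [set: 'rV[R]_0]) r%:E = r%:E)%E.
    by rewrite integral_cst//; have := congr1 (fun z => r%:E * z)%E d1; rewrite mule1; apply.
  by rewrite /cintegral /Rintegral !i1.
have mf i : cmeasurable (f i : measurableTypeR R -> R[i]) by case/cintegrableP : (fI i).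
have mF : cmeasurable (fun v : 'rV[R]_n.+1 => \prod_(i < n.+1) f i (v ord0 i)).
  by apply: cmeasurable_bigprod => i; exact: cmeasurable_coord.
have E z : \prod_(i < n.+1) f i (@cons_rV R n z ord0 i) =
    f ord0 z.1 * \prod_(i < n) f (lift ord0 i) (z.2 ord0 i).
  rewrite big_ord_recl; congr (_ * _); first by rewrite mxE unlift_none.
  by apply: eq_bigr => i _; rewrite mxE liftK.
have [gI gE] := IHn (fun i => f (lift ord0 i)) (fun i => fI _).
have tI := cintegrable_tensor (fI ord0) gI.
split.
  apply/cintegrableP; split => //; rewrite integral_cons; last first.
    by apply/measurable_EFinP; exact: measurable_normc.
  under eq_integral do rewrite E.
  by case/cintegrableP : tI.
rewrite cintegral_cons// big_ord_recl -gE -cintegral_tensor//.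
exact: eq_cintegral.
Qed.

Lemma integral_rV_prod n (r : 'I_n -> R -> R) :
  (forall i, leb.-integrable setT (EFin \o r i)) ->
  (lebesgue_rV n).-integrable setT (EFin \o (fun v : 'rV[R]_n => \prod_(i < n) r i (v ord0 i))) /\
  Rintegral (lebesgue_rV n) setT (fun v : 'rV[R]_n => \prod_(i < n) r i (v ord0 i)) =
  \prod_(i < n) Rintegral leb setT (r i).
Proof.
move=> rI; have fI i : cintegrable leb (fun x => (r i x)%:C%C).
  by split; [exact: rI|exact: integrable0].
have [[I1 _] E] := cintegral_rV_prod fI.
have P I (s : seq I) (a : I -> R) : \prod_(i <- s) (a i)%:C%C = (\prod_(i <- s) a i)%:C%C :> R[i].
  by rewrite rmorph_prod.
split; first by under eq_fun do rewrite /= -[\prod_(_ < _) _]/(Re (\prod_(_ < _) _)%:C%C) -P.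
have := congr1 (@complex.Re R) E; rewrite /= => E1.
rewrite (_ : \prod_(i < n) _ = Re (\prod_(i < n) cintegral leb (fun x => (r i x)%:C%C))).
  by rewrite -E1; apply: eq_Rintegral => x _; rewrite P.
rewrite (eq_bigr (fun i => (Rintegral leb setT (r i))%:C%C)) ?P// => i _.
apply: complex_eq => //=; rewrite /Rintegral integral0_eq//.
Qed.

End rV_product.

Lemma cis_sum (R : realType) (I : Type) (s : seq I) (a : I -> R) :
  cis (\sum_(i <- s) a i) = \prod_(i <- s) cis (a i).
Proof.
elim: s => [|i s IH]; first by rewrite !big_nil cis0.
by rewrite !big_cons cisD IH.
Qed.

Lemma cmeasurable_cis d (T : measurableType d) (R : realType) (g : T -> R) :
  measurable_fun setT g -> cmeasurable (fun x => cis (g x)).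
Proof.
move=> mg; split; rewrite /cis/=.
  by apply: measurableT_comp mg; apply: continuous_measurable_fun; exact: continuous_cos.
by apply: measurableT_comp mg; apply: continuous_measurable_fun; exact: continuous_sin.
Qed.

Lemma conjcM (R : realType) (z w : R[i]) : ((z * w)^*)%C = (z^*)%C * (w^*)%C.
Proof. by case: z => a b; case: w => c e; apply: complex_eq => /=; ring. Qed.

Lemma conjc_cis (R : realType) (a : R) : ((cis a)^*)%C = cis (- a).
Proof. by rewrite /cis /= cosN sinN. Qed.

Section fourier_transform.
Context {R : realType} {d : nat}.
Local Notation E := ('rV[R]_d).
Local Notation mu := (@lebesgue_rV R d).
Local Notation leb := (@lebesgue_measure R).
Implicit Types (x y a b xi eta : E) (f m : E -> R[i]).

(** The forward transform for t = -1, the unnormalized inverse one for t = 1. Lemmas assuming t^2 =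
    1 serve both directions. *)
Definition FT (t : R) f xi : R[i] :=
  cintegral mu (fun x => cis (t * dotp x xi) * f x).

Definition lap (e : R) a x : R := \prod_(i < d) expR (- (e * `|x ord0 i - a ord0 i|)).

Definition cauchy_rV (e : R) x : R := \prod_(i < d) cauchy e (x ord0 i).

Lemma dotpC x y : dotp x y = dotp y x.
Proof. by apply: eq_bigr => i _; rewrite mulrC. Qed.

Lemma dotpBr x y b : dotp x (y - b) = dotp x y - dotp x b.
Proof. by rewrite /dotp -sumrB; apply: eq_bigr => i _; rewrite !mxE mulrBr. Qed.

Lemma dotp0 x : dotp 0 x = 0.
Proof. by rewrite /dotp big1// => i _; rewrite mxE mul0r. Qed.

Lemma measurable_coord (i : 'I_d) : measurable_fun setT (fun x : E => x ord0 i).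
Proof. exact: (measurable_rV_coord i). Qed.

Lemma measurable_dotp2 : measurable_fun setT (fun z : E * E => dotp z.1 z.2).
Proof.
apply: measurable_sum => i; apply: measurable_funM.
  exact: (measurableT_comp (measurable_coord i) measurable_fst).
exact: (measurableT_comp (measurable_coord i) measurable_snd).
Qed.

Lemma measurable_dotp xi : measurable_fun setT (fun x : E => dotp x xi).
Proof.
by apply: measurable_sum => i; apply: measurable_funM => //; exact: measurable_coord.
Qed.

Lemma cmeasurable_cis_dotp (t : R) xi : cmeasurable (fun x : E => cis (t * dotp x xi)).
Proof. by apply: cmeasurable_cis; apply: measurable_funM => //; exact: measurable_dotp. Qed.

Lemma cintegrable_cis (t : R) xi f : cintegrable mu f ->
  cintegrable mu (fun x => cis (t * dotp x xi) * f x).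
Proof.
by apply: cintegrableM_le1; [exact: cmeasurable_cis_dotp|move=> x; rewrite normc_cis].
Qed.

Lemma fourier_L1E f xi : fourier_L1 f xi = FT (- 1) f xi.
Proof. by apply: eq_cintegral => x; rewrite mulN1r. Qed.

Lemma FTZ t c f xi : cintegrable mu f -> FT t (fun x => c * f x) xi = c * FT t f xi.
Proof.
move=> fI; rewrite /FT -cintegralZ; last exact: cintegrable_cis.
by apply: eq_cintegral => x; rewrite mulrCA.
Qed.

Lemma FTB t f m xi : cintegrable mu f -> cintegrable mu m ->
  FT t (fun x => f x - m x) xi = FT t f xi - FT t m xi.
Proof.
move=> fI mI; rewrite /FT -cintegralB; [|exact: cintegrable_cis..].
by apply: eq_cintegral => x; rewrite mulrBr.
Qed.

Lemma lap_gt0 e a x : 0 < lap e a x.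
Proof. by apply: prodr_gt0 => i _; exact: expR_gt0. Qed.

Lemma lap_le1 e a x : 0 < e -> lap e a x <= 1.
Proof.
move=> e0; apply: prodr_ile1 => i _; rewrite expR_ge0 -expR0 ler_expR oppr_le0.
by rewrite mulr_ge0// ltW.
Qed.

Lemma measurable_lap e a : measurable_fun setT (lap e a).
Proof.
apply: measurable_prod => i _; apply: measurableT_comp => //.
apply: measurableT_comp => //; apply: measurable_funM => //.
by apply: measurableT_comp => //; apply: measurable_funB => //; exact: measurable_coord.
Qed.

Lemma cauchy_rV_ge0 e x : 0 < e -> 0 <= cauchy_rV e x.
Proof. by move=> e0; apply: prodr_ge0 => i _; exact: cauchy_ge0. Qed.

Lemma FT_lap t e a y : 0 < e ->
  cintegrable mu (fun x => (lap e a x)%:C%C) /\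
  FT t (fun x => (lap e a x)%:C%C) y =
  cis (t * dotp a y) * (cauchy_rV e (t *: y))%:C%C.
Proof.
move=> e0.
have eI i c : cintegrable leb (fun r : R => cis (c * r) * (expR (- (e * `|r - a ord0 i|)))%:C%C).
  apply: cintegrableM_le1.
  - by apply: cmeasurable_cis; exact: measurable_funM.
  - by move=> x; rewrite normc_cis.
  - by split; [exact: (integrable_exp e0)|exact: integrable0].
have [I1 E1] := cintegral_rV_prod (fun i => eI i (t * y ord0 i)).
have [I0 _] := cintegral_rV_prod (fun i => eI i 0).
split.
  congr cintegrable : I0; apply/funext => x.
  by rewrite /lap rmorph_prod; apply: eq_bigr => i _; rewrite mul0r cis0 mul1r.
transitivity (\prod_(i < d) (cis (t * y ord0 i * a ord0 i) * (cauchy e (t * y ord0 i))%:C%C) : R[i]).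
  rewrite -(eq_bigr _ (fun i _ => cintegral_exp e0 (t * y ord0 i) (a ord0 i))) -E1.
  apply: eq_cintegral => x; rewrite big_split/=; congr (_ * _); last by rewrite rmorph_prod.
  rewrite -cis_sum; congr cis; rewrite /dotp mulr_sumr; apply: eq_bigr => i _; ring.
rewrite big_split/=; congr (_ * _).
  by rewrite -cis_sum; congr cis; rewrite /dotp mulr_sumr; apply: eq_bigr => i _; ring.
by rewrite -rmorph_prod; congr (_%:C%C); apply: eq_bigr => i _; rewrite mxE.
Qed.

(** Both integrals are iterated forms of the double integral of cis(t x.xi) m(xi) w(x). The
    integrability of the two products comes from Fubini as well and is used on its own below. *)
Lemma multiplication_formula t m (w : E -> R[i]) : cintegrable mu m -> cintegrable mu w ->
  [/\ cintegrable mu (fun x => FT t m x * w x),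
      cintegrable mu (fun xi => m xi * FT t w xi) &
  cintegral mu (fun x => FT t m x * w x) = cintegral mu (fun xi => m xi * FT t w xi)].
Proof.
move=> mI wI; pose F (z : E * E) := cis (t * dotp z.1 z.2) * (m z.1 * w z.2).
have FI : cintegrable (mu \x mu)%E F.
  apply: cintegrableM_le1; last exact: cintegrable_tensor.
    by apply: cmeasurable_cis; apply: measurable_funM => //; exact: measurable_dotp2.
  by move=> x; rewrite normc_cis.
have [F1 F2] := cintegral_fubini_F FI; have [G1 G2] := cintegral_fubini_G FI.
have HF : (fun xi => cintegral mu (fun x => F (xi, x))) = (fun xi => m xi * FT t w xi).
  apply/funext => xi; rewrite /FT -cintegralZ; last exact: cintegrable_cis.
  by apply: eq_cintegral => x; rewrite /F/= dotpC; ring.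
have HG : (fun x => cintegral mu (fun xi => F (xi, x))) = (fun x => FT t m x * w x).
  apply/funext => x; rewrite /FT -cintegralZr; last exact: cintegrable_cis.
  by apply: eq_cintegral => xi; rewrite /F/=; ring.
rewrite -HF -HG; split; [exact: G1|exact: F1|exact: (etrans G2 (esym F2))].
Qed.

Lemma cauchy_rVN e x : cauchy_rV e (- x) = cauchy_rV e x.
Proof. by apply: eq_bigr => i _; rewrite mxE cauchyN. Qed.

Lemma cauchy_rV_sign e t x : t ^+ 2 = 1 -> cauchy_rV e (t *: x) = cauchy_rV e x.
Proof.
move=> /eqP; rewrite sqrf_eq1 => /orP[|] /eqP ->; first by rewrite scale1r.
by rewrite scaleN1r cauchy_rVN.
Qed.

(** Regularized inversion: damping the transform before transforming back yields the convolution of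
    m with a Cauchy kernel. This is the multiplication formula for a modulated Laplace kernel, whose
    transform is the kernel centred at eta. *)
Lemma FT_lap_FT t m e eta : t ^+ 2 = 1 -> 0 < e -> cintegrable mu m ->
  [/\ cintegrable mu (fun x => (lap e 0 x)%:C%C * FT t m x),
      cintegrable mu (fun xi => m xi * (cauchy_rV e (xi - eta))%:C%C) &
  FT (- t) (fun x => (lap e 0 x)%:C%C * FT t m x) eta =
  cintegral mu (fun xi => m xi * (cauchy_rV e (xi - eta))%:C%C)].
Proof.
move=> t1 e0 mI; pose w x := cis (- t * dotp x eta) * (lap e 0 x)%:C%C.
have lI : cintegrable mu (fun x => (lap e 0 x)%:C%C) by have [] := FT_lap t 0 0 e0.
have wI : cintegrable mu w := cintegrable_cis (- t) eta lI.
have FTw xi : FT t w xi = (cauchy_rV e (xi - eta))%:C%C.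
  transitivity (FT t (fun x => (lap e 0 x)%:C%C) (xi - eta)).
    apply: eq_cintegral => x; rewrite /w mulrA -cisD dotpBr; congr (cis _ * _); ring.
  have [_ ->] := FT_lap t 0 (xi - eta) e0.
  by rewrite dotp0 mulr0 cis0 mul1r cauchy_rV_sign.
have [I1 _ _] := multiplication_formula t mI lI.
have [_ + MF] := multiplication_formula t mI wI.
under eq_fun do rewrite FTw.
move=> I2; split => //; first by under eq_fun do rewrite mulrC.
rewrite -(eq_cintegral mu (fun xi => congr1 _ (FTw xi))) -MF.
by apply: eq_cintegral => x; rewrite /w; ring.
Qed.

Lemma lapN e x : lap (- e) 0 x * lap e 0 x = 1.
Proof.
by rewrite -big_split big1//= => i _; rewrite mulNr opprK expRxMexpNx_1.
Qed.

(** The damped transform is integrable, hence measurable, by Fubini; multiplying by exp(|x|_1)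
    undoes the damping. *)
Lemma cmeasurable_FT t m : t ^+ 2 = 1 -> cintegrable mu m -> cmeasurable (FT t m).
Proof.
move=> t1 mI; have [/cintegrableP[mF _] _ _] := FT_lap_FT 0 t1 ltr01 mI.
have := cmeasurableM (cmeasurable_real (measurable_lap (- 1) 0)) mF.
congr cmeasurable; apply/funext => x.
by rewrite mulrA -rmorphM/= lapN mul1r.
Qed.

Lemma integrable_cauchy e (c : R) : 0 < e ->
  leb.-integrable setT (EFin \o (fun r => cauchy e (r - c))).
Proof.
move=> e0; apply/integrableP; split.
  apply/measurable_EFinP; apply: measurableT_comp; first exact: measurable_cauchy.
  exact: measurable_funB.
under eq_integral do rewrite /= ger0_norm ?cauchy_ge0//.
by rewrite integral_cauchy// ltry.
Qed.

Lemma integral_cauchy_rV e a : 0 < e ->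
  mu.-integrable setT (EFin \o (fun x => cauchy_rV e (x - a))) /\
  (\int[mu]_x (cauchy_rV e (x - a))%:E = ((2 * pi) ^+ d)%:E)%E.
Proof.
move=> e0.
have [I1 E1] := integral_rV_prod (fun i : 'I_d => integrable_cauchy (a ord0 i) e0).
have H : (fun x : E => \prod_(i < d) cauchy e (x ord0 i - a ord0 i)) = (fun x => cauchy_rV e (x - a)).
  by apply/funext => x; apply: eq_bigr => i _; rewrite !mxE.
rewrite H in I1 E1; split => //.
rewrite -[LHS]fineK; last exact: integrable_fin_num.
congr EFin; rewrite -[LHS]/(Rintegral mu setT (fun x => cauchy_rV e (x - a))) E1.
under eq_bigr do rewrite /Rintegral integral_cauchy//=.
by rewrite prodr_const card_ord.
Qed.

Lemma measurable_cauchy_rV2 e : 0 < e ->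
  measurable_fun setT (fun z : E * E => cauchy_rV e (z.2 - z.1)).
Proof.
move=> e0; apply: measurable_prod => i _; apply: measurableT_comp.
  exact: measurable_cauchy.
under eq_fun do rewrite !mxE.
apply: measurable_funB.
  exact: (measurableT_comp (measurable_coord i) measurable_snd).
exact: (measurableT_comp (measurable_coord i) measurable_fst).
Qed.

Local Notation cd := ((2 * pi) ^+ d : R).

(** The kernel is symmetric and has mass [cd] in each variable, so after exchanging the integrals
    the two summands contribute equally. *)
Lemma cauchy_rV_schur e (f : E -> R) : 0 < e -> measurable_fun setT f ->
  (forall x, 0 <= f x) ->
  (\int[mu]_x \int[mu]_y ((f x + f y) * cauchy_rV e (y - x))%:E =
   (2 * cd)%:E * \int[mu]_x (f x)%:E)%E.
Proof.
move=> e0 mf f0; have K0 x := cauchy_rV_ge0 x e0.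
have mK := measurable_cauchy_rV2 e0.
have mK1 x : measurable_fun setT (fun y : E => cauchy_rV e (y - x)).
  exact: (measurableT_comp mK (pair1_measurable x)).
have mf2 : measurable_fun setT (fun z : E * E => f z.2).
  exact: measurableT_comp measurable_snd.
have fK x : (\int[mu]_y (f x * cauchy_rV e (y - x))%:E = (f x * cd)%:E)%E.
  under eq_integral do rewrite EFinM.
  have [_ E1] := integral_cauchy_rV x e0.
  rewrite ge0_integralZl ?E1//; [exact/measurable_EFinP|by move=> y _; rewrite lee_fin|by rewrite lee_fin].
have cd0 : 0 <= cd by rewrite exprn_ge0// mulr_ge0// pi_ge0.
under eq_integral => x _.
  under eq_integral do rewrite mulrDl EFinD.
  rewrite ge0_integralD//; last 4 first.
  - by move=> y _; rewrite lee_fin mulr_ge0.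
  - by apply/measurable_EFinP; exact: measurable_funM.
  - by move=> y _; rewrite lee_fin mulr_ge0.
  - by apply/measurable_EFinP; exact: measurable_funM.
  rewrite fK; over.
have mfK : measurable_fun setT (fun z : E * E => (f z.2 * cauchy_rV e (z.2 - z.1))%:E).
  by apply/measurable_EFinP; exact: measurable_funM.
have fK0 (z : E * E) : (0 <= (f z.2 * cauchy_rV e (z.2 - z.1))%:E)%E.
  by rewrite lee_fin mulr_ge0.
rewrite ge0_integralD//; last 4 first.
- by move=> x _; rewrite lee_fin mulr_ge0.
- by apply/measurable_EFinP; exact: measurable_funM.
- by move=> x _; apply: integral_ge0 => y _; rewrite lee_fin mulr_ge0.
- by apply: (@measurable_fun_fubini_tonelli_F _ _ _ _ _ mu (fun z : E * E => (f z.2 * cauchy_rV e (z.2 - z.1))%:E)).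
rewrite (@fubini_tonelli _ _ _ _ _ mu mu _ mfK fK0).
have -> : (\int[mu]_y \int[mu]_x (f y * cauchy_rV e (y - x))%:E = \int[mu]_y (f y * cd)%:E)%E.
  apply: eq_integral => y _; rewrite -fK; apply: eq_integral => x _.
  by rewrite -opprB cauchy_rVN.
rewrite -ge0_integralD//; last 4 first.
- by move=> x _; rewrite lee_fin mulr_ge0.
- by apply/measurable_EFinP; exact: measurable_funM.
- by move=> x _; rewrite lee_fin mulr_ge0.
- by apply/measurable_EFinP; exact: measurable_funM.
rewrite -ge0_integralZl//; last 3 first.
- exact/measurable_EFinP.
- by move=> x _; rewrite lee_fin.
- by rewrite lee_fin mulr_ge0.
by apply: eq_integral => x _; rewrite -EFinD -EFinM; congr EFin; ring.
Qed.

(* Schur's test for the kernel [cauchy_rV], of mass [cd], with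
   [2 |m(x)| |m(y)| <= |m(x)|^2 + |m(y)|^2]. The factor 2 comes from bounding real
   and imaginary parts separately; only boundedness is used, not its value. *)
Lemma FT_lap_N2_le t m e : t ^+ 2 = 1 -> 0 < e -> cintegrable mu m ->
  (\int[mu]_x (sqn (FT t m x) * lap e 0 x)%:E <= (2 * cd)%:E * N2 mu m)%E.
Proof.
move=> t1 e0 mI; have mF := cmeasurable_FT t1 mI.
have [LI _ _] := FT_lap_FT 0 t1 e0 mI.
have K0 x := cauchy_rV_ge0 x e0.
have mm : cmeasurable m by case/cintegrableP : mI.
(* Chosen so that FT m * w = |FT m|^2 lap. The transform of w is the conjugate of m convolved with
   the Cauchy kernel, and the multiplication formula turns the left-hand side into a quadratic form
   in m. *)
pose w x := ((FT t m x)^*)%C * (lap e 0 x)%:C%C.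
have wE x : w x = (((lap e 0 x)%:C%C * FT t m x)^*)%C.
  by rewrite /w; case: (FT t m x) => u v; apply: complex_eq => /=; ring.
have wI : cintegrable mu w.
  by rewrite (_ : w = fun x => (((lap e 0 x)%:C%C * FT t m x)^*)%C); [exact: cintegrable_conj|exact/funext].
have FTw xi : FT t w xi = ((cintegral mu (fun eta => m eta * (cauchy_rV e (eta - xi))%:C%C))^*)%C.
  have [_ _ <-] := FT_lap_FT xi t1 e0 mI.
  rewrite /FT -cintegral_conj; last exact: cintegrable_cis.
  by apply: eq_cintegral => x; rewrite wE [in RHS]conjcM conjc_cis mulNr opprK.
have [I1 I2 MF] := multiplication_formula t mI wI.
have Fw x : FT t m x * w x = (sqn (FT t m x) * lap e 0 x)%:C%C.
  rewrite /w; move: (FT t m x) (lap e 0 x) => [u v] l.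
  by apply: complex_eq; rewrite /sqn /=; ring.
have -> : (\int[mu]_x (sqn (FT t m x) * lap e 0 x)%:E)%E = (Re (cintegral mu (fun x => FT t m x * w x)))%:E.
  have [J _] := I1.
  rewrite -[Re (cintegral _ _)]/(fine (\int[mu]_x (Re (FT t m x * w x))%:E)%E).
  rewrite fineK; last exact: integrable_fin_num.
  by apply: eq_integral => x _; rewrite Fw.
rewrite MF; apply: (@le_trans _ _ (\int[mu]_xi (Normc.normc (m xi * FT t w xi))%:E)%E).
  have NI := integrable_normc I2.
  rewrite -[leRHS]fineK; last exact: integrable_fin_num.
  by rewrite lee_fin; apply: le_trans (abs_Re_cintegral_le I2); exact: ler_norm.
have mn : measurable_fun setT (fun xi => Normc.normc (m xi)) by exact: measurable_normc.
have ms : measurable_fun setT (fun xi => sqn (m xi)) by exact: measurable_sqn.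
rewrite -(@cauchy_rV_schur e)//; last by move=> x; exact: sqn_ge0.
have mH : measurable_fun setT (fun z : E * E => ((sqn (m z.1) + sqn (m z.2)) * cauchy_rV e (z.2 - z.1))%:E).
  apply/measurable_EFinP; apply: measurable_funM; last exact: measurable_cauchy_rV2.
  by apply: measurable_funD; [exact: (measurableT_comp ms measurable_fst)
                             |exact: (measurableT_comp ms measurable_snd)].
have H0 (z : E * E) : (0 <= ((sqn (m z.1) + sqn (m z.2)) * cauchy_rV e (z.2 - z.1))%:E)%E.
  by rewrite lee_fin; apply: mulr_ge0; [apply: addr_ge0; exact: sqn_ge0|exact: K0].
apply: ge0_le_integral => //.
- by move=> xi _; rewrite lee_fin normc_ge0.
- by apply/measurable_EFinP/measurable_normc; case/cintegrableP : I2.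
- by apply: (@measurable_fun_fubini_tonelli_F _ _ _ _ _ mu (fun z : E * E => ((sqn (m z.1) + sqn (m z.2)) * cauchy_rV e (z.2 - z.1))%:E)).
move=> xi _.
have [_ KI _] := FT_lap_FT xi t1 e0 mI.
rewrite FTw Normc.normcM.
set G := cintegral mu _.
have nG : Normc.normc (G^*)%C <= 2 * Rintegral mu setT (fun eta => Normc.normc (m eta * (cauchy_rV e (eta - xi))%:C%C)).
  rewrite (_ : Normc.normc (G^*)%C = Normc.normc G); last first.
    by case: (G) => u v /=; rewrite sqrrN.
  rewrite mulr_natl mulr2n (le_trans (normc_le_ReIm _))//.
  by rewrite lerD//; [exact: abs_Re_cintegral_le|exact: abs_Im_cintegral_le].
have NI := integrable_normc KI.
apply: (@le_trans _ _ (2 * Normc.normc (m xi) * Rintegral mu setT (fun eta => Normc.normc (m eta * (cauchy_rV e (eta - xi))%:C%C)))%:E).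
  by rewrite lee_fin (mulrC 2) -mulrA ler_wpM2l ?normc_ge0.
rewrite EFinM fineK; last exact: integrable_fin_num.
have mK1 : measurable_fun setT (fun y : E => cauchy_rV e (y - xi)).
  exact: (measurableT_comp (measurable_cauchy_rV2 e0) (pair1_measurable xi)).
rewrite -ge0_integralZl//; last 3 first.
- by case/integrableP : NI.
- by move=> y _; rewrite lee_fin normc_ge0.
- by rewrite lee_fin mulr_ge0 ?normc_ge0.
apply: ge0_le_integral => //.
- by move=> y _; rewrite -EFinM lee_fin !mulr_ge0 ?normc_ge0.
- by apply: measurable_funeM; case/integrableP : NI.
- apply/measurable_EFinP; apply: measurable_funM => //.
  exact: measurable_funD.
move=> y _; rewrite -EFinM lee_fin Normc.normcM normc_real ger0_norm// mulrA ler_wpM2r//.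
have := sqr_ge0 (Normc.normc (m xi) - Normc.normc (m y)).
by rewrite sqrrB -!normc_sqr; lra.
Qed.

Lemma lapE e a x : lap e a x = expR (- (e * \sum_(i < d) `|x ord0 i - a ord0 i|)).
Proof.
rewrite mulr_sumr -sumrN (big_morph _ (@expRD R) (@expR0 R)).
by apply: eq_bigr => i _.
Qed.

Lemma lap_cvg x : lap (n.+1%:R^-1) 0 x @[n --> \oo] --> (1 : R).
Proof.
pose S := \sum_(i < d) `|x ord0 i - (0 : E) ord0 i|.
have H : expR (- (n.+1%:R^-1 * S)) @[n --> \oo] --> expR (- (0 * S)).
  apply: continuous_cvg; first exact: continuous_expR.
  by apply: cvgN; apply: cvgM; [exact: cvg_harmonic|exact: cvg_cst].
rewrite mul0r oppr0 expR0 in H.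
by under eq_fun do rewrite lapE.
Qed.

(** The damped bound is uniform in the damping parameter, so Fatou's lemma removes the damping.
    [FT_lap_N2_le] applies because lap^2 <= lap. *)
Lemma plancherel_le t m : t ^+ 2 = 1 -> cintegrable mu m ->
  (N2 mu (FT t m) <= (2 * cd)%:E * N2 mu m)%E.
Proof.
move=> t1 mI; have mF := cmeasurable_FT t1 mI.
pose F n x := (lap (n.+1%:R^-1) 0 x)%:C%C * FT t m x.
apply: (@N2_fatou _ _ _ _ F).
- move=> n; apply: cmeasurableM => //; apply: cmeasurable_real; exact: measurable_lap.
- exact: mF.
- apply: nearW => x.
  rewrite (_ : (fun n => sqn (F n x)) = (fun n => lap n.+1%:R^-1 0 x * lap n.+1%:R^-1 0 x * sqn (FT t m x))); last first.
    by apply/funext => n; rewrite sqnM sqn_real expr2.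
  have H : lap n.+1%:R^-1 0 x * lap n.+1%:R^-1 0 x * sqn (FT t m x) @[n --> \oo] --> 1 * 1 * sqn (FT t m x).
    by apply: cvgM; [apply: cvgM; exact: lap_cvg|exact: cvg_cst].
  by rewrite !mul1r in H; exact: H.
- apply: nearW => n; have e0 : 0 < n.+1%:R^-1 :> R by rewrite invr_gt0.
  apply: le_trans (FT_lap_N2_le t1 e0 mI).
  apply: ge0_le_integral => //.
  + by move=> x _; rewrite lee_fin sqn_ge0.
  + apply/measurable_EFinP/measurable_sqn; apply: cmeasurableM => //.
    by apply: cmeasurable_real; exact: measurable_lap.
  + apply/measurable_EFinP/measurable_funM; first exact: measurable_sqn.
    exact: measurable_lap.
  + move=> x _; rewrite lee_fin /F sqnM sqn_real mulrC ler_wpM2l ?sqn_ge0//.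
    by rewrite expr2 ler_piMr ?lap_le1// ltW// lap_gt0.
Qed.

End fourier_transform.

(** * Fourier inversion for bounded, continuous, integrable functions *)

Lemma normcD_le (R : realType) (z w : R[i]) :
  Normc.normc (z + w) <= Normc.normc z + Normc.normc w.
Proof.
have E (u : R[i]) : `|u| = (Normc.normc u)%:C%C by rewrite normc_def normc_sqrt.
by have := ler_normD z w; rewrite !E -rmorphD/= lecR.
Qed.

Lemma L2norm_cvg0 d (T : measurableType d) (R : realType) (mu : {measure set T -> \bar R})
    (F : nat -> T -> R[i]) : (forall n, inL2 mu (F n)) ->
  N2 mu (F n) @[n --> \oo] --> 0%E -> L2norm mu (F n) @[n --> \oo] --> 0%E.
Proof.
move=> FL; under eq_fun do rewrite inL2_N2//; under [in X in _ -> X]eq_fun do rewrite inL2_L2norm//.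
move=> /fine_cvgP[_ H]; apply/fine_cvgP; split; first exact: nearW.
have H2 : Num.sqrt (nrm mu (F n) ^+ 2) @[n --> \oo] --> Num.sqrt (0 : R).
  by apply: continuous_cvg; [exact: sqrt_continuous|exact: H].
rewrite sqrtr0 in H2.
rewrite (_ : fine \o _ = fun n => Num.sqrt (nrm mu (F n) ^+ 2))//.
by apply/funext => n /=; rewrite sqrtr_sqr ger0_norm// nrm_ge0.
Qed.

Lemma N2_dominated d (T : measurableType d) (R : realType) (mu : {measure set T -> \bar R})
    (F : nat -> T -> R[i]) (g : T -> R[i]) :
  (forall n, cmeasurable (F n)) -> inL2 mu g ->
  (forall n x, sqn (F n x) <= sqn (g x)) ->
  (forall x, sqn (F n x) @[n --> \oo] --> (0 : R)) ->
  N2 mu (F n) @[n --> \oo] --> 0%E.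
Proof.
move=> mF /inL2P[mg goo] Fg F0.
have gI : mu.-integrable setT (fun x => (sqn (g x))%:E).
  apply/integrableP; split; first exact/measurable_EFinP/measurable_sqn.
  by under eq_integral do rewrite abse_EFin ger0_norm ?sqn_ge0//.
have := @dominated_cvg _ _ _ mu _ measurableT (fun n x => (sqn (F n x))%:E) (cst 0%E)
  (fun x => (sqn (g x))%:E).
rewrite integral0; apply => //.
- by move=> n; exact/measurable_EFinP/measurable_sqn.
- by move=> x _; apply: cvg_EFin; [exact: nearW|exact: F0].
- by move=> n x _; rewrite abse_EFin lee_fin ger0_norm ?sqn_ge0.
Qed.

Lemma sqn_cvg_normc (R : realType) (u : nat -> R[i]) (z : R[i]) :
  Normc.normc (u n - z) @[n --> \oo] --> (0 : R) -> sqn (u n) @[n --> \oo] --> sqn z.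
Proof.
move=> H; apply: sqn_cvg; apply/cvgrPdist_le => e e0;
  move/cvgrPdist_le : H => /(_ e e0); apply: filterS => n;
  rewrite sub0r normrN ger0_norm ?normc_ge0//; apply: le_trans; rewrite distrC.
  by rewrite -ReN -ReD abs_Re_le.
by rewrite -ImN -ImD abs_Im_le.
Qed.

Lemma Rintegral_sum d (T : measurableType d) (R : realType) (mu : {measure set T -> \bar R})
    I (s : seq I) (f : I -> T -> R) :
  (forall i, mu.-integrable setT (EFin \o f i)) ->
  mu.-integrable setT (EFin \o (fun x => \sum_(i <- s) f i x)) /\
  Rintegral mu setT (fun x => \sum_(i <- s) f i x) = \sum_(i <- s) Rintegral mu setT (f i).
Proof.
move=> fI; elim: s => [|i s [IH1 IH2]].
  rewrite big_nil; split; last by rewrite /Rintegral integral0_eq// => x _; rewrite big_nil.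
  rewrite (_ : EFin \o _ = cst 0%E); first exact: integrable0.
  by apply/funext => x /=; rewrite big_nil.
have E : (fun x => \sum_(j <- i :: s) f j x) = (fun x => f i x + \sum_(j <- s) f j x).
  by apply/funext => x; rewrite big_cons.
rewrite E big_cons -IH2 RintegralD//; split => //.
exact: (integrableD measurableT (fI i) IH1).
Qed.

Section inverse_fourier.
Context {R : realType} {d : nat}.
Local Notation E := ('rV[R]_d).
Local Notation mu := (@lebesgue_rV R d).
Local Notation leb := (@lebesgue_measure R).
Local Notation cd := ((2 * pi) ^+ d : R).

Lemma cd_gt0 : 0 < cd.
Proof. by rewrite exprn_gt0// mulr_gt0// pi_gt0. Qed.

Lemma integral_cauchy_prod (e : 'I_d -> R) (a : E) : (forall i, 0 < e i) ->
  mu.-integrable setT (EFin \o (fun x : E => \prod_(i < d) cauchy (e i) ((x - a) ord0 i))) /\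
  Rintegral mu setT (fun x : E => \prod_(i < d) cauchy (e i) ((x - a) ord0 i)) = cd.
Proof.
move=> e0.
have [I1 E1] := integral_rV_prod (fun i : 'I_d => integrable_cauchy (a ord0 i) (e0 i)).
have H : (fun x : E => \prod_(i < d) cauchy (e i) (x ord0 i - a ord0 i)) =
    (fun x => \prod_(i < d) cauchy (e i) ((x - a) ord0 i)).
  by apply/funext => x; apply: eq_bigr => i _; rewrite !mxE.
rewrite H in I1 E1; split => //; rewrite E1.
under eq_bigr do rewrite /Rintegral integral_cauchy//=.
by rewrite prodr_const card_ord.
Qed.

(** Away from 0 the narrow kernel is at most O(e) times the kernel of width 1, which is again
    integrable with mass 2 pi. *)
Lemma cauchy_tail (e dl x : R) : 0 < e -> 0 < dl -> dl <= `|x| ->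
  cauchy e x <= e * (1 + dl ^- 2) * cauchy 1 x.
Proof.
move=> e0 dl0 dlx; have x20 : 0 < x ^+ 2.
  by rewrite -real_normK ?num_real// exprn_gt0// (lt_le_trans dl0).
have H : 1 + x ^+ 2 <= (1 + dl ^- 2) * x ^+ 2.
  rewrite mulrDl mul1r addrC lerD2l mulrC ler_pdivlMr ?exprn_gt0// mul1r.
  by rewrite -[leRHS]real_normK ?num_real// ler_pXn2r ?nnegrE// ltW.
rewrite /cauchy expr1n mulr1 ler_pdivrMr ?cauchy_den//.
have c0 : 0 <= 1 + dl ^- 2 by rewrite addr_ge0// invr_ge0 exprn_ge0// ltW.
have D1 : 0 < 1 + x ^+ 2 by rewrite ltr_wpDr ?sqr_ge0.
move: (1 + dl ^- 2) c0 H => c c0 H.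
rewrite [leRHS](_ : _ = 2 * e * (c * (e ^+ 2 + x ^+ 2)) / (1 + x ^+ 2)); last first.
  by field; rewrite gt_eqF.
rewrite ler_pdivlMr// ler_pM2l ?mulr_gt0//; apply: le_trans H _.
by rewrite ler_wpM2l// lerDr sqr_ge0.
Qed.

Variables (M : E -> R[i]) (B : R).
Hypothesis MI : cintegrable mu M.
Hypothesis MB : forall xi, Normc.normc (M xi) <= B.
Hypothesis Mc : forall eta eps, 0 < eps -> exists2 dl, 0 < dl &
  forall xi : E, (forall i, `|(xi - eta) ord0 i| < dl) -> Normc.normc (M xi - M eta) <= eps.

Let B0 : 0 <= B. Proof. by apply: le_trans (MB 0); exact: normc_ge0. Qed.

(** Near eta the continuity of M is used. Elsewhere some coordinate i is at distance at least dl,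
    and its factor is traded for a kernel of width 1 at the price of O(e); summing over i bounds the
    whole exterior contribution. *)
Lemma approx_identity (eta : E) :
  Normc.normc (cintegral mu (fun xi => M xi * (cauchy_rV n.+1%:R^-1 (xi - eta))%:C%C) -
    cd%:C%C * M eta) @[n --> \oo] --> (0 : R).
Proof.
apply/cvgrPdist_le => eps eps0; have cd0 := cd_gt0.
(* The near part contributes eps / 4 to each of the real and imaginary parts, eps / 2 in all; twice
   the far part is [Cd] * e, made smaller than eps / 2 by the choice of n. *)
have [dl dl0 Hdl] := @Mc eta (eps / (4 * cd)) ltac:(by rewrite divr_gt0// mulr_gt0).
pose c2 : R := 1 + dl ^- 2.
have c20 : 0 <= c2 by rewrite addr_ge0// invr_ge0 exprn_ge0// ltW.
pose Cd : R := 4 * B * c2 * d%:R * cd.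
have Cd0 : 0 <= Cd by rewrite /Cd mulr_ge0 ?(ltW cd0)// mulr_ge0// mulr_ge0// mulr_ge0.
have /cvgrPdist_le/(_ (eps / 2 / (Cd + 1))) := @cvg_harmonic R.
have eC : 0 < eps / 2 / (Cd + 1) by rewrite !divr_gt0// ltr_wpDl.
move=> /(_ eC); apply: filterS => n; rewrite /harmonic !sub0r !normrN /=.
have e0 : 0 < n.+1%:R^-1 :> R by rewrite invr_gt0.
rewrite gtr0_norm// ger0_norm ?normc_ge0//; set e := _^-1 in e0 * => eCd.
(* Widths of the comparison kernel [G i]: 1 in the far coordinate i, e in the others. Its mass is
   still [cd]. *)
pose ei (i j : 'I_d) : R := if j == i then 1 else e.
have ei0 i j : 0 < ei i j by rewrite /ei; case: ifP.
pose G (i : 'I_d) (x : E) : R := \prod_(j < d) cauchy (ei i j) (x ord0 j).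
have G0 i x : 0 <= G i x by apply: prodr_ge0 => j _; exact: cauchy_ge0.
pose K (xi : E) := cauchy_rV e (xi - eta).
have K0 xi : 0 <= K xi := cauchy_rV_ge0 _ e0.
have [KI KE] := @integral_cauchy_prod (fun=> e) eta (fun=> e0).
have GI i : mu.-integrable setT (EFin \o (fun x => G i (x - eta))).
  by have [] := integral_cauchy_prod eta (ei0 i).
have GE i : Rintegral mu setT (fun x => G i (x - eta)) = cd.
  by have [] := integral_cauchy_prod eta (ei0 i).
have KG i (xi : E) : dl <= `|(xi - eta) ord0 i| -> K xi <= e * c2 * G i (xi - eta).
  move=> Hi; rewrite /K /cauchy_rV /G /ei (bigD1 i)//= [in leRHS](bigD1 i)//= eqxx mulrA.
  rewrite [in leRHS](eq_bigr (fun j => cauchy e ((xi - eta) ord0 j))) => [|j /negbTE ->//].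
  rewrite ler_wpM2r//; last exact: cauchy_tail.
  by apply: prodr_ge0 => j _; exact: cauchy_ge0.
pose bd xi := eps / (4 * cd) * K xi + \sum_(i < d) 2 * B * (e * c2) * G i (xi - eta).
have sum_ge0 xi (P : pred 'I_d) : 0 <= \sum_(i < d | P i) 2 * B * (e * c2) * G i (xi - eta).
  by apply: sumr_ge0 => i _; rewrite mulr_ge0// mulr_ge0// ?mulr_ge0// ltW.
have bdP xi : Normc.normc (M xi - M eta) * K xi <= bd xi.
  have [all_lt|] := pselect (forall i, `|(xi - eta) ord0 i| < dl).
    by rewrite /bd (le_trans (ler_wpM2r (K0 xi) (Hdl xi all_lt)))// lerDl.
  move=> /existsNP[i /negP]; rewrite -leNgt => Hi.
  rewrite /bd (bigD1 i)//=; apply: ler_wpDl.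
    by rewrite mulr_ge0// divr_ge0 ?mulr_ge0// ltW.
  apply: ler_wpDr; first exact: sum_ge0.
  rewrite -mulrA; apply: ler_pM; rewrite ?normc_ge0 ?K0 ?KG//.
  have := normcD_le (M xi) (- M eta); rewrite normcN.
  by have := MB xi; have := MB eta; lra.
have cI c (f : E -> R) : mu.-integrable setT (EFin \o f) -> mu.-integrable setT (EFin \o (fun x => c * f x)).
  exact: integrableZl.
have [SI SE] := Rintegral_sum (index_enum 'I_d) (fun i => cI (2 * B * (e * c2)) _ (GI i)).
have sumI : mu.-integrable setT (EFin \o bd).
  exact: (integrableD measurableT (cI (eps / (4 * cd)) _ KI) SI).
have sumE : Rintegral mu setT bd = eps / 4 + 2 * B * (e * c2) * d%:R * cd.
  rewrite RintegralD//; last exact: cI.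
  rewrite SE RintegralZl// KE.
  under eq_bigr do rewrite RintegralZl// GE.
  rewrite sumr_const card_ord -mulr_natr; field.
  by rewrite gt_eqF.
have KcI : cintegrable mu (fun xi => (K xi)%:C%C) by split; [exact: KI|exact: integrable0].
have MKI : cintegrable mu (fun xi => M xi * (K xi)%:C%C).
  by have [] := @FT_lap_FT _ _ 1 M e eta (expr1n _ _) e0 MI.
have E1 : cd%:C%C * M eta = cintegral mu (fun xi => M eta * (K xi)%:C%C).
  rewrite cintegralZ// mulrC; congr (_ * _); apply: complex_eq => /=; first by rewrite -KE.
  by rewrite /Rintegral integral0_eq.
have MKI' := cintegrableZ (M eta) KcI.
rewrite E1 -cintegralB//.
have dI := cintegrableB MKI MKI'.
have nle : Rintegral mu setT (fun xi => Normc.normc (M xi * (K xi)%:C%C - M eta * (K xi)%:C%C)) <=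
    eps / 4 + 2 * B * (e * c2) * d%:R * cd.
  rewrite -sumE; apply: le_Rintegral => //; first exact: integrable_normc.
  by move=> xi _; rewrite -mulrBl Normc.normcM normc_real ger0_norm.
apply: le_trans (normc_le_ReIm _) _.
apply: le_trans (lerD (le_trans (abs_Re_cintegral_le dI) nle) (le_trans (abs_Im_cintegral_le dI) nle)) _.
rewrite [leLHS](_ : _ = eps / 2 + Cd * e); last by rewrite /Cd; lra.
rewrite [leRHS]splitr lerD2l.
have C1 : 0 < Cd + 1 by rewrite ltr_wpDl.
rewrite ler_pdivlMr// in eCd; rewrite mulrC.
by apply: le_trans eCd; rewrite ler_wpM2l ?lerDl// ltW.
Qed.

Lemma bounded_inL2 : inL2 mu M.
Proof.
have mM : cmeasurable M by case/cintegrableP : MI.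
apply/inL2P; split => //; have NI := integrable_normc MI.
have BI : mu.-integrable setT (fun x => (B * Normc.normc (M x))%:E).
  by under eq_fun do rewrite EFinM; exact: integrableZl.
apply: (@le_lt_trans _ _ (\int[mu]_x (B * Normc.normc (M x))%:E)%E).
  apply: ge0_le_integral => //.
  - by move=> x _; rewrite lee_fin sqn_ge0.
  - exact/measurable_EFinP/measurable_sqn.
  - by case/integrableP : BI.
  - by move=> x _; rewrite lee_fin -normc_sqr expr2 ler_wpM2r ?normc_ge0.
by rewrite ltey_eq integrable_fin_num.
Qed.

Definition invFT (x : E) : R[i] := (cd^-1)%:C%C * FT 1 M x.

Let M2oo : (N2 mu M < +oo)%E. Proof. by case/inL2P : bounded_inL2. Qed.

Lemma inL2_invFT : inL2 mu invFT.
Proof.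
apply: inL2Z; apply/inL2P; split; first exact: (cmeasurable_FT (expr1n _ _)).
apply: le_lt_trans (plancherel_le (expr1n _ _) MI) _.
by rewrite lte_mul_pinfty// lee_fin mulr_ge0// ltW// cd_gt0.
Qed.

(** [invFT] is obtained in L^2, while [is_fourier] asks for approximants that are also integrable;
    damping by a Laplace kernel of vanishing rate produces them, and their transforms are Cauchy
    averages of M. *)
Let L n x : R := lap n.+1%:R^-1 0 (x : E).
Let f n x := (L n x)%:C%C * invFT x.

Let L_bounds n x : 0 <= L n x <= 1.
Proof. by rewrite ltW ?lap_gt0//= lap_le1// invr_gt0. Qed.

Let mf n : cmeasurable (f n).
Proof.
apply: cmeasurableM; last by case: inL2_invFT.
by apply: (cmeasurable_real (f := L n)); exact: measurable_lap.
Qed.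

Let fI n : cintegrable mu (f n).
Proof.
have e0 : 0 < n.+1%:R^-1 :> R by rewrite invr_gt0.
have [LI _ _] := FT_lap_FT 0 (expr1n _ _) e0 MI.
have := cintegrableZ (cd^-1)%:C%C LI; congr cintegrable.
by apply/funext => x; rewrite /f /invFT mulrCA.
Qed.

Let fB_le n m x : (n <= m)%N -> sqn (f n x - f m x) <= sqn (f n x - invFT x).
Proof.
move=> nm; have Lnm : L n x <= L m x.
  rewrite /L !lapE ler_expR lerN2 ler_wpM2r ?sumr_ge0//.
  by rewrite lef_pV2 ?posrE// ler_nat ltnS.
have -> : f n x - f m x = (L n x - L m x)%:C%C * invFT x.
  by rewrite rmorphB/= mulrBl.
have -> : f n x - invFT x = (L n x - 1)%:C%C * invFT x.
  by rewrite rmorphB/= mulrBl mul1r.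
rewrite !(sqnM _ (invFT x)) !sqn_real; apply: (ler_wpM2r (sqn_ge0 (invFT x))).
rewrite -(sqrrN (_ - L m x)) -(sqrrN (_ - 1)) !opprB.
have /andP[_ L1] := L_bounds m x.
by rewrite ler_pXn2r ?nnegrE ?subr_ge0// ?lerD2r//; exact: le_trans L1.
Qed.

Let f_cvg : N2 mu (fun x => f n x - invFT x) @[n --> \oo] --> 0%E.
Proof.
apply: (@N2_dominated _ _ _ _ (fun n x => f n x - invFT x) invFT).
- by move=> n; apply: cmeasurableB => //; case: inL2_invFT.
- exact: inL2_invFT.
- move=> n x; have -> : f n x - invFT x = (L n x - 1)%:C%C * invFT x.
    by rewrite rmorphB/= mulrBl mul1r.
  rewrite sqnM sqn_real ler_piMl ?sqn_ge0// -sqrrN opprB expr_le1//;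
    by have := L_bounds n x; lra.
- move=> x; rewrite (_ : (fun _ => _) = fun n => (L n x - 1) * (L n x - 1) * sqn (invFT x)).
    have H : L n x @[n --> \oo] --> (1 : R) by exact: lap_cvg.
    have H1 : L n x - 1 @[n --> \oo] --> (1 : R) - 1 by apply: cvgB => //; exact: cvg_cst.
    have := cvgM (cvgM H1 H1) (cvg_cst (sqn (invFT x))).
    by rewrite subrr mulr0 mul0r; exact.
  apply/funext => n; have -> : f n x - invFT x = (L n x - 1)%:C%C * invFT x.
    by rewrite rmorphB/= mulrBl mul1r.
  by rewrite sqnM sqn_real expr2.
Qed.

Let fhE n eta : fourier_L1 (f n) eta = (cd^-1)%:C%C *
  cintegral mu (fun xi => M xi * (cauchy_rV n.+1%:R^-1 (xi - eta))%:C%C).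
Proof.
have e0 : 0 < n.+1%:R^-1 :> R by rewrite invr_gt0.
have [LI _ <-] := FT_lap_FT eta (expr1n _ _) e0 MI.
rewrite fourier_L1E -FTZ//; apply: eq_cintegral => x.
by congr (_ * _); rewrite /f /invFT mulrCA.
Qed.

Let fh_cvg eta : Normc.normc (fourier_L1 (f n) eta - M eta) @[n --> \oo] --> (0 : R).
Proof.
have H : cd^-1 * Normc.normc (cintegral mu (fun xi => M xi * (cauchy_rV n.+1%:R^-1 (xi - eta))%:C%C) -
    cd%:C%C * M eta) @[n --> \oo] --> cd^-1 * 0.
  by apply: cvgM; [exact: cvg_cst|exact: approx_identity].
rewrite mulr0 in H.
have E n : fourier_L1 (f n) eta - M eta = (cd^-1)%:C%C *
  (cintegral mu (fun xi => M xi * (cauchy_rV n.+1%:R^-1 (xi - eta))%:C%C) - cd%:C%C * M eta).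
  by rewrite fhE mulrBr mulrA -rmorphM/= mulVf ?mul1r// gt_eqF// cd_gt0.
have c0 : 0 <= cd^-1 by rewrite invr_ge0 ltW// cd_gt0.
by under eq_fun do rewrite E Normc.normcM normc_real (ger0_norm c0).
Qed.

Let cm_fh n : cmeasurable (fourier_L1 (f n)).
Proof.
have -> : fourier_L1 (f n) = FT (- 1) (f n) by apply/funext => x; rewrite fourier_L1E.
by apply: cmeasurable_FT; rewrite ?sqrrN ?expr1n.
Qed.

(* Fatou's lemma as m -> oo: [fourier_L1 (f m)] tends to [M] pointwise, and
   [|f n - f m| <= |f n - invFT|] for n <= m. *)
Let fh_le n : (N2 mu (fun x => (fourier_L1 (f n) x - M x)%R) <=
  (2 * cd)%:E * N2 mu (fun x => (f n x - invFT x)%R))%E.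
Proof.
have mM : cmeasurable M by case/cintegrableP : MI.
apply: (@N2_fatou _ _ _ _ (fun m x => (fourier_L1 (f n) x - fourier_L1 (f m) x)%R)).
- by move=> m; exact: cmeasurableB.
- exact: cmeasurableB.
- apply: nearW => x; apply: sqn_cvg_normc.
  rewrite (_ : (fun _ => _) = (fun m => Normc.normc (fourier_L1 (f m) x - M x))); first exact: fh_cvg.
  by apply/funext => m; rewrite opprB (addrC (_ - _)) addrA subrK -opprB normcN.
- exists n => //= m nm.
  apply: (@le_trans _ _ ((2 * cd)%:E * N2 mu (fun x => (f n x - f m x)%R))%E).
    rewrite (@eq_N2 _ _ _ _ _ (FT (- 1) (fun x => f n x - f m x))).
      by apply: plancherel_le; [rewrite sqrrN expr1n|exact: cintegrableB].
    by move=> x; rewrite FTB// !fourier_L1E.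
  rewrite lee_wpmul2l ?lee_fin ?mulr_ge0 ?(ltW cd_gt0)//.
  apply: le_N2; [exact: cmeasurableB|apply: cmeasurableB => //; by case: inL2_invFT|].
  by move=> x; exact: fB_le.
Qed.

(** [fh_le] transfers the convergence in L^2 from the damped functions to their transforms; the
    pointwise limit, given by the approximate identity, identifies the limit as M. *)
Lemma is_fourier_invFT : is_fourier invFT M.
Proof.
split; [exact: inL2_invFT|exact: bounded_inL2|exists f].
have fL n : inL2 mu (f n).
  apply/inL2P; split => //; have /inL2P[mh] := inL2_invFT.
  apply: le_lt_trans; apply: le_N2 => // x; rewrite sqnM sqn_real ler_piMl ?sqn_ge0//.
  by have /andP[? ?] := L_bounds n x; rewrite expr_le1.
have fhL n : inL2 mu (fourier_L1 (f n)).
  apply/inL2P; split => //.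
  rewrite (@eq_N2 _ _ _ _ _ (FT (- 1) (f n))); last by move=> x; rewrite fourier_L1E.
  apply: le_lt_trans (plancherel_le _ _) _ => //; first by rewrite sqrrN expr1n.
  by rewrite lte_mul_pinfty ?lee_fin ?mulr_ge0 ?(ltW cd_gt0)//; case/inL2P : (fL n).
split => //.
  by apply: L2norm_cvg0 => // n; apply: inL2B => //; exact: inL2_invFT.
apply: L2norm_cvg0 => [n|]; first by apply: inL2B => //; exact: bounded_inL2.
have H : ((2 * cd)%:E * N2 mu (fun x => (f n x - invFT x)%R))%E @[n --> \oo] --> ((2 * cd)%:E * 0)%E.
  by apply: cvgeZl.
rewrite mule0 in H.
apply: squeeze_cvge (cvg_cst 0%E) H; apply: nearW => n.
by rewrite N2_ge0 fh_le.
Qed.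

End inverse_fourier.

(** * Wave packets *)

Section packet.
Context {R : realType} {d : nat}.
Local Notation E := ('rV[R]_d).
Local Notation mu := (@lebesgue_rV R d).
Local Notation leb := (@lebesgue_measure R).
Local Notation cd := ((2 * pi) ^+ d : R).

Lemma modulus_of_continuity (M : E -> R[i]) :
  continuous (fun xi => Re (M xi)) -> continuous (fun xi => Im (M xi)) ->
  forall eta eps, 0 < eps -> exists2 dl, 0 < dl &
  forall xi : E, (forall i, `|(xi - eta) ord0 i| < dl) -> Normc.normc (M xi - M eta) <= eps.
Proof.
move=> cR cI eta eps eps0; have e20 : 0 < eps / 2 by rewrite divr_gt0.
have /cvgrPdist_le/(_ _ e20) H1 := cR eta.
have /cvgrPdist_le/(_ _ e20) H2 := cI eta.
have [dl /= dl0 H] := iffLR (nbhs_ballP _ _) (filterI H1 H2).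
exists dl => // xi Hxi; have [/= h1 h2] : [set t : E | `|Re (M eta) - Re (M t)| <= eps / 2] xi /\
    [set t : E | `|Im (M eta) - Im (M t)| <= eps / 2] xi.
  apply: H; split => // i j; rewrite /ball/= (ord1 i) distrC.
  by have := Hxi j; rewrite !mxE.
apply: le_trans (normc_le_ReIm _) _; rewrite ReD ImD ReN ImN [leRHS]splitr.
by rewrite lerD// distrC.
Qed.

Lemma continuous_mulr (T : topologicalType) (f g : T -> R) :
  continuous f -> continuous g -> continuous (fun x => f x * g x).
Proof. by move=> cf cg x; apply: cvgM; [exact: cf|exact: cg]. Qed.

Lemma continuous_compr (T : topologicalType) (h : R -> R) (f : T -> R) :
  continuous h -> continuous f -> continuous (fun x => h (f x)).
Proof.
by move=> ch cf x; apply: (@continuous_comp _ _ _ f h); [exact: cf|exact: ch].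
Qed.

Lemma continuous_sumr (T : topologicalType) (I : Type) (s : seq I) (F : I -> T -> R) :
  (forall i, continuous (F i)) -> continuous (fun x => \sum_(i <- s) F i x).
Proof.
move=> cF; elim: s => [|i s IH].
  have -> : (fun x => \sum_(i <- [::]) F i x) = cst 0 by apply/funext => x; rewrite big_nil.
  exact: cst_continuous.
have -> : (fun x => \sum_(j <- i :: s) F j x) = (fun x => F i x + \sum_(j <- s) F j x).
  by apply/funext => x; rewrite big_cons.
by move=> x; apply: cvgD; [exact: cF|exact: IH].
Qed.

Lemma continuous_coord (i : 'I_d) : continuous (fun x : E => x ord0 i).
Proof. exact: coord_continuous. Qed.

Lemma continuous_dotp (x0 : E) : continuous (fun xi : E => dotp xi x0).
Proof.
apply: (continuous_sumr (F := fun i (xi : E) => xi ord0 i * x0 ord0 i)) => i.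
apply: continuous_mulr; first exact: continuous_coord.
exact: cst_continuous.
Qed.

Lemma continuous_lap (e : R) (a : E) : continuous (lap e a).
Proof.
have -> : lap e a = fun x => expR (- (e * \sum_(i < d) `|x ord0 i - a ord0 i|)).
  by apply/funext => x; rewrite lapE.
apply: (continuous_compr (h := fun r => expR (- (e * r)))).
  apply: (continuous_compr (h := @expR R)); first exact: continuous_expR.
  apply: continuous_compr; first exact: opp_continuous.
  exact: mulrl_continuous.
apply: (continuous_sumr (F := fun i (x : E) => `|x ord0 i - a ord0 i|)) => i.
apply: (continuous_compr (h := fun r : R => `|r - a ord0 i|)); last exact: continuous_coord.
apply: continuous_compr; first exact: norm_continuous.
by move=> x; apply: cvgB; [exact: cvg_id|exact: cvg_cst].
Qed.

(** By homogeneity this is |t^p - 1| <= |t - 1| for t = a / b, which holds because t^p lies between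
    1 and t. When p < 1 the factor b^(p-1) tends to 0 for large b; this is where s < 1/2 takes
    effect. *)
Lemma powR_dist_le (p a b : R) : 0 < p -> p <= 1 -> 0 <= a -> 0 < b ->
  `|a `^ p - b `^ p| <= b `^ (p - 1) * `|a - b|.
Proof.
move=> p0 p1 a0 b0; have b0' := ltW b0; have one : 1 `^ p = 1 :> R by rewrite powR1.
have -> : a `^ p - b `^ p = b `^ p * ((a / b) `^ p - 1).
  by rewrite mulrBr -powRM ?divr_ge0// mulrCA divff ?gt_eqF// !mulr1.
have -> : a - b = b * (a / b - 1) by field; rewrite gt_eqF.
rewrite !normrM (ger0_norm (powR_ge0 _ _)) (ger0_norm b0') mulrA.
rewrite (mulrC (b `^ (p - 1))) mulr_powRB1// ler_wpM2l ?powR_ge0//.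
have t0 : 0 <= a / b by rewrite divr_ge0.
move: (a / b) t0 => t; rewrite le_eqVlt => /predU1P[<-|t0].
  by rewrite powR0 ?gt_eqF.
have [t1|/ltW t1] := leP 1 t.
  rewrite !ger0_norm ?subr_ge0//; last by rewrite -one ge0_ler_powR ?nnegrE// ltW.
  by rewrite lerD2r ler1_powR.
have h : t <= t `^ p by rewrite ger1_powR// t0.
rewrite -(distrC 1) -(distrC 1) !ger0_norm ?subr_ge0//; last first.
  by rewrite -one ge0_ler_powR ?nnegrE// ltW.
by rewrite lerD2l lerN2.
Qed.

Lemma dotp_ge0 (xi : E) : 0 <= dotp xi xi.
Proof. by apply: sumr_ge0 => i _; rewrite -expr2 sqr_ge0. Qed.

Lemma enorm_sqr (xi : E) : enorm xi ^+ 2 = \sum_(i < d) xi ord0 i ^+ 2.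
Proof. by rewrite sqr_sqrtr ?dotp_ge0//; apply: eq_bigr => i _; rewrite expr2. Qed.

Lemma enorm_ge0 (xi : E) : 0 <= enorm xi. Proof. exact: sqrtr_ge0. Qed.

Lemma coord_le_enorm (xi : E) i : `|xi ord0 i| <= enorm xi.
Proof.
rewrite -(@ler_pXn2r _ 2) ?nnegrE ?enorm_ge0// enorm_sqr real_normK ?num_real//.
by rewrite (bigD1 i)//= lerDl sumr_ge0// => j _; exact: sqr_ge0.
Qed.

(** Multiply by |a| + |b|: the difference of squares splits over the coordinates, and |a_i + b_i| <=
    |a| + |b|. The 1-norm on the right matches the exponent of [lap]. *)
Lemma enorm_dist_le (a b : E) : `|enorm a - enorm b| <= \sum_(i < d) `|a ord0 i - b ord0 i|.
Proof.
have := addr_ge0 (enorm_ge0 a) (enorm_ge0 b); rewrite le_eqVlt => /predU1P[/esym/eqP|ab0].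
  rewrite paddr_eq0 ?enorm_ge0// => /andP[/eqP -> /eqP ->].
  by rewrite subrr normr0 sumr_ge0.
rewrite -(ler_pM2r ab0) -{1}(gtr0_norm ab0) -normrM -subr_sqr !enorm_sqr -sumrB.
apply: le_trans (ler_norm_sum _ _ _) _; rewrite mulr_suml; apply: ler_sum => i _.
rewrite subr_sqr normrM ler_wpM2l// (le_trans (ler_normD _ _))//.
by rewrite lerD// coord_le_enorm.
Qed.

Lemma continuous_norm_powR (p : R) : 0 < p -> p <= 1 ->
  continuous (fun r : R => `|r| `^ p).
Proof.
move=> p0 p1 b; apply/cvgrPdist_le => eps eps0.
have cn : `|r| @[r --> b] --> `|b| by exact: norm_continuous.
have [b0|b0] := eqVneq `|b| 0.
  (* At the origin [powR_dist_le] does not apply; the radius eps^(1/p) comes from inverting the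
     power. *)
  have e0 : 0 < eps `^ p^-1 by rewrite powR_gt0.
  move/cvgrPdist_lt : cn => /(_ _ e0); rewrite b0; apply: filterS => r.
  rewrite sub0r normrN normr_id powR0 ?gt_eqF// sub0r normrN => H.
  rewrite ger0_norm ?powR_ge0//; apply: (@le_trans _ _ ((eps `^ p^-1) `^ p)).
    by apply: ge0_ler_powR; rewrite ?nnegrE ?powR_ge0// ltW.
  by rewrite -powRrM mulVf ?gt_eqF// powRr1// ltW.
have b1 : 0 < `|b| by rewrite lt_def b0 normr_ge0.
have c0 : 0 < `|b| `^ (p - 1) by rewrite powR_gt0.
have e0 : 0 < eps / `|b| `^ (p - 1) by rewrite divr_gt0.
move/cvgrPdist_le : cn => /(_ _ e0); apply: filterS => r.
rewrite ler_pdivlMr// mulrC => H; rewrite distrC; apply: le_trans H.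
by rewrite (distrC `|b|); exact: powR_dist_le.
Qed.

Lemma continuous_enorm : continuous (@enorm R d).
Proof.
apply: (continuous_compr (h := @Num.sqrt R) (f := fun xi : E => dotp xi xi)).
  exact: sqrt_continuous.
apply: (continuous_sumr (F := fun i (xi : E) => xi ord0 i * xi ord0 i)) => i.
by apply: continuous_mulr; exact: continuous_coord.
Qed.

Lemma continuous_enorm_powR (p : R) : 0 < p -> p <= 1 ->
  continuous (fun xi : E => enorm xi `^ p).
Proof.
move=> p0 p1; have -> : (fun xi : E => enorm xi `^ p) = (fun xi => `|enorm xi| `^ p).
  by apply/funext => xi; rewrite ger0_norm// enorm_ge0.
apply: (continuous_compr (h := fun r => `|r| `^ p)); last exact: continuous_enorm.
exact: continuous_norm_powR.
Qed.

Lemma integral_lap (k : R) (q : E) : 0 < k ->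
  mu.-integrable setT (EFin \o lap k q) /\ Rintegral mu setT (lap k q) = (2 / k) ^+ d.
Proof.
move=> k0.
have [I1 E1] := integral_rV_prod (fun i : 'I_d => integrable_exp k0 (q ord0 i)).
split; first exact: I1.
rewrite [LHS]E1; under eq_bigr do rewrite /Rintegral (integral_exp k0)/=.
by rewrite prodr_const card_ord.
Qed.

(** Half of the exponential pays for the linear factor: with S the distance, (k / 2) S <= exp(k S /
    2). *)
Lemma dist1_lap_le (k : R) (q xi : E) : 0 < k ->
  (\sum_(i < d) `|xi ord0 i - q ord0 i|) * lap k q xi <= 2 / k * lap (k / 2) q xi.
Proof.
move=> k0; rewrite !lapE; set S := \sum_(i < d) _.
have -> : - (k * S) = - (k / 2 * S) + - (k / 2 * S) by lra.
rewrite expRD mulrA ler_wpM2r ?expR_ge0// expRN ler_pdivrMr ?expR_gt0//.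
apply: (@le_trans _ _ (2 / k * (k / 2 * S))).
  by rewrite le_eqVlt; apply/orP; left; apply/eqP; field; rewrite gt_eqF.
rewrite ler_wpM2l ?divr_ge0 ?(ltW k0)//.
by have := expR_ge1Dx (k / 2 * S); lra.
Qed.

(* In frequency: centred at [q] with width [k], and at [x0] in position. *)
Definition packet (w : E -> R) (k : R) (q x0 : E) (xi : E) : R[i] :=
  (w xi * lap k q xi)%:C%C * cis (- dotp xi x0).

Section packet_bounded.
Variables (w : E -> R) (k k' B : R) (q x0 : E).
Hypotheses (k'0 : 0 < k') (cw : continuous w) (mw : measurable_fun setT w).
Hypothesis wB : forall xi, `|w xi| * lap k q xi <= B * lap k' q xi.

Lemma normc_packet xi : Normc.normc (packet w k q x0 xi) = `|w xi| * lap k q xi.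
Proof.
by rewrite Normc.normcM normc_cis mulr1 normc_real normrM (gtr0_norm (lap_gt0 _ _ _)).
Qed.

Lemma cmeasurable_packet : cmeasurable (packet w k q x0).
Proof.
apply: cmeasurableM.
  apply: cmeasurable_real; apply: measurable_funM => //; exact: measurable_lap.
by apply: cmeasurable_cis; apply: measurableT_comp => //; exact: measurable_dotp.
Qed.

Lemma cintegrable_packet : cintegrable mu (packet w k q x0).
Proof.
have [I1 _] := integral_lap q k'0.
apply: (le_cintegrable (b := fun xi => B * lap k' q xi)).
- exact: cmeasurable_packet.
- exact: (integrableZl measurableT B I1).
- by move=> xi; rewrite normc_packet.
Qed.

Lemma normc_packet_le xi : Normc.normc (packet w k q x0 xi) <= B.
Proof.
have B0 : 0 <= B.
  rewrite -(pmulr_lge0 _ (lap_gt0 k' q xi)); apply: le_trans (wB xi).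
  by rewrite mulr_ge0// ltW// lap_gt0.
by rewrite normc_packet (le_trans (wB xi))// ler_piMr// lap_le1.
Qed.

(** The hypothesis [wB] yields both the sup bound and the integrability required by inversion. The
    rate k' may be smaller than k, the decay given up having absorbed the growth of w. *)
Lemma is_fourier_packet : is_fourier (invFT (packet w k q x0)) (packet w k q x0).
Proof.
apply: (is_fourier_invFT cintegrable_packet normc_packet_le).
have cwl : continuous (fun xi => w xi * lap k q xi).
  by apply: continuous_mulr => //; exact: continuous_lap.
have cd : continuous (fun xi => - dotp xi x0).
  apply: (continuous_compr (h := -%R)); first exact: opp_continuous.
  exact: continuous_dotp.
apply: modulus_of_continuity.
  have -> : (fun xi => Re (packet w k q x0 xi)) =
      (fun xi => (w xi * lap k q xi) * cos (- dotp xi x0)).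
    by apply/funext => xi; rewrite /packet ReM /= mul0r subr0.
  apply: continuous_mulr => //; apply: (continuous_compr (h := @cos R)) => //.
  exact: continuous_cos.
have -> : (fun xi => Im (packet w k q x0 xi)) =
    (fun xi => (w xi * lap k q xi) * sin (- dotp xi x0)).
  by apply/funext => xi; rewrite /packet ImM /= mul0r addr0.
apply: continuous_mulr => //; apply: (continuous_compr (h := @sin R)) => //.
exact: continuous_sin.
Qed.

End packet_bounded.

Lemma N2_invFT_le (M : E -> R[i]) : cintegrable mu M ->
  (N2 mu (invFT M) <= (2 / cd)%:E * N2 mu M)%E.
Proof.
move=> MI; have cd0 : 0 < cd := cd_gt0.
have c0 : 0 <= cd^-1 ^+ 2 by exact: sqr_ge0.
have mFT := cmeasurable_FT (expr1n R 2) MI.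
have -> : (N2 mu (invFT M) = (cd^-1 ^+ 2)%:E * N2 mu (FT 1 M))%E.
  rewrite /N2 -ge0_integralZl//; last 2 first.
  - exact/measurable_EFinP/measurable_sqn.
  - by move=> x _; rewrite lee_fin sqn_ge0.
  by apply: eq_integral => x _; rewrite (sqnM _ (FT 1 M x)) sqn_real EFinM.
apply: (@le_trans _ _ ((cd^-1 ^+ 2)%:E * ((2 * cd)%:E * N2 mu M))%E).
  by rewrite lee_wpmul2l ?lee_fin//; exact: plancherel_le (expr1n _ _) MI.
rewrite muleA -EFinM (_ : _ * (2 * _) = 2 / cd)//; field.
by rewrite gt_eqF.
Qed.

(** q enters only through a phase, so the modulus of the packet, hence its norm and its mass on
    omega, is the same for all q. *)
Lemma invFT_packet (c k : R) (q x0 x : E) : 0 < k ->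
  invFT (packet (fun=> c) k q x0) x =
  (c / cd)%:C%C * cis (dotp q (x - x0)) * (cauchy_rV k (x - x0))%:C%C.
Proof.
move=> k0; have [lI E1] := FT_lap 1 q (x - x0) k0.
have -> : (c / cd)%:C%C * cis (dotp q (x - x0)) * (cauchy_rV k (x - x0))%:C%C =
    (cd^-1)%:C%C * (c%:C%C * FT 1 (fun xi => (lap k q xi)%:C%C) (x - x0)).
  by rewrite E1 mul1r scale1r rmorphM/= -!mulrA mulrCA.
rewrite /invFT; congr (_ * _); rewrite /FT -cintegralZ; last exact: cintegrable_cis.
apply: eq_cintegral => xi; rewrite !mul1r dotpBr cisD /packet rmorphM/=.
by rewrite -!mulrA mulrCA; congr (_ * (_ * _)); exact: mulrC.
Qed.

Lemma cauchy_sqr_le (k y : R) : 0 < k -> cauchy k y ^+ 2 <= 2 / k * cauchy k y.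
Proof.
move=> k0; rewrite expr2 ler_wpM2r ?cauchy_ge0// /cauchy.
rewrite ler_pdivrMr ?cauchy_den// -mulrA ler_wpM2l// mulrC ler_pdivlMr//.
by rewrite -expr2 lerDl sqr_ge0.
Qed.

Lemma cauchy_sqr_tail (k r y : R) : 0 < k -> 0 < r -> r <= `|y| ->
  cauchy k y ^+ 2 <= 2 * k / r ^+ 2 * cauchy k y.
Proof.
move=> k0 r0 ry; rewrite expr2 ler_wpM2r ?cauchy_ge0// /cauchy.
rewrite ler_wpM2l ?mulr_ge0 ?(ltW k0)// lef_pV2 ?posrE ?cauchy_den ?exprn_gt0//.
apply: (@le_trans _ _ (y ^+ 2)); last by rewrite lerDr sqr_ge0.
by rewrite -[leRHS]real_normK ?num_real// ler_pXn2r ?nnegrE// ltW.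
Qed.

Lemma measurable_cauchyB (k c : R) : 0 < k -> measurable_fun setT (fun r : R => cauchy k (r - c)).
Proof.
move=> k0; apply: measurableT_comp; first exact: measurable_cauchy.
exact: measurable_funB.
Qed.

Lemma integrable_cauchy_sqr (k c : R) : 0 < k ->
  leb.-integrable setT (EFin \o (fun r => cauchy k (r - c) ^+ 2)).
Proof.
move=> k0; have I1 := integrableZl measurableT (2 / k) (integrable_cauchy c k0).
apply: le_integrable I1 => //.
  by apply/measurable_EFinP/measurable_funX; exact: measurable_cauchyB.
move=> r _; have c0 := cauchy_ge0 (r - c) k0.
have c1 : 0 <= 2 / k * cauchy k (r - c) by rewrite mulr_ge0// divr_ge0// ltW.
by rewrite lee_fin (ger0_norm (sqr_ge0 _)) (ger0_norm c1) cauchy_sqr_le.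
Qed.

(** On [c - k, c + k], of length 2 k, the kernel is at least 1 / k. This lower bound suffices for
    the localization, so the exact integral is not computed. *)
Lemma Rintegral_cauchy_sqr_ge (k c : R) : 0 < k ->
  2 / k <= Rintegral leb setT (fun r => cauchy k (r - c) ^+ 2).
Proof.
move=> k0; have I1 := integrable_cauchy_sqr c k0.
rewrite -lee_fin fineK; last exact: integrable_fin_num.
have mI : measurable (`[c - k, c + k]%classic : set (measurableTypeR R)) by [].
apply: (@le_trans _ _ (\int[leb]_(r in `[(c - k)%R, (c + k)%R]) (k ^- 2)%:E)%E).
  have E1 : leb `[(c - k)%R, (c + k)%R] = (2 * k)%:E.
    rewrite lebesgue_measure_itv/= lte_fin ifT; last by lra.
    by rewrite -EFinD; congr EFin; ring.
  have -> : (\int[leb]_(r in `[(c - k)%R, (c + k)%R]) (k ^- 2)%:E = (k ^- 2)%:E * (2 * k)%:E)%E.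
    by rewrite -E1; exact: integral_cst.
  rewrite -EFinM lee_fin le_eqVlt; apply/orP; left; apply/eqP.
  by field; rewrite gt_eqF.
apply: (@le_trans _ _ (\int[leb]_(r in `[(c - k)%R, (c + k)%R]) (cauchy k (r - c) ^+ 2)%:E)%E).
  apply: ge0_le_integral => //.
  - by move=> r _; rewrite lee_fin invr_ge0 sqr_ge0.
  - apply: measurable_funTS; apply/measurable_EFinP/measurable_funX.
    exact: measurable_cauchyB.
  - move=> r; rewrite /= in_itv/= => /andP[r1 r2]; rewrite lee_fin -exprVn.
    rewrite ler_pXn2r ?nnegrE ?cauchy_ge0 ?invr_ge0 ?(ltW k0)//.
    rewrite /cauchy ler_pdivlMr ?cauchy_den// -ler_pdivlMl ?invr_gt0// invrK.
    rewrite (_ : k * (2 * k) = k ^+ 2 + k ^+ 2); last by ring.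
    by rewrite lerD2l; have : 0 <= (k - (r - c)) * (k + (r - c)); [apply: mulr_ge0; lra|nra].
apply: ge0_subset_integral => //.
- apply/measurable_EFinP/measurable_funX; exact: measurable_cauchyB.
- by move=> r _; rewrite lee_fin sqr_ge0.
Qed.

(** The amplitude c is produced before q, which matters because |q| will later be taken large
    depending on c. A point of omega has a coordinate at distance at least r from x0, so the mass on
    omega is at most a sum over coordinates of one-dimensional tails. *)
Lemma packet_localized (k r : R) (x0 : E) (om : set E) : 0 < k -> 0 < r ->
  measurable om -> (forall x, om x -> exists i, r <= `|x ord0 i - x0 ord0 i|) ->
  exists2 c : R, 0 < c & forall q, let g := invFT (packet (fun=> c) k q x0) in
    inL2 mu g -> nrm mu g = 1 /\
    nrm mu (fun x => (\1_om x)%:C%C * g x) ^+ 2 <= d%:R * (2 * pi * k ^+ 2 / r ^+ 2).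
Proof.
move=> k0 r0 mom omr; have cd0 : 0 < cd := cd_gt0.
pose J i := Rintegral leb setT (fun y => cauchy k (y - x0 ord0 i) ^+ 2).
have Jge i : 2 / k <= J i := Rintegral_cauchy_sqr_ge _ k0.
have J0 i : 0 < J i by apply: lt_le_trans (Jge i); rewrite divr_gt0.
have PJ0 : 0 < \prod_(i < d) J i by apply: prodr_gt0.
(* Normalizes the packet: |g|^2 is (c / cd)^2 times the product of the integrals [J i]. *)
pose c := cd / Num.sqrt (\prod_(i < d) J i).
have c0 : 0 < c by rewrite divr_gt0// sqrtr_gt0.
have cE : (c / cd) ^+ 2 * \prod_(i < d) J i = 1.
  have -> : c / cd = (Num.sqrt (\prod_(i < d) J i))^-1.
    by rewrite /c mulrC mulrA mulVf ?mul1r// gt_eqF.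
  rewrite exprVn sqr_sqrtr ?(ltW PJ0)//.
  by rewrite mulVf// gt_eqF.
exists c => // q g gL.
have gE x : sqn (g x) = (c / cd) ^+ 2 * \prod_(i < d) cauchy k (x ord0 i - x0 ord0 i) ^+ 2.
  rewrite /g invFT_packet// !sqnM sqn_cis mulr1 !sqn_real; congr (_ * _).
  by rewrite /cauchy_rV -prodrXl; apply: eq_bigr => i _; rewrite !mxE.
have [PI PE] := integral_rV_prod (fun i : 'I_d => integrable_cauchy_sqr (x0 ord0 i) k0).
have cZ (f : E -> R) b : mu.-integrable setT (EFin \o f) ->
    (\int[mu]_x (b * f x)%:E = (b * Rintegral mu setT f)%:E)%E.
  move=> fI; under eq_integral do rewrite EFinM.
  by rewrite integralZl// EFinM fineK//; exact: integrable_fin_num.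
split.
  rewrite /nrm /N2; under eq_integral do rewrite gE.
  by rewrite cZ// PE cE/= sqrtr1.
(* In coordinate i one factor of the squared kernel is replaced by its bound 2 k / r^2 outside
   radius r; the other factor keeps the mass 2 pi. *)
pose f (i j : 'I_d) y := if j == i then 2 * k / r ^+ 2 * cauchy k (y - x0 ord0 j)
  else cauchy k (y - x0 ord0 j) ^+ 2.
have f0 i j y : 0 <= f i j y.
  rewrite /f; case: ifP => _; last exact: sqr_ge0.
  by rewrite mulr_ge0 ?cauchy_ge0// divr_ge0 ?sqr_ge0// mulr_ge0// ltW.
have fI i j : leb.-integrable setT (EFin \o f i j).
  have -> : f i j = if j == i then (fun y => 2 * k / r ^+ 2 * cauchy k (y - x0 ord0 j))
      else (fun y => cauchy k (y - x0 ord0 j) ^+ 2).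
    by apply/funext => y; rewrite /f; case: ifP.
  case: ifP => _; last exact: integrable_cauchy_sqr.
  exact: (integrableZl measurableT _ (integrable_cauchy (x0 ord0 j) k0)).
pose F i (x : E) := \prod_(j < d) f i j (x ord0 j).
have FI i := (integral_rV_prod (fI i)).1.
have FE i : Rintegral mu setT (F i) <= 2 * pi * k ^+ 2 / r ^+ 2 * \prod_(j < d) J j.
  rewrite (integral_rV_prod (fI i)).2 (bigD1 i)//= [in leRHS](bigD1 i)//= mulrA.
  rewrite [in leLHS](eq_bigr J) => [|j /negbTE ji]; last by rewrite /f ji.
  rewrite ler_wpM2r//; first by apply: prodr_ge0 => j _; exact: ltW.
  have -> : Rintegral leb setT (f i i) = 2 * k / r ^+ 2 * (2 * pi).
    rewrite /f eqxx RintegralZl//; last exact: integrable_cauchy.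
    by rewrite /Rintegral integral_cauchy.
  (* The tail 4 pi k / r^2 is measured against [J i] >= 2 / k; the quotient is of order k^2 and
     vanishes with k. *)
  apply: (@le_trans _ _ (2 * pi * k ^+ 2 / r ^+ 2 * (2 / k))).
    by rewrite le_eqVlt; apply/orP; left; apply/eqP; field; rewrite !gt_eqF.
  by rewrite ler_wpM2l// divr_ge0 ?sqr_ge0// mulr_ge0 ?sqr_ge0// mulr_ge0// pi_ge0.
have [SI SE] := Rintegral_sum (index_enum 'I_d) FI.
have ogL := inL2_indicM mom gL.
rewrite -lee_fin -inL2_N2//.
apply: (@le_trans _ _ (\int[mu]_x ((c / cd) ^+ 2 * \sum_i F i x)%:E)%E).
  apply: ge0_le_integral => //.
  - by move=> x _; rewrite lee_fin sqn_ge0.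
  - by apply/measurable_EFinP/measurable_sqn; case: ogL.
  - by case/integrableP : (integrableZl measurableT ((c / cd) ^+ 2) SI).
  move=> x _; rewrite lee_fin sqnM sqn_real gE indicE.
  have F0 i : 0 <= F i x by apply: prodr_ge0.
  case: (boolP (x \in om)) => [|_]; last first.
    by rewrite expr0n mul0r mulr_ge0 ?sqr_ge0 ?sumr_ge0.
  rewrite inE => /omr[i ri]; rewrite expr1n mul1r ler_wpM2l ?sqr_ge0//.
  rewrite (bigD1 i)//= [leRHS](bigD1 i)//=; apply: ler_wpDr; first exact: sumr_ge0.
  rewrite [leRHS](bigD1 i)//= {1}/f eqxx.
  rewrite [in leRHS](eq_bigr (fun j => cauchy k (x ord0 j - x0 ord0 j) ^+ 2)); last first.
    by move=> j /negbTE ji; rewrite /f ji.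
  rewrite ler_wpM2r//; last exact: cauchy_sqr_tail.
  by apply: prodr_ge0 => j _; exact: sqr_ge0.
rewrite cZ// SE lee_fin.
apply: (@le_trans _ _ ((c / cd) ^+ 2 * \sum_(i < d) (2 * pi * k ^+ 2 / r ^+ 2 * \prod_(j < d) J j))).
  by rewrite ler_wpM2l ?sqr_ge0//; apply: ler_sum => i _; exact: FE.
have X (a e P : R) n : a * P = 1 -> a * (e * P *+ n) <= n%:R * e.
  move=> aP; have -> : a * (e * P *+ n) = n%:R * e * (a * P) by rewrite -mulr_natl; ring.
  by rewrite aP mulr1.
by rewrite sumr_const card_ord; exact: X.
Qed.

Section symbol.
Variables (p c k : R) (q x0 : E).
Hypotheses (p0 : 0 < p) (p1 : p <= 1) (c0 : 0 < c) (k0 : 0 < k) (q0 : 0 < enorm q).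

Let w (xi : E) : R := c * enorm xi `^ p.

(** The increment of the symbol is at most |q|^(p-1) times the 1-norm distance to q, and the
    exponential absorbs that distance at the cost of halving its rate. *)
Lemma symbol_dist_le xi : `|w xi - c * enorm q `^ p| * lap k q xi <=
  c * enorm q `^ (p - 1) * (2 / k) * lap (k / 2) q xi.
Proof.
have b0 := powR_ge0 (enorm q) (p - 1).
rewrite /w -mulrBr normrM (gtr0_norm c0) -!mulrA ler_wpM2l ?(ltW c0)//.
apply: (@le_trans _ _ (enorm q `^ (p - 1) *
    (\sum_(i < d) `|xi ord0 i - q ord0 i|) * lap k q xi)).
  rewrite ler_wpM2r ?(ltW (lap_gt0 _ _ _))//.
  apply: le_trans (powR_dist_le p0 p1 (enorm_ge0 xi) q0) _.
  by rewrite ler_wpM2l// enorm_dist_le.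
by rewrite -mulrA ler_wpM2l// mulrA; exact: dist1_lap_le.
Qed.

(** Makes the packet weighted by the symbol bounded and integrable, so that its inverse transform h
    is available. *)
Lemma symbol_le xi : `|w xi| * lap k q xi <=
  (c * enorm q `^ p + c * enorm q `^ (p - 1) * (2 / k)) * lap (k / 2) q xi.
Proof.
have L0 := lap_gt0 k q xi; have cq0 : 0 <= c * enorm q `^ p by rewrite mulr_ge0 ?powR_ge0// ltW.
have H : `|w xi| <= `|w xi - c * enorm q `^ p| + c * enorm q `^ p.
  by rewrite -[X in _ <= _ + X](ger0_norm cq0) -lerBlDr lerB_dist.
apply: le_trans (ler_wpM2r (ltW L0) H) _; rewrite mulrDl [leRHS]mulrDl addrC.
apply: lerD; last exact: symbol_dist_le.
rewrite ler_wpM2l// !lapE ler_expR lerN2 ler_wpM2r ?sumr_ge0//.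
by have := k0; lra.
Qed.

(** The residual h - |q|^p g is the inverse transform of the packet weighted by the deviation of the
    symbol from its value at q. Here 2 / cd is the Plancherel constant and (4 / k)^d the integral of
    the kernel of rate k / 2. *)
Lemma packet_quasimode (g := invFT (packet (fun=> c) k q x0)) (h := invFT (packet w k q x0)) :
  [/\ is_fourier g (packet (fun=> c) k q x0),
      is_fourier h (packet w k q x0) &
      nrm mu (fun x => h x - (enorm q `^ p)%:C%C * g x) ^+ 2 <=
      2 / cd * (c * enorm q `^ (p - 1) * (2 / k)) ^+ 2 * (4 / k) ^+ d].
Proof.
have k20 : 0 < k / 2 by rewrite divr_gt0.
have cw : continuous w.
  apply: (continuous_compr (h := *%R c)); first exact: mulrl_continuous.
  exact: continuous_enorm_powR.
have cc : continuous (fun _ : E => c) by exact: cst_continuous.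
have mc : measurable_fun setT (fun _ : E => c) by exact: measurable_cst.
have mw : measurable_fun setT w.
  apply: measurable_funM => //; apply: (measurableT_comp (measurable_powR p)).
  apply: (@measurableT_comp _ _ _ _ _ _ (@Num.sqrt R) _ (fun xi : E => dotp xi xi)).
    by apply: continuous_measurable_fun; exact: sqrt_continuous.
  by apply: measurable_sum => i; apply: measurable_funM; exact: measurable_coord.
have gF := is_fourier_packet x0 k0 cc mc (fun xi => lexx (`|c| * lap k q xi)).
have hF := is_fourier_packet x0 k20 cw mw symbol_le.
split=> //.
have MI := cintegrable_packet x0 k0 mc (fun xi => lexx (`|c| * lap k q xi)).
have WI := cintegrable_packet x0 k20 mw symbol_le.
set lam := enorm q `^ p.
have gL : inL2 mu g by case: gF.
have hL : inL2 mu h by case: hF.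
pose D xi := packet w k q x0 xi - lam%:C%C * packet (fun=> c) k q x0 xi.
have DI : cintegrable mu D by apply: cintegrableB => //; exact: cintegrableZ.
have ED : (fun x => h x - lam%:C%C * g x) = invFT D.
  apply/funext => x; rewrite /invFT /D FTB//; last exact: cintegrableZ.
  by rewrite FTZ// mulrBr mulrCA.
rewrite -lee_fin -inL2_N2; last by apply: inL2B => //; exact: inL2Z.
rewrite ED; apply: le_trans (N2_invFT_le DI) _.
rewrite -(mulrA (2 / cd)) [leRHS]EFinM.
apply: lee_wpmul2l; first by rewrite lee_fin divr_ge0// ltW// cd_gt0.
set B := c * enorm q `^ (p - 1) * (2 / k).
have [LI LE] := integral_lap q k20.
(* The square of the kernel is bounded by the kernel itself, which is at most 1 and has a known
   integral. *)
apply: (@le_trans _ _ (\int[mu]_xi ((B ^+ 2)%:E * (lap (k / 2) q xi)%:E))%E); last first.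
  rewrite integralZl// (EFinM (B ^+ 2)) (_ : 4 / k = 2 / (k / 2)); last by field; rewrite gt_eqF.
  by rewrite -LE fineK//; exact: integrable_fin_num.
apply: ge0_le_integral => //.
- by move=> xi _; rewrite lee_fin sqn_ge0.
- by apply/measurable_EFinP/measurable_sqn; case/cintegrableP : DI.
- by case/integrableP : (integrableZl measurableT (B ^+ 2) LI).
move=> xi _; rewrite -EFinM lee_fin.
have -> : D xi = ((w xi - c * lam) * lap k q xi)%:C%C * cis (- dotp xi x0).
  by rewrite /D /packet mulrA -rmorphM/= -mulrBl -rmorphB/=; congr (_%:C%C * _); ring.
rewrite sqnM sqn_cis mulr1 sqn_real -real_normK ?num_real//.
rewrite normrM (gtr0_norm (lap_gt0 _ _ _)).
have H := symbol_dist_le xi; rewrite -/lam -/B in H.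
have Lh := lap_gt0 (k / 2) q xi.
apply: (@le_trans _ _ ((B * lap (k / 2) q xi) ^+ 2)).
  rewrite ler_pXn2r// nnegrE; first by rewrite mulr_ge0// ltW// lap_gt0.
  by apply: le_trans H; rewrite mulr_ge0// ltW// lap_gt0.
rewrite exprMn ler_wpM2l ?sqr_ge0// expr2 ler_piMl ?(ltW Lh)//.
exact: lap_le1.
Qed.

End symbol.

End packet.

(** * Existence of localized quasimodes of the fractional Laplacian *)

Section quasimodes.
Context {R : realType} {d : nat}.
Local Notation E := ('rV[R]_d.+1).
Local Notation mu := (@lebesgue_rV R d.+1).
Local Notation cd := ((2 * pi) ^+ d.+1 : R).

Lemma enorm_delta (b : R) : 0 <= b -> enorm (b *: delta_mx ord0 ord0 : E) = b.
Proof.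
move=> b0; rewrite -[RHS](ger0_norm b0) -sqrtr_sqr; congr Num.sqrt.
rewrite /dotp (bigD1 ord0)//= big1 => [|i i0]; last first.
  by rewrite !mxE (negbTE i0) andbF mulr0 mul0r.
by rewrite !mxE !eqxx mulr1 addr0 expr2.
Qed.

(* [k] is chosen first, for the localization; then |q|^(2s - 1) -> 0 as
   |q| -> oo makes the residual small. *)
Lemma frac_laplacian_quasimode (s : R) (x0 : E) (r T eps : R) (om : set E) :
  0 < s -> s < 1 / 2 -> 0 < r -> 0 < T -> 0 < eps -> measurable om ->
  (forall x, om x -> exists i, r <= `|x ord0 i - x0 ord0 i|) ->
  exists (g h : E -> R[i]) (lam : R),
    [/\ inL2 mu g, inL2 mu h, frac_laplacian s g h, nrm mu g = 1 &
    nrm mu (fun x => (\1_om x)%:C%C * g x) +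
      T * nrm mu (fun x => h x - lam%:C%C * g x) <= eps].
Proof.
move=> s0 s1 r0 T0 eps0 mom omr.
have cd0 : 0 < cd := @cd_gt0 R d.+1.
have pi0 : 0 < pi :> R := pi_gt0 R.
(* The squared mass on omega is at most A k^2; k is chosen to make this (eps / 2)^2. *)
pose A : R := d.+1%:R * (2 * pi) / r ^+ 2.
have A0 : 0 < A by rewrite divr_gt0 ?exprn_gt0// mulr_gt0// mulr_gt0.
pose k := eps / 2 / Num.sqrt A.
have k0 : 0 < k by rewrite !divr_gt0// sqrtr_gt0.
have kE : d.+1%:R * (2 * pi * k ^+ 2 / r ^+ 2) = (eps / 2) ^+ 2.
  transitivity (A * k ^+ 2); first by rewrite /A; field; rewrite gt_eqF.
  rewrite /k expr_div_n sqr_sqrtr ?(ltW A0)//; field.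
  by rewrite gt_eqF.
have [c c0 Hc] := packet_localized k0 r0 mom omr.
pose p := 2 * s.
have p0 : 0 < p by rewrite mulr_gt0.
have p1 : p < 1 by rewrite /p; lra.
(* The squared residual is at most B |q|^(2 (p - 1)), and B involves only c and k, already fixed. *)
pose B := 2 / cd * (c * (2 / k)) ^+ 2 * (4 / k) ^+ d.+1.
have B0 : 0 < B.
  apply: mulr_gt0; last by rewrite exprn_gt0// divr_gt0.
  by apply: mulr_gt0; rewrite ?exprn_gt0 ?divr_gt0// mulr_gt0// divr_gt0.
pose dl := eps / 2 / T / Num.sqrt B.
have dl0 : 0 < dl by rewrite !divr_gt0// sqrtr_gt0.
(* The solution of b^(p-1) = dl. Since p - 1 < 0, a small tolerance dl forces a large frequency. *)
pose b := dl `^ (p - 1)^-1.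
have b0 : 0 < b by rewrite powR_gt0.
have bE : b `^ (p - 1) = dl.
  by rewrite -powRrM mulVf ?powRr1 ?(ltW dl0)// lt_eqF// subr_lt0.
pose q : E := b *: delta_mx ord0 ord0.
have qE : enorm q = b by rewrite enorm_delta// ltW.
have q0 : 0 < enorm q by rewrite qE.
have [gF hF Hh] := packet_quasimode x0 p0 (ltW p1) c0 k0 q0.
set g := invFT (packet (fun=> c) k q x0) in gF Hh.
set h := invFT _ in hF Hh.
have gL : inL2 mu g by case: gF.
have hL : inL2 mu h by case: hF.
have [g1 g2] := Hc q gL.
exists g, h, (enorm q `^ p); split => //.
  (* h was defined as the inverse transform of |xi|^(2s) times the packet, so (g, h) lies in the
     graph of the operator by construction. *)
  exists (packet (fun=> c) k q x0); split => //.
  congr is_fourier : hF; apply/funext => xi.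
  by rewrite /packet mulrA -rmorphM/=; congr (_%:C%C * _); ring.
rewrite [leRHS]splitr; apply: lerD.
  by rewrite -(@ler_pXn2r _ 2) ?nnegrE ?nrm_ge0 ?divr_ge0 ?(ltW eps0)// -kE.
rewrite mulrC -ler_pdivlMr// -(@ler_pXn2r _ 2) ?nnegrE ?nrm_ge0 ?divr_ge0 ?(ltW eps0) ?(ltW T0)//.
apply: le_trans Hh _; rewrite qE bE le_eqVlt; apply/orP; left; apply/eqP.
transitivity (dl ^+ 2 * B); first by rewrite /B; field; rewrite !gt_eqF.
rewrite /dl expr_div_n sqr_sqrtr ?(ltW B0)// divfK// gt_eqF//.
Qed.

End quasimodes.

(** * Measurability of open sets, and the conclusion *)

(** The sigma-algebra is generated by the coordinates, so an open set is written as the countable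
    union of the boxes with rational centre and radius 1 / (k + 1) that it contains. *)
Lemma measurable_open_rV (R : realType) (n : nat) (A : set 'rV[R]_n) :
  open A -> measurable A.
Proof.
move=> oA; pose e (k : nat) : R := k.+1%:R^-1.
have e0 k : 0 < e k by rewrite invr_gt0.
pose box (p : {ffun 'I_n -> rat} * nat) : set 'rV[R]_n :=
  [set v | forall i, `]ratr (p.1 i) - e p.2, ratr (p.1 i) + e p.2[%classic (v ord0 i)].
have mbox p : measurable (box p).
  apply: (measurable_box (A := fun i => `]ratr (p.1 i) - e p.2, ratr (p.1 i) + e p.2[%classic)).
  by move=> i; exact: measurable_itv.
(* Boxes are enumerated by their codes; integers that code no box, or a box not contained in A,
   contribute the empty set. *)
pose B m := if unpickle m is Some p then if pselect (box p `<=` A) then box p else set0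
  else set0.
suff -> : A = \bigcup_m B m.
  apply: bigcup_measurable => m _; rewrite /B.
  move: (unpickle m) => [p|]; last exact: measurable0.
  by case: ifP => _; [exact: mbox|exact: measurable0].
apply/seteqP; split => [x Ax|x [m _]]; last first.
  by rewrite /B; move: (unpickle m) => [p|//]; case: pselect => // pA /pA.
have [r /= r0 rA] := iffLR (nbhs_ballP _ _) (open_nbhs_nbhs (conj oA Ax)).
(* Half of r, since two points of the box are compared through its rational centre. *)
have [k /= kr] : exists k, e k < r / 2.
  have r2 : 0 < r / 2 by rewrite divr_gt0.
  have /cvgrPdist_lt/(_ _ r2)[k _ /(_ k (leqnn k))] := @cvg_harmonic R.
  by rewrite /= sub0r normrN gtr0_norm ?invr_gt0// => kr; exists k.
have /choice[c Hc] (i : 'I_n) : exists c : rat, `|x ord0 i - ratr c| < e k.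
  have /rat_in_itvoo[c] : x ord0 i - e k < x ord0 i + e k by have := e0 k; lra.
  by rewrite in_itv/= -ltr_distlC => H; exists c.
exists (pickle ([ffun i => c i], k)) => //; rewrite /B pickleK.
have xbox : box ([ffun i => c i], k) x.
  by move=> i /=; rewrite ffunE in_itv/= -ltr_distlC distrC.
case: pselect => [//|]; case => v Hv; apply: rA; split => // i j.
rewrite (ord1 i) /ball/= -(subrK (ratr (c j)) (x ord0 j)) -addrA.
rewrite (le_lt_trans (ler_normD _ _))// [r]splitr ltrD//; apply: lt_trans kr; first exact: Hc.
by have := Hv j; rewrite /= ffunE in_itv/= -ltr_distlC.
Qed.

Theorem corollary2p9 (R : realType) (d : nat) (s : R) (omega : set 'rV[R]_d)
    (hd : (1 <= d)%N) (hs0 : 0 < s) (hs1 : s < 1 / 2) (homega : open omega)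
    (hcontrol : exists2 T : R, 0 < T &
       exactly_controllable (frac_laplacian s) omega T) :
  interior (~` omega) = set0.
Proof.
(* A positive dimension provides the coordinate axis along which the frequencies q go to
   infinity. *)
case: d hd omega homega hcontrol => // d _ omega oom [T T0 [U UA ctrl]].
have mom := measurable_open_rV oom.
rewrite -subset0 => x0 /= x0om.
have [r /= r0 rom] := iffLR (nbhs_ballP _ _) x0om.
(* Balls are those of the sup norm, so a point outside the ball has one coordinate far from that of
   x0, as the product structure of the packets requires. *)
have omr (x : 'rV[R]_d.+1) : omega x -> exists i, r <= `|x ord0 i - x0 ord0 i|.
  move=> omx; apply: contrapT => /forallNP H; apply: (rom x) omx; split => // i j.
  by rewrite (ord1 i) /ball/= distrC ltNge; apply/negP/H.
pose mu := @lebesgue_rV R d.+1.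
have /choice[Q HQ] (k : nat) : exists Q : ('rV[R]_d.+1 -> R[i]) * ('rV[R]_d.+1 -> R[i]) * R,
    [/\ inL2 mu Q.1.1, inL2 mu Q.1.2, frac_laplacian s Q.1.1 Q.1.2, nrm mu Q.1.1 = 1 &
    nrm mu (fun x => (\1_omega x)%:C%C * Q.1.1 x) +
      T * nrm mu (fun x => Q.1.2 x - (Q.2)%:C%C * Q.1.1 x) <= 9^-1 ^+ k].
  have e0 : 0 < 9^-1 ^+ k :> R by rewrite exprn_gt0// invr_gt0.
  have [g [h [lam H]]] := frac_laplacian_quasimode hs0 hs1 r0 T0 e0 mom omr.
  by exists (g, h, lam).
have gL k : inL2 mu (Q k).1.1 by case: (HQ k).
have g1 k : nrm mu (Q k).1.1 = 1 by case: (HQ k).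
have [fT fTL fTg] := gliding_hump gL g1.
(* Starting from 0, the final state is the Duhamel integral up to U T 0. *)
have [u [f [[uL _] fmild ffT]]] := ctrl _ fT (inL2_0 mu) fTL.
have [|I BI fI] := fmild T; first by rewrite lexx ltW.
have IL : inL2 mu I by case: BI.
have [C HC] := control_rip_le UA mom T0 uL BI.
(* U acts on representatives, so U T 0 is not literally the zero function; it only has norm 0. *)
pose Z := U T (fun=> 0).
have ZL : inL2 mu Z := group_L2 UA T (inL2_0 mu).
have Z0 : nrm mu Z = 0.
  by rewrite /Z (unitary_nrm UA)//; [exact: nrm_ae0 (inL2_0 mu) (aeW _ _)|exact: inL2_0].
have ripI k : rip mu fT (Q k).1.1 = rip mu I (Q k).1.1.
  have -> : rip mu fT (Q k).1.1 = rip mu (fun x => Z x + I x) (Q k).1.1.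
    apply: rip_ae => //; first exact: inL2D.
    by apply: filterS2 ffT fI => x <- <-.
  rewrite ripDl// [X in X + _](_ : _ = 0) ?add0r//; apply/eqP.
  by rewrite -normr_le0; apply: le_trans (rip_le _ _) _ => //; rewrite Z0 mul0r.
(* The lower bound 3^-k / 2 and the upper bound 9^-k C, divided by 3^-k 3^-k. *)
have bound k : 3 ^+ k <= 2 * C.
  have [_ hL gh _ geps] := HQ k.
  have e0 : 0 < 9^-1 ^+ k :> R by rewrite exprn_gt0// invr_gt0.
  have := le_trans (fTg k); rewrite ripI => /(_ _ (HC _ _ _ _ (gL k) hL gh e0 geps)).
  rewrite (_ : 9^-1 = 3^-1 * 3^-1); last by field.
  rewrite exprMn -mulrA ler_pM2l ?exprn_gt0 ?invr_gt0//.
  rewrite exprVn ler_pdivlMl ?exprn_gt0// => H.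
  by have := H; lra.
(* An integer n > |2 C| would satisfy 3^n <= 2 C < n, against n < 3^n. *)
have := archi_boundP (normr_ge0 (2 * C)); set n := Num.bound _ => Cn.
have := le_lt_trans (le_trans (bound n) (ler_norm _)) Cn.
apply/negP; rewrite -leNgt -natrX ler_nat ltnW//; exact: ltn_expl.
Qed.
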